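(* Let $A\in\mathbb C^{n\times n}$; let $z_1,z_2,\dots,z_N\in\mathbb C$ be arbitrary (possibly repeated) points of interpolation; let $f$ be an analytic function defined on a neighborhood of the convex hull of the union of the spectrum $\sigma(A)$ and the set $\{z_1,\dots,z_N\}$; let $r=\frac uv$ be a rational function of degree $[L/M]$, with $L\le N-1$, that interpolates $f$ at the points $z_1,\dots,z_N$ (counted according to their multiplicities); and let $v(z_k)\ne0$ for $k=1,2,\dots,N$ and $v(\lambda)\neq0$ for all $\lambda\in\sigma(A)$. Put $\Omega(z)=\prod_{k=1}^N(z-z_k)$. Then for any norm $\lVert\cdot\rVert$ on the linear space $\mathbb C^{n\times n}$, $$\bigl\lVert f(A)-r(A)\bigr\rVert\le\max_{\substack{t\in[0,1]\\ \mu\in\operatorname{co}\{z_1,z_2,\dots,z_N\}}}\biggl\lVert\Omega(A)[v(A)]^{-1}\frac{(vf)^{(N)}\bigl((1-t)\mu\mathbf 1+tA\bigr)}{N!}\biggr\rVert.$$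
   Context: $\mathbf 1$ is the identity matrix and $\operatorname{co}M$ is the convex hull of $M\subset\mathbb C$. If $g$ is analytic on an open (possibly disconnected) set containing $\sigma(B)$, then $g(B)=\frac1{2\pi i}\int_\Gamma g(\lambda)(\lambda\mathbf 1-B)^{-1}d\lambda$, where the contour $\Gamma$ encloses $\sigma(B)$; $(vf)^{(N)}$ is the $N$-th complex derivative of the product $vf$, and it is applied to the matrix $(1-t)\mu\mathbf 1+tA$ in this sense. A rational function $r=u/v$ of degree $[L/M]$ means that $u,v$ are polynomials with $\deg u\le L$, $\deg v\le M$. ''$r$ interpolates $f$ at $z_1,\dots,z_N$ counted according to their multiplicities'' means: if $\zeta_1,\dots,\zeta_m$ are the distinct values in the list $z_1,\dots,z_N$ and $n_k$ is the number of occurrences of $\zeta_k$ in the list (so $N=\sum_k n_k$), then $r^{(j)}(\zeta_k)=f^{(j)}(\zeta_k)$ for $k=1,\dots,m$, $j=0,1,\dots,n_k-1$. *)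

(* Defs.v *)
(* The complex field R[i] is a numFieldType, hence a normed space over itself;
   R[i]^o is its alias carrying that structure. *)
From HB Require Import structures.
From mathcomp Require Import all_boot all_order all_algebra.
From mathcomp Require Import all_classical all_reals all_analysis.
From mathcomp Require Import complex.

Set Implicit Arguments.
Unset Strict Implicit.
Unset Printing Implicit Defensive.

Import Order.TTheory GRing.Theory Num.Theory.
Import numFieldNormedType.Exports.

Local Open Scope classical_set_scope.
Local Open Scope ring_scope.
Local Open Scope complex_scope.

(* convex_set is taken over the scalars R[i]: since 0 <= t <= 1 in R[i] forces
   t to be real, this is ordinary convexity in the plane. *)
Definition co (R : realType) (M : set R[i]) : set R[i] :=
  smallest (@convex_set R[i] R[i]^o) M.

Definition spectrum (R : realType) (n : nat) (A : 'M[R[i]]_n) : set R[i] :=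
  [set a | eigenvalue A a].

Definition cderive (R : realType) (N : nat) (g : R[i] -> R[i]) : R[i] -> R[i] :=
  derive1n N (g : R[i] -> R[i]^o).

(* Complex differentiability: the difference quotients have complex
   increments. *)
Definition analytic_on (R : realType) (U : set R[i]) (g : R[i] -> R[i]) : Prop :=
  open (U : set R[i]^o) /\
  forall x, U x -> derivable (g : R[i]^o -> R[i]^o) x 1.

Definition cintegral (R : realType) (a b : R) (h : R -> R[i]) : R[i] :=
  (\int[lebesgue_measure]_(s in `[a, b]) complex.Re (h s))%R +i*
  (\int[lebesgue_measure]_(s in `[a, b]) complex.Im (h s))%R.

Definition expi (R : realType) (s : R) : R[i] := cos s +i* sin s.

(* With lambda = c + rho e^(i s), d lambda = i rho e^(i s) ds. *)
Definition circle_integral (R : realType) (c : R[i]) (rho : R)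
    (h : R[i] -> R[i]) : R[i] :=
  cintegral 0 (2 * pi)
    (fun s => h (c + rho%:C * expi s) * ('i * rho%:C * expi s)).

(* A contour is the positively oriented boundary of a finite union of disjoint
   closed disks, given by the list of their centres and radii. *)
Definition contour (R : realType) := seq (R[i] * R).

Definition contour_integral (R : realType) (G : contour R)
    (h : R[i] -> R[i]) : R[i] :=
  \sum_(d <- G) circle_integral d.1 d.2 h.

Definition encloses (R : realType) (U S : set R[i]) (G : contour R) : Prop :=
  [/\ forall d, d \in G -> 0 < d.2,
      pairwise (fun d e => d.2 + e.2 < Normc.normc (d.1 - e.1)) G,
      forall d, d \in G -> [set x | Normc.normc (x - d.1) <= d.2] `<=` U
    & forall x, S x -> exists2 d, d \in G & Normc.normc (x - d.1) < d.2].

(* g(B) for g analytic on the open set U containing the spectrum of B, the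
   integral being taken entrywise. Some contour in U encloses the spectrum
   (small circles around the eigenvalues), and by Cauchy's theorem the value
   does not depend on which one is chosen. *)
Definition matfun (R : realType) (n : nat) (U : set R[i]) (g : R[i] -> R[i])
    (B : 'M[R[i]]_n) : 'M[R[i]]_n :=
  let G := xget [::] [set G | encloses U (spectrum B) G] in
  \matrix_(i, j) ((2 * pi%:C * 'i)^-1 *
    contour_integral G (fun x => g x * invmx (x%:M - B) i j)).

Definition ratfun (R : realType) (u v : {poly R[i]}) : R[i] -> R[i] :=
  fun x => u.[x] / v.[x].

Definition interpolates (R : realType) (N : nat) (z : N.-tuple R[i])
    (f r : R[i] -> R[i]) : Prop :=
  forall (x : R[i]) (j : nat), x \in z -> (j < count_mem x z)%N ->
    cderive j r x = cderive j f x.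

Definition is_norm (R : realType) (n : nat) (nrm : 'M[R[i]]_n -> R) : Prop :=
  [/\ forall B, nrm B = 0 -> B = 0,
      forall (a : R[i]) B, nrm (a *: B) = Normc.normc a * nrm B
    & forall B D, nrm (B + D) <= nrm B + nrm D].

(* Main.v *)
(* Since u interpolates v f, one has v f - u = Omega h with h the divided
   difference of v f - u at the points z_k, hence
   f(A) - r(A) = Omega(A) v(A)^-1 h(A).  By the Hermite-Genocchi formula h(A) is an
   average of the matrices (v f)^(N)((1 - t) mu + t A) / N!, so its image under any
   seminorm is bounded by the maximum over t and mu.  The averaging is done one
   point z_k at a time, each step being a maximum principle for the norm along a
   segment.  The complex analysis needed (Cauchy's formula, analyticity of divided
   differences, the functional calculus) is derived from Goursat's theorem. *)
Require Import Defs.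
From HB Require Import structures.
From mathcomp Require Import all_boot all_order all_algebra.
From mathcomp Require Import all_classical all_reals all_analysis.
From mathcomp Require Import complex.
From mathcomp Require Import ring lra.

Set Implicit Arguments.
Unset Strict Implicit.
Unset Printing Implicit Defensive.

Import Order.TTheory GRing.Theory Num.Theory.
Import numFieldNormedType.Exports.

Local Open Scope classical_set_scope.
Local Open Scope ring_scope.
Local Open Scope complex_scope.

(** * The modulus on the complex numbers *)

(** The averaging integral is never formed. For g x = g y + (x - y) e x, Leibniz's rule gives
    g^(j+1) = (j + 1) e^(j) + (x - y) e^(j+1); on the segment x = y + t (B - y) this is (j + 1) E +
    t E' with E t = e^(j)(y + t (B - y)). So a bound on (j + 1) E + t E' must yield one on E 1, and
    the successive divisions by j + 1 produce N!. The obstacle is that E must be differentiable in t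
    while the eigenvalues move, although each E t is defined by a contour that is merely chosen.
    Hence g(B) is first identified with p(B) whenever g = p + chi q, chi being the characteristic
    polynomial of B, and the remainders are bounded uniformly over a family of matrices, through
    Newton interpolation with divided differences controlled on a compact convex set. The hypothesis
    must hold on whole segments towards each z_k, so the induction runs over a family star-shaped
    about every z_k: all matrices (1 - t) mu + t A. As v may vanish in the hull, v f - u is analytic
    there but f - r need not be; L <= N - 1 removes u from the N-th derivative. *)

Section Cplx.
Variable R : realType.
Implicit Types (x y w : R[i]) (e : R).
Local Notation nc := Normc.normc.

Lemma normcE x : `|x| = (nc x)%:C. Proof. by []. Qed.
Lemma normcoE (x : R[i]^o) : `|x| = (nc x)%:C. Proof. by []. Qed.
Lemma nc_ge0 x : 0 <= nc x.
Proof. by case: x => a b; rewrite /= sqrtr_ge0. Qed.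
Lemma nc0 : nc (0 : R[i]) = 0. Proof. exact: Normc.normc0. Qed.
Lemma nc1 : nc (1 : R[i]) = 1. Proof. exact: Normc.normc1. Qed.
Lemma nc_eq0 x : (nc x == 0) = (x == 0).
Proof. by apply/eqP/eqP => [/Normc.eq0_normc//|->]; rewrite nc0. Qed.
Lemma nc_gt0 x : (0 < nc x) = (x != 0).
Proof. by rewrite lt_def nc_ge0 andbT nc_eq0. Qed.
Lemma ncM x y : nc (x * y) = nc x * nc y. Proof. exact: Normc.normcM. Qed.
Lemma ncV x : nc x^-1 = (nc x)^-1. Proof. exact: Normc.normcV. Qed.
Lemma ncN x : nc (- x) = nc x. Proof. by apply/complexI; rewrite -!normcE normrN. Qed.
Lemma ncB x y : nc (x - y) = nc (y - x). Proof. by rewrite -ncN opprB. Qed.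
Lemma ncD x y : nc (x + y) <= nc x + nc y.
Proof. exact: le_normcD. Qed.
Lemma nc_tri x y w : nc (x - w) <= nc (x - y) + nc (y - w).
Proof. by rewrite -(subrK y x) -addrA addrK; exact: ncD. Qed.
Lemma ncR (a : R) : nc a%:C = `|a|.
Proof. by rewrite /Normc.normc /= expr0n addr0 sqrtr_sqr. Qed.
Lemma rcD (a b : R) : (a + b)%:C = a%:C + b%:C :> R[i]. Proof. exact: rmorphD. Qed.
Lemma rcB (a b : R) : (a - b)%:C = a%:C - b%:C :> R[i]. Proof. exact: rmorphB. Qed.
Lemma rcN (a : R) : (- a)%:C = - a%:C :> R[i]. Proof. exact: rmorphN. Qed.
Lemma rcM (a b : R) : (a * b)%:C = a%:C * b%:C :> R[i]. Proof. exact: rmorphM. Qed.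
Lemma rcV (a : R) : (a^-1)%:C = (a%:C)^-1 :> R[i]. Proof. exact: fmorphV. Qed.
Lemma rc1 : 1%:C = 1 :> R[i]. Proof. exact: rmorph1. Qed.
Lemma rc_nat (n : nat) : n%:R%:C = n%:R :> R[i]. Proof. exact: rmorph_nat. Qed.
Lemma nc_Re x : `|complex.Re x| <= nc x.
Proof. by rewrite -lecR -normcE normc_ge_Re. Qed.
Lemma nc_i : nc ('i : R[i]) = 1.
Proof. by rewrite /Normc.normc /= expr0n expr1n add0r sqrtr1. Qed.
Lemma nc_Im x : `|complex.Im x| <= nc x.
Proof. by have := nc_Re (x * 'i); rewrite ReiNIm ncM nc_i mulr1 normrN. Qed.
Lemma nc_ReIm x : nc x <= `|complex.Re x| + `|complex.Im x|.
Proof.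
rewrite {1}[x]complexE; apply: le_trans (ncD _ _) _.
by rewrite ncM nc_i mul1r !ncR.
Qed.
Lemma nc_sum (I : Type) (s : seq I) (P : pred I) (F : I -> R[i]) :
  nc (\sum_(i <- s | P i) F i) <= \sum_(i <- s | P i) nc (F i).
Proof.
elim/big_ind2: _ => // [|x a y b xa yb]; first by rewrite nc0.
by apply: le_trans (ncD _ _) _; exact: lerD.
Qed.
Lemma ltc_exists (e : R[i]) : 0 < e -> exists2 r : R, 0 < r & e = r%:C.
Proof. by case: e => a b; rewrite ltcE /= => /andP[/eqP -> a0]; exists a. Qed.
Lemma nbhs_ncP (x : R[i]^o) (P : set R[i]^o) :
  nbhs x P <-> exists2 d : R, 0 < d & forall y, nc (y - x) < d -> P y.
Proof.
split=> [/nbhs_ballP[e /= /ltc_exists[r r0 ->]] H|[d d0 H]].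
  exists r => // y yx; apply: H; rewrite -ball_normE /= /ball_/= normcoE ltcR.
  by rewrite -ncN opprB.
apply/nbhs_ballP; exists d%:C; first by rewrite /= ltcR.
by move=> y; rewrite -ball_normE /= /ball_/= normcoE ltcR => yx; apply: H; rewrite -ncN opprB.
Qed.
Lemma open_ncP (U : set R[i]^o) : open U <->
  forall x, U x -> exists2 d : R, 0 < d & forall y, nc (y - x) < d -> U y.
Proof.
rewrite openE; split => H x /H; first by move/nbhs_ncP.
by move=> ?; apply/nbhs_ncP.
Qed.
Lemma cvg_ncP (T : Type) (F : set_system T) {FF : Filter F} (h : T -> R[i]^o) (l : R[i]^o) :
  h @ F --> l <-> forall e : R, 0 < e -> \forall t \near F, nc (h t - l) < e.
Proof.
split=> [H e e0|H].
  have : nbhs l [set y | nc (y - l) < e] by apply/nbhs_ncP; exists e.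
  by move=> /H.
move=> P /nbhs_ncP[d d0 PP]; rewrite nbhs_filterE.
by apply: filterS (H _ d0) => t; exact: PP.
Qed.
(** The denominator of the difference quotient is cleared. The bound is not strict, so y = x
    satisfies it trivially and the punctured neighbourhood disappears. *)
Lemma derivable_ncP (g : R[i]^o -> R[i]^o) (x D : R[i]^o) :
  is_derive x 1 g D <->
  forall e : R, 0 < e -> exists2 d : R, 0 < d &
    forall y, nc (y - x) < d -> nc (g y - g x - D * (y - x)) <= e * nc (y - x).
Proof.
have E1 (a b c : R[i]) : c != 0 -> a - b * c = c * (c^-1 * a - b).
  by move=> c0; rewrite mulrBr mulVKf // [c * b]mulrC.
have E2 (a b c : R[i]) : c != 0 -> c^-1 * a - b = c^-1 * (a - b * c).
  by move=> c0; rewrite mulrBr [b * c]mulrC mulKf.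
have key : ((fun h : R[i]^o => h^-1 *: ((g \o shift x) (h *: (1:R[i]^o)) - g x) : R[i]^o) @ (0:R[i]^o)^' --> (D:R[i]^o)) <->
  forall e : R, 0 < e -> exists2 d : R, 0 < d &
    forall y, nc (y - x) < d -> nc (g y - g x - D * (y - x)) <= e * nc (y - x).
  rewrite cvg_ncP; split=> H e e0.
    have /nbhs_ncP[d d0 Hd] := H _ e0; exists d => // y yx.
    have [->|nyx] := eqVneq y x; first by rewrite !subrr mulr0 subr0 nc0 mulr0.
    have yx0 : y - x != 0 by rewrite subr_eq0.
    have := Hd (y - x); rewrite /= subr0 => /(_ yx yx0); rewrite /shift /=.
    rewrite [_ *: 1]mulr1 subrK => /ltW K.
    by rewrite (E1 _ _ _ yx0) ncM mulrC ler_wpM2r // nc_ge0.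
  have e20 : 0 < e / 2 by rewrite divr_gt0.
  have [d d0 Hd] := H _ e20; apply/nbhs_ncP; exists d => // h; rewrite subr0 => hd /= h0.
  have := Hd (h + x); rewrite addrK => /(_ hd) K.
  rewrite /shift /= [_ *: 1]mulr1.
  move: (E2 (g (h + x) - g x) D h h0) => /(congr1 (@Normc.normc R)) /= ->.
  rewrite ncM ncV; apply: le_lt_trans (_ : e / 2 < e); last first.
    by rewrite ltr_pdivrMr // ltr_pMr // ltr1n.
  by rewrite mulrC ler_pdivrMr ?nc_gt0.
rewrite -key; split => [[gx <-]|H]; first exact: gx.
by apply: DeriveDef; [apply/cvg_ex; exists D | exact: cvg_lim H].
Qed.
End Cplx.

(** * Complex derivatives and integrals of complex-valued functions *)

Section Calc.
Variable R : realType.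
Implicit Types (x y w : R[i]) (e : R).
Local Notation nc := (@Normc.normc R).

(** The derivative is an explicit argument, so that the rules below compute it; the alias [R[i]^o]
    stays hidden. *)
Definition cdiff (g : R[i] -> R[i]) (x D : R[i]) : Prop :=
  is_derive (x : R[i]^o) 1 (g : R[i]^o -> R[i]^o) D.

Definition ccts (T : topologicalType) (h : T -> R[i]) (t : T) : Prop :=
  {for t, continuous (h : T -> R[i]^o)}.

Lemma cctsP (T : topologicalType) (h : T -> R[i]) t :
  ccts h t <-> forall e, 0 < e -> \forall s \near t, nc (h s - h t) < e.
Proof. exact: cvg_ncP. Qed.

Lemma ccts_complexP (g : R[i] -> R[i]) x :
  ccts (g : R[i]^o -> R[i]) x <-> forall e, 0 < e -> exists2 d, 0 < d &
     forall y, nc (y - x) < d -> nc (g y - g x) < e.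
Proof.
rewrite cctsP; split=> H e /H; first by move/nbhs_ncP.
by move=> ?; apply/nbhs_ncP.
Qed.

Lemma ccts_cst (T : topologicalType) (c : R[i]) (t : T) : ccts (fun=> c) t.
Proof. exact: cvg_cst. Qed.
Lemma ccts_id (x : R[i]) : ccts (id : R[i]^o -> R[i]) x.
Proof. exact: cvg_id. Qed.
Lemma cctsD (T : topologicalType) (g h : T -> R[i]) t :
  ccts g t -> ccts h t -> ccts (fun s => g s + h s) t.
Proof. exact: continuousD. Qed.
Lemma cctsB (T : topologicalType) (g h : T -> R[i]) t :
  ccts g t -> ccts h t -> ccts (fun s => g s - h s) t.
Proof. exact: continuousB. Qed.
Lemma cctsM (T : topologicalType) (g h : T -> R[i]) t :
  ccts g t -> ccts h t -> ccts (fun s => g s * h s) t.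
Proof. exact: (@continuousM _ T g h t). Qed.
Lemma cctsV (T : topologicalType) (g : T -> R[i]) t :
  g t != 0 -> ccts g t -> ccts (fun s => (g s)^-1) t.
Proof. exact: (@continuousV _ T g t). Qed.
Lemma ccts_comp (T : topologicalType) (h : T -> R[i]) (g : R[i] -> R[i]) t :
  ccts h t -> ccts (g : R[i]^o -> R[i]) (h t) -> ccts (fun s => g (h s)) t.
Proof. by move=> ch cg; exact: (@cvg_comp _ _ _ h g _ _ _ ch cg). Qed.
Lemma ccts_real (T : topologicalType) (h : T -> R) t :
  {for t, continuous h} -> ccts (fun s => (h s)%:C) t.
Proof.
move=> ch; apply/cctsP => e e0.
move/cvgrPdist_lt: ch => /(_ e e0); apply: filterS => s.
by rewrite -[_%:C - _]raddfB ncR distrC.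
Qed.
Lemma continuous_Re (T : topologicalType) (h : T -> R[i]) t :
  ccts h t -> {for t, continuous (fun s => complex.Re (h s))}.
Proof.
move=> /cctsP ch; apply/cvgrPdist_lt => e e0; apply: filterS (ch e e0) => s.
by apply: le_lt_trans; rewrite distrC -raddfB nc_Re.
Qed.
Lemma continuous_Im (T : topologicalType) (h : T -> R[i]) t :
  ccts h t -> {for t, continuous (fun s => complex.Im (h s))}.
Proof.
move=> /cctsP ch; apply/cvgrPdist_lt => e e0; apply: filterS (ch e e0) => s.
by apply: le_lt_trans; rewrite distrC -raddfB nc_Im.
Qed.

Lemma continuous_nc (T : topologicalType) (h : T -> R[i]) t :
  ccts h t -> {for t, continuous (fun s => nc (h s))}.
Proof.
move=> /cctsP ch; apply/cvgrPdist_lt => e e0; apply: filterS (ch e e0) => s.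
apply: le_lt_trans; rewrite distrC ler_norml lerNl opprB !lerBlDr; apply/andP; split.
  by rewrite ncB; apply: le_trans (ncD _ _); rewrite subrK.
by apply: le_trans (ncD _ _); rewrite subrK.
Qed.

Lemma cdiffP g x D : cdiff g x D <->
  forall e : R, 0 < e -> exists2 d : R, 0 < d &
    forall y, nc (y - x) < d -> nc (g y - g x - D * (y - x)) <= e * nc (y - x).
Proof. exact: derivable_ncP. Qed.
Lemma cdiff_derive1 g x D : cdiff g x D -> cderive 1 g x = D.
Proof. by move=> H; rewrite /cderive /derive1n /= derive1E; case: H. Qed.
Lemma cdiff_eq g x D D' : cdiff g x D -> D = D' -> cdiff g x D'.
Proof. by move=> H <-. Qed.
Lemma cdiff_cst c x : cdiff (fun=> c) x 0.
Proof. exact: is_derive_cst. Qed.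
Lemma cdiff_id x : cdiff id x 1.
Proof. exact: is_derive_id. Qed.
Lemma cdiffD g h x D E : cdiff g x D -> cdiff h x E ->
  cdiff (fun y => g y + h y) x (D + E).
Proof. exact: is_deriveD. Qed.
Lemma cdiffB g h x D E : cdiff g x D -> cdiff h x E ->
  cdiff (fun y => g y - h y) x (D - E).
Proof. exact: is_deriveB. Qed.
Lemma cdiffM g h x D E : cdiff g x D -> cdiff h x E ->
  cdiff (fun y => g y * h y) x (g x * E + h x * D).
Proof. exact: is_deriveM. Qed.
Lemma cdiff_local (g h : R[i] -> R[i]) x D d : 0 < d ->
  (forall y, nc (y - x) < d -> g y = h y) -> cdiff g x D -> cdiff h x D.
Proof.
move=> d0 gh /cdiffP H; apply/cdiffP => e /H[d' d'0 Hd].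
exists (Num.min d d'); first by rewrite lt_min d0.
move=> y; rewrite lt_min => /andP[yd yd'].
by rewrite -!gh ?Hd // subrr nc0.
Qed.
Lemma cdiff_ccts g x D : cdiff g x D -> ccts (g : R[i]^o -> R[i]) x.
Proof.
move=> /cdiffP H; apply/ccts_complexP => e e0.
have [d d0 Hd] := H 1 ltr01.
have K0 : 0 < 1 + nc D by rewrite ltr_wpDr // nc_ge0.
exists (Num.min d (e / (1 + nc D))); first by rewrite lt_min d0 divr_gt0.
move=> y; rewrite lt_min => /andP[/Hd yd]; rewrite ltr_pdivlMr // => ye.
apply: le_lt_trans ye; rewrite mulrDr mulr1 mulrC.
have -> : g y - g x = g y - g x - D * (y - x) + D * (y - x) by rewrite subrK.
apply: le_trans (ncD _ _) _; rewrite ncM mulrC; apply: lerD; last by rewrite mulrC.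
by move: yd; rewrite mul1r.
Qed.
Lemma cdiffV g x D : g x != 0 -> cdiff g x D ->
  cdiff (fun y => (g y)^-1) x (- (g x) ^- 2 * D).
Proof.
move=> g0 gD; have [dg <-] := gD.
by apply: DeriveDef; [exact: derivableV|rewrite deriveV].
Qed.
Lemma analytic_cdiff U g x : analytic_on U g -> U x -> cdiff g x (cderive 1 g x).
Proof.
by move=> [_ H] /H dg; rewrite /cderive /derive1n /= derive1E; exact: derivableP.
Qed.
Lemma analyticP (U : set R[i]) g :
  analytic_on U g <-> open (U : set R[i]^o) /\ forall x, U x -> exists D, cdiff g x D.
Proof.
split=> [ag|[oU H]].
  by split=> [|x /(analytic_cdiff ag) ?]; [case: ag|eexists; eassumption].
by split=> // x /H[D []].
Qed.
Lemma analytic_ccts U g x : analytic_on U g -> U x -> ccts (g : R[i]^o -> R[i]) x.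
Proof. by move=> ag /(analytic_cdiff ag) /cdiff_ccts. Qed.

Implicit Types (h k : R -> R[i]) (a b c : R).

(** Two-sided continuity, end points included: it is inherited from pointwise continuity of the
    factors, without subspace topologies. *)
Definition ccts_on a b h := forall s, a <= s <= b -> ccts h s.

Lemma cint_integrable_Re a b h : ccts_on a b h ->
  lebesgue_measure.-integrable `[a, b] (EFin \o (fun s => complex.Re (h s))).
Proof.
move=> ch; apply: continuous_compact_integrable; first exact: segment_compact.
apply: continuous_in_subspaceT => s; rewrite inE /= in_itv /= => /ch.
exact: continuous_Re.
Qed.
Lemma cint_integrable_Im a b h : ccts_on a b h ->
  lebesgue_measure.-integrable `[a, b] (EFin \o (fun s => complex.Im (h s))).
Proof.
move=> ch; apply: continuous_compact_integrable; first exact: segment_compact.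
apply: continuous_in_subspaceT => s; rewrite inE /= in_itv /= => /ch.
exact: continuous_Im.
Qed.

Lemma eq_cintegral a b h k : (forall s, a <= s <= b -> h s = k s) ->
  cintegral a b h = cintegral a b k.
Proof.
move=> hk; rewrite /cintegral; congr (_ +i* _); apply: eq_Rintegral => s;
by rewrite inE /= in_itv /= => /hk ->.
Qed.

Lemma cintegralD a b h k : ccts_on a b h -> ccts_on a b k ->
  cintegral a b (fun s => h s + k s) = cintegral a b h + cintegral a b k.
Proof.
move=> ch ck; rewrite /cintegral.
under eq_Rintegral do rewrite raddfD /=.
rewrite RintegralD //; [|exact: cint_integrable_Re..].
congr (_ +i* _).
under eq_Rintegral do rewrite raddfD /=.
by rewrite RintegralD //; exact: cint_integrable_Im.
Qed.

Lemma cintegralZ a b (c : R[i]) h : ccts_on a b h ->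
  cintegral a b (fun s => c * h s) = c * cintegral a b h.
Proof.
move=> ch; rewrite /cintegral; case: c => p q.
have E s : (p +i* q) * h s = (p * complex.Re (h s) - q * complex.Im (h s)) +i*
   (p * complex.Im (h s) + q * complex.Re (h s)) by case: (h s).
under eq_Rintegral do rewrite E /=.
(* A real multiple of h scales both components, so each term of [E] inherits integrability from a
   continuous complex function. *)
have cs r : ccts_on a b (fun s => r%:C * h s).
  by move=> s /ch ?; apply: cctsM => //; exact: ccts_cst.
have iR r : lebesgue_measure.-integrable `[a, b] (EFin \o (fun s => r * complex.Re (h s))).
  have := cint_integrable_Re (cs r); congr (_.-integrable _ _); apply/funext => s /=.
  by case: (h s) => ? ? /=; rewrite mul0r subr0.
have iI r : lebesgue_measure.-integrable `[a, b] (EFin \o (fun s => r * complex.Im (h s))).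
  have := cint_integrable_Im (cs r); congr (_.-integrable _ _); apply/funext => s /=.
  by case: (h s) => ? ? /=; rewrite mul0r addr0.
rewrite RintegralB // !RintegralZl //; [|exact: cint_integrable_Im|exact: cint_integrable_Re].
under [X in _ +i* X]eq_Rintegral do rewrite E /=.
by rewrite RintegralD // !RintegralZl //; [exact: cint_integrable_Re|exact: cint_integrable_Im].
Qed.

Lemma cintegralN a b h : ccts_on a b h ->
  cintegral a b (fun s => - h s) = - cintegral a b h.
Proof.
move=> ch; rewrite -mulN1r -cintegralZ //.
by apply: eq_cintegral => s _; rewrite mulN1r.
Qed.
Lemma cintegralB a b h k : ccts_on a b h -> ccts_on a b k ->
  cintegral a b (fun s => h s - k s) = cintegral a b h - cintegral a b k.
Proof.
move=> ch ck; rewrite cintegralD // ?cintegralN // => s sab.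
have := cctsB (@ccts_cst _ 0 s) (ck _ sab).
by congr (ccts _ _); apply/funext => u; rewrite sub0r.
Qed.

Lemma cintegral_cst a b (c : R[i]) : a <= b -> cintegral a b (fun=> c) = (b - a)%:C * c.
Proof.
move=> ab; rewrite /cintegral !Rintegral_cst // /= lebesgue_measure_itv /= lte_fin.
move: ab; rewrite le_eqVlt => /predU1P[->|ab].
  by rewrite ltxx subrr /= !mulr0 mul0r.
by rewrite ab /=; case: c => p q; simpc; rewrite ![(b - a) * _]mulrC.
Qed.

(** Serves the integral of 1 / (y - x) over a circle, one term of which is handled through its
    conjugate. *)
Lemma cintegral_conj a b h : ccts_on a b h ->
  cintegral a b (fun s => (h s)^*) = (cintegral a b h)^*.
Proof.
move=> ch; rewrite /cintegral.
under [X in _ +i* X]eq_Rintegral => s _.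
  rewrite (_ : complex.Im _ = (-1) * complex.Im (h s)); first by over.
  by rewrite mulN1r; case: (h s).
rewrite RintegralZl //; last exact: cint_integrable_Im.
rewrite mulN1r /=; congr (_ +i* _).
by apply: eq_Rintegral => s _; case: (h s).
Qed.

(* The factor 2 comes from bounding the real and imaginary parts separately. *)
Lemma nc_cintegral a b h C : a <= b -> ccts_on a b h ->
  (forall s, a <= s <= b -> nc (h s) <= C) -> nc (cintegral a b h) <= 2 * C * (b - a).
Proof.
move=> ab ch hC; rewrite mulrAC mulr2n !mulrDl mul1r.
have leb f : lebesgue_measure.-integrable `[a, b] (EFin \o f) ->
    (forall s, a <= s <= b -> `|f s| <= C) ->
    `|\int[lebesgue_measure]_(s in `[a, b]) f s| <= (b - a) * C.
  move=> fi fC; apply: le_trans (le_normr_Rintegral _ _) _ => //.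
  have : \int[lebesgue_measure]_(s in `[a, b]) `|f s| <=
         \int[lebesgue_measure]_(s in `[a, b]) (cst C s).
    apply: le_Rintegral => //.
    - exact: integrable_norm fi.
    - apply: continuous_compact_integrable; first exact: segment_compact.
      by apply: continuous_subspaceT => ?; exact: cvg_cst.
  move=> /le_trans; apply.
  rewrite Rintegral_cst //= lebesgue_measure_itv /= lte_fin.
  move: ab; rewrite le_eqVlt => /predU1P[->|ab]; first by rewrite ltxx subrr mulr0 mul0r.
  by rewrite ab /= mulrC.
apply: le_trans (nc_ReIm _) _; apply: lerD; apply: leb.
- exact: cint_integrable_Re.
- by move=> s /hC; apply: le_trans; exact: nc_Re.
- exact: cint_integrable_Im.
- by move=> s /hC; apply: le_trans; exact: nc_Im.
Qed.

Lemma cintegral_split a b c h : a <= b -> b <= c -> ccts_on a c h ->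
  cintegral a c h = cintegral a b h + cintegral b c h.
Proof.
move=> ab bc ch.
have spl f : lebesgue_measure.-integrable `[a, c] (EFin \o f) ->
    \int[lebesgue_measure]_(s in `[a, c]) f s =
    \int[lebesgue_measure]_(s in `[a, b]) f s + \int[lebesgue_measure]_(s in `[b, c]) f s.
  move=> fi; apply/eqP; rewrite addrC -subr_eq; apply/eqP.
  rewrite Rintegral_itvB //; first rewrite Rintegral_itv_obnd_cbnd //.
  by apply: integrableS fi => //; apply: subset_itv; rewrite bnd_simp.
rewrite /cintegral !spl //; [exact: cint_integrable_Im|exact: cint_integrable_Re].
Qed.

(* Derivative of a complex-valued function of a real variable: R[i] is not a
   normed space over R in the library, so it is taken componentwise. *)
Definition rdiff h (s : R) (D : R[i]) : Prop :=
  is_derive s 1 (fun t => complex.Re (h t)) (complex.Re D) /\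
  is_derive s 1 (fun t => complex.Im (h t)) (complex.Im D).

Lemma rdiff_eq h s D D' : rdiff h s D -> D = D' -> rdiff h s D'.
Proof. by move=> H <-. Qed.
Lemma rdiff_cst (c : R[i]) s : rdiff (fun=> c) s 0.
Proof. by split; exact: is_derive_cst. Qed.
Lemma rdiff_real s : rdiff (fun t => t%:C) s 1.
Proof. by split; [exact: is_derive_id|exact: is_derive_cst]. Qed.
Lemma rdiff_expi s : rdiff (@expi R) s ('i * expi s).
Proof.
split; rewrite /expi /=; simpc; [exact: is_derive_cos|exact: is_derive_sin].
Qed.
Lemma rdiffD h k s D E : rdiff h s D -> rdiff k s E -> rdiff (fun t => h t + k t) s (D + E).
Proof.
move=> [h1 h2] [k1 k2]; split; rewrite raddfD.
  rewrite (_ : (fun _ => _) = (fun t => complex.Re (h t)) \+ (fun t => complex.Re (k t))).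
    exact: is_deriveD.
  by apply/funext => t; rewrite raddfD.
rewrite (_ : (fun _ => _) = (fun t => complex.Im (h t)) \+ (fun t => complex.Im (k t))).
  exact: is_deriveD.
by apply/funext => t; rewrite raddfD.
Qed.
Lemma rdiffM h k s D E : rdiff h s D -> rdiff k s E ->
  rdiff (fun t => h t * k t) s (h s * E + k s * D).
Proof.
move=> [h1 h2] [k1 k2].
have ReM x y : complex.Re (x * y) =
    complex.Re x * complex.Re y - complex.Im x * complex.Im y by case: x; case: y.
have ImM x y : complex.Im (x * y) =
    complex.Re x * complex.Im y + complex.Im x * complex.Re y by case: x; case: y.
have ReD x y : complex.Re (x + y) = complex.Re x + complex.Re y by case: x; case: y.
have ImD x y : complex.Im (x + y) = complex.Im x + complex.Im y by case: x; case: y.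
split; rewrite ?ReD ?ImD !(ReM, ImM).
  rewrite (_ : (fun _ => _) =
    (fun t => complex.Re (h t)) * (fun t => complex.Re (k t)) -
    (fun t => complex.Im (h t)) * (fun t => complex.Im (k t))); last first.
    by apply/funext => t; rewrite ReM.
  apply: is_derive_eq; rewrite /GRing.scale /=; ring.
rewrite (_ : (fun _ => _) =
  (fun t => complex.Re (h t)) * (fun t => complex.Im (k t)) +
  (fun t => complex.Im (h t)) * (fun t => complex.Re (k t))); last first.
  by apply/funext => t; rewrite ImM.
apply: is_derive_eq; rewrite /GRing.scale /=; ring.
Qed.

Lemma cintegral_FTC a b h k : a <= b -> ccts_on a b k ->
  (forall s, rdiff h s (k s)) -> cintegral a b k = h b - h a.
Proof.
rewrite le_eqVlt => /predU1P[->|ab] ck hk.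
  by rewrite subrr /cintegral set_itv1 !Rintegral_set1.
have ftc (f F : R -> R) : {within `[a, b], continuous f} ->
    (forall s : R, is_derive s 1 F (f s)) ->
    \int[lebesgue_measure]_(s in `[a, b]) f s = F b - F a.
  move=> cf Ff; rewrite /Rintegral (@continuous_FTC2 _ _ F) //.
    have dF (s : R) : derivable F s 1 by case: (Ff s).
    have cF (s : R) : {for s, continuous F}.
      exact/differentiable_continuous/derivable1_diffP.
    split.
    - by move=> s _.
    - by apply: cvg_at_right_filter; exact: cF.
    - by apply: cvg_at_left_filter; exact: cF.
  by move=> s _; rewrite derive1E; case: (Ff s).
have eRe : \int[lebesgue_measure]_(s in `[a, b]) complex.Re (k s) =
    complex.Re (h b) - complex.Re (h a).
  apply: (ftc _ (fun s => complex.Re (h s))); last by move=> s; case: (hk s).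
  apply: continuous_in_subspaceT => s; rewrite inE /= in_itv /= => /ck.
  exact: continuous_Re.
have eIm : \int[lebesgue_measure]_(s in `[a, b]) complex.Im (k s) =
    complex.Im (h b) - complex.Im (h a).
  apply: (ftc _ (fun s => complex.Im (h s))); last by move=> s; case: (hk s).
  apply: continuous_in_subspaceT => s; rewrite inE /= in_itv /= => /ck.
  exact: continuous_Im.
by rewrite /cintegral eRe eIm; case: (h a); case: (h b).
Qed.
End Calc.

(** * Goursat's theorem *)

Section Bisection.
Variable R : realType.
Implicit Types (a b l x y d : R).

(* If P failed on the unit square it would fail on a nested sequence of dyadic
   subsquares shrinking to a point (x, y). *)
Lemma bisection2 (P : R -> R -> R -> Prop) :
  (forall a b l, 0 < l -> P a b (l / 2) -> P (a + l / 2) b (l / 2) ->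
     P a (b + l / 2) (l / 2) -> P (a + l / 2) (b + l / 2) (l / 2) -> P a b l) ->
  (forall x y, 0 <= x <= 1 -> 0 <= y <= 1 -> exists2 d, 0 < d &
     forall a b l, 0 < l < d -> a <= x <= a + l -> b <= y <= b + l -> P a b l) ->
  P 0 0 1.
Proof.
move=> Pmerge Ploc; apply: contrapT => nP.
(* A square is coded as (side, corner). The implication sits under the existential so that [choice]
   yields a total function, arbitrary at squares where P holds. *)
have step (u : R * (R * R)) : exists v : R * R, 0 < u.1 -> ~ P u.2.1 u.2.2 u.1 ->
    [/\ ~ P v.1 v.2 (u.1 / 2), v.1 = u.2.1 \/ v.1 = u.2.1 + u.1 / 2
      & v.2 = u.2.2 \/ v.2 = u.2.2 + u.1 / 2].
  case: u => l [a b] /=; apply: contrapT => /forallNP H.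
  have [l0 nPl] : 0 < l /\ ~ P a b l.
    by have /not_implyP[l0 /not_implyP[? _]] := H (0, 0).
  apply: nPl; apply: Pmerge => //; apply: contrapT => nPl.
  - by apply: (H (a, b)) => _ _; split => //; left.
  - by apply: (H (a + l / 2, b)) => _ _; split => //; [right|left].
  - by apply: (H (a, b + l / 2)) => _ _; split => //; [left|right].
  - by apply: (H (a + l / 2, b + l / 2)) => _ _; split => //; right.
have [next nextP] := choice step.
pose l n : R := 2^-1 ^+ n.
have l0 n : 0 < l n by rewrite exprn_gt0 // invr_gt0.
have lS n : l n.+1 = l n / 2 by rewrite /l exprSr.
pose fix s n := if n is m.+1 then next (l m, s m) else (0, 0).
have sP n : ~ P (s n).1 (s n).2 (l n).
  elim: n => [|n IHn]; first by rewrite /l expr0.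
  by rewrite lS; have [] := nextP (l n, s n) (l0 n) IHn.
(* The left ends increase and the right ends decrease, so the supremum of the left ends lies in
   every interval. *)
have conv (p : nat -> R) : p 0%N = 0 ->
    (forall n, p n.+1 = p n \/ p n.+1 = p n + l n / 2) ->
    exists2 x, 0 <= x <= 1 & forall n, p n <= x <= p n + l n.
  move=> p0 pS.
  have le1 n m : p n <= p (n + m)%N.
    elim: m => [|m IHm]; first by rewrite addn0.
    rewrite addnS; case: (pS (n + m)%N) => -> //; apply: le_trans IHm _.
    by rewrite lerDl divr_ge0 // ltW.
  have le2 n m : p (n + m)%N + l (n + m)%N <= p n + l n.
    elim: m => [|m IHm]; first by rewrite addn0.
    rewrite addnS lS; apply: le_trans IHm.
    have := l0 (n + m)%N; case: (pS (n + m)%N) => ->; lra.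
  have le3 n m : p n <= p m + l m.
    apply: le_trans (le1 n m) _; rewrite addnC; apply: le_trans (le2 m n).
    by rewrite lerDl ltW.
  have sE : has_sup (range p).
    by split; [exists (p 0%N), 0%N|exists (p 0%N + l 0%N) => _ [n _ <-]].
  have xP n : p n <= sup (range p) <= p n + l n.
    apply/andP; split; first by apply: (sup_upper_bound sE); exists n.
    by apply: ge_sup => [|_ [m _ <-] //]; exists (p 0%N), 0%N.
  exists (sup (range p)) => //.
  by have := xP 0%N; rewrite p0 add0r /l expr0.
have [x x01 xP] : exists2 x, 0 <= x <= 1 & forall n, (s n).1 <= x <= (s n).1 + l n.
  by apply: conv => // n; have [] := nextP (l n, s n) (l0 n) (sP n).
have [y y01 yP] : exists2 x, 0 <= x <= 1 & forall n, (s n).2 <= x <= (s n).2 + l n.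
  by apply: conv => // n; have [] := nextP (l n, s n) (l0 n) (sP n).
have [d d0 Pd] := Ploc x y x01 y01.
have [n ln] : exists n, l n < d.
  have : (l : nat -> R) @ \oo --> (0 : R).
    by apply: cvg_expr; rewrite ger0_norm ?invr_ge0 // invf_lt1 // ltr1n.
  move/cvgrPdist_lt => /(_ d d0) [n _ /(_ n)] /= /(_ (leqnn n)).
  by rewrite sub0r normrN gtr0_norm // => ?; exists n.
by apply: (sP n); apply: Pd; rewrite ?l0.
Qed.
End Bisection.

Section Goursat.
Variable R : realType.
Implicit Types (s t a b e : R) (y : R[i]) (k : R[i] -> R[i]).
Local Notation nc := (@Normc.normc R).

Lemma nc_expi s : nc (expi s) = 1.
Proof. by rewrite /expi /= cos2Dsin2 sqrtr1. Qed.
Lemma expi_neq0 s : expi s != 0.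
Proof. by rewrite -nc_eq0 nc_expi oner_eq0. Qed.
Lemma ccts_expi s : ccts (@expi R) s.
Proof.
rewrite (_ : @expi R = fun t => (cos t)%:C + 'i * (sin t)%:C).
  apply: cctsD; first by apply: ccts_real; exact: continuous_cos.
  by apply: cctsM; [exact: ccts_cst|apply: ccts_real; exact: continuous_sin].
by apply/funext => t; rewrite /expi; simpc.
Qed.
(** The increment is the integral of ['i * expi u], of modulus 1; the factor 2 is that of
    [nc_cintegral]. *)
Lemma expi_lip s t : nc (expi s - expi t) <= 2 * `|s - t|.
Proof.
wlog ts : s t / t <= s.
  by move=> W; have /orP[/W//|/W] := le_total t s; rewrite ncB distrC.
have ce : ccts_on t s (fun u => 'i * expi u).
  by move=> u _; apply: cctsM; [exact: ccts_cst|exact: ccts_expi].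
rewrite -(cintegral_FTC ts ce (@rdiff_expi R)) ger0_norm ?subr_ge0 //.
rewrite -[2 * (s - t)]mulr1 mulrAC; apply: nc_cintegral => // u _.
by rewrite ncM nc_i nc_expi mulr1.
Qed.

Variables (c x : R[i]) (rho : R).
Hypotheses (rho0 : 0 < rho) (xc : nc (x - c) < rho).

(* The circle [gam] is contracted to x along rays by [hom]; the integral of k
   over the image of the boundary of a parameter rectangle is [bI]. *)
Let gam s := c + rho%:C * expi s.
Let gam' s := 'i * rho%:C * expi s.
Let hom t s := x + t%:C * (gam s - x).

Let gam_c s : nc (gam s - c) = rho.
Proof. by rewrite /gam addrC addKr ncM nc_expi mulr1 ncR gtr0_norm. Qed.
Let gam_x s : nc (gam s - x) <= 2 * rho.
Proof.
apply: le_trans (nc_tri _ c _) _; rewrite gam_c mulr_natl mulr2n lerD2l ncB.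
exact: ltW.
Qed.
Let gam_neq s : gam s - x != 0.
Proof.
rewrite subr_eq0; apply: contraTneq xc => <-.
by rewrite gam_c ltxx.
Qed.
Let hom_disc t s : 0 <= t <= 1 -> nc (hom t s - c) <= rho.
Proof.
move=> /andP[t0 t1].
have -> : hom t s - c = (1 - t)%:C * (x - c) + t%:C * (gam s - c).
  by rewrite /hom rmorphB rmorph1; ring.
apply: le_trans (ncD _ _) _; rewrite !ncM gam_c !ncR !ger0_norm ?subr_ge0 //.
have : (1 - t) * nc (x - c) <= (1 - t) * rho by rewrite ler_wpM2l ?subr_ge0 // ltW.
lra.
Qed.
Let hom_neq t s : 0 < t -> hom t s != x.
Proof.
move=> t0; rewrite /hom -subr_eq0 addrC addKr mulf_neq0 //.
by rewrite -nc_eq0 ncR normr_eq0 gt_eqF.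
Qed.
Let ccts_gam s : ccts gam s.
Proof.
by apply: cctsD; [exact: ccts_cst|apply: cctsM; [exact: ccts_cst|exact: ccts_expi]].
Qed.
Let ccts_gam' s : ccts gam' s.
Proof. by apply: cctsM; [exact: ccts_cst|exact: ccts_expi]. Qed.
Let ccts_hom_s t s : ccts (hom t) s.
Proof.
apply: cctsD; first exact: ccts_cst; apply: cctsM; first exact: ccts_cst.
by apply: cctsB; [exact: ccts_gam|exact: ccts_cst].
Qed.
Let ccts_hom_t t s : ccts (hom^~ s) t.
Proof.
apply: cctsD; first exact: ccts_cst; apply: cctsM; last exact: ccts_cst.
by apply: ccts_real; exact: cvg_id.
Qed.
Let rdiff_gam s : rdiff gam s (gam' s).
Proof.
apply: rdiff_eq (rdiffD (rdiff_cst c s) (rdiffM (rdiff_cst rho%:C s) (rdiff_expi s))) _.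
by rewrite mulr0 addr0 add0r mulrCA mulrA.
Qed.
Let rdiff_hom_s t s : rdiff (hom t) s (t%:C * gam' s).
Proof.
have H := rdiffD (rdiff_gam s) (rdiff_cst (- x) s).
apply: rdiff_eq (rdiffD (rdiff_cst x s) (rdiffM (rdiff_cst t%:C s) H)) _.
by rewrite mulr0 !addr0 add0r.
Qed.
Let rdiff_hom_t t s : rdiff (hom^~ s) t (gam s - x).
Proof.
apply: rdiff_eq (rdiffD (rdiff_cst x t) (rdiffM (rdiff_real t) (rdiff_cst (gam s - x) t))) _.
by rewrite mulr0 !add0r mulr1.
Qed.
Let hom_lip t t0 s s0 : 0 <= t0 <= 1 ->
  nc (hom t s - hom t0 s0) <= 2 * rho * (`|t - t0| + `|s - s0|).
Proof.
move=> /andP[t00 t01].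
have -> : hom t s - hom t0 s0 = (t - t0)%:C * (gam s - x) + t0%:C * (rho%:C * (expi s - expi s0)).
  by rewrite /hom /gam rmorphB; ring.
apply: le_trans (ncD _ _) _; rewrite !ncM !ncR mulrDr; apply: lerD.
  by rewrite mulrC ler_wpM2r // gam_x.
rewrite (ger0_norm t00) (ger0_norm (ltW rho0)).
have H := expi_lip s s0.
apply: le_trans (_ : 1 * (rho * (2 * `|s - s0|)) <= _); last by rewrite mul1r mulrCA mulrA.
apply: ler_pM => //; first by rewrite mulr_ge0 ?nc_ge0 // ltW.
by rewrite ler_wpM2l // ltW.
Qed.

Let E1 k t a b := cintegral a b (fun s => k (hom t s) * (t%:C * gam' s)).
Let E2 k s a b := cintegral a b (fun t => k (hom t s) * (gam s - x)).
Let bI k t1 t2 s1 s2 := E2 k s1 t1 t2 + E1 k t2 s1 s2 - E2 k s2 t1 t2 - E1 k t1 s1 s2.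

Let kcts k t1 t2 := forall t s, t1 <= t <= t2 -> ccts (k : R[i]^o -> R[i]) (hom t s).

Let ccts_E1 k t1 t2 t a b : kcts k t1 t2 -> t1 <= t <= t2 ->
  ccts_on a b (fun s => k (hom t s) * (t%:C * gam' s)).
Proof.
move=> kc tt s _; apply: cctsM; first by apply: (@ccts_comp _ _ (hom t) k s (@ccts_hom_s t s)); exact: kc.
by apply: cctsM; [exact: ccts_cst|exact: ccts_gam'].
Qed.
Let ccts_E2 k t1 t2 s a b : kcts k t1 t2 -> t1 <= a -> b <= t2 ->
  ccts_on a b (fun t => k (hom t s) * (gam s - x)).
Proof.
move=> kc ta tb t /andP[a_t t_b].
apply: cctsM; last exact: ccts_cst.
apply: (@ccts_comp _ _ (hom^~ s) k t (@ccts_hom_t t s)); apply: kc.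
by rewrite (le_trans ta) //= (le_trans _ tb).
Qed.

(** A side shared by two of the four pieces is traversed twice in opposite directions. *)
Let bI_split k t1 t2 t3 s1 s2 s3 : kcts k t1 t3 -> t1 <= t2 <= t3 -> s1 <= s2 <= s3 ->
  bI k t1 t3 s1 s3 =
  bI k t1 t2 s1 s2 + bI k t2 t3 s1 s2 + bI k t1 t2 s2 s3 + bI k t2 t3 s2 s3.
Proof.
move=> kc /andP[t12 t23] /andP[s12 s23]; rewrite /bI.
have H2 s : E2 k s t1 t3 = E2 k s t1 t2 + E2 k s t2 t3.
  by apply: cintegral_split => //; apply: ccts_E2 kc _ _.
have H1 t : t1 <= t <= t3 -> E1 k t s1 s3 = E1 k t s1 s2 + E1 k t s2 s3.
  by move=> tt; apply: cintegral_split => //; apply: ccts_E1 kc _.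
have t13 := le_trans t12 t23.
rewrite (H2 s1) (H2 s3) (H1 t1) ?(H1 t3) ?lexx ?t13 //; ring.
Qed.

(** An affine function has the primitive [Pr]; the four sides are differences of its values at the
    corners and cancel. *)
Let bI_lin A B t1 t2 s1 s2 : t1 <= t2 -> s1 <= s2 ->
  bI (fun y => A + B * y) t1 t2 s1 s2 = 0.
Proof.
move=> t12 s12; pose Pr y := A * y + B / 2 * (y * y).
have two : (2 : R[i]) != 0 by rewrite pnatr_eq0.
have kc : kcts (fun y => A + B * y) t1 t2.
  move=> t s _; apply: cctsD; first exact: ccts_cst.
  by apply: cctsM; [exact: ccts_cst|exact: cvg_id].
have rP (h : R -> R[i]) u D : rdiff h u D -> rdiff (fun v => Pr (h v)) u ((A + B * h u) * D).
  move=> hD; have := rdiffD (rdiffM (rdiff_cst A u) hD)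
    (rdiffM (rdiff_cst (B / 2) u) (rdiffM hD hD)).
  by move=> /rdiff_eq; apply; field.
have H1 t : t1 <= t <= t2 ->
    E1 (fun y => A + B * y) t s1 s2 = Pr (hom t s2) - Pr (hom t s1).
  move=> tt; apply: (cintegral_FTC (h := fun s => Pr (hom t s))) => //.
    exact: ccts_E1 kc tt.
  by move=> s; apply: rP; exact: rdiff_hom_s.
have H2 s : E2 (fun y => A + B * y) s t1 t2 = Pr (hom t2 s) - Pr (hom t1 s).
  apply: (cintegral_FTC (h := fun t => Pr (hom t s))) => //.
    exact: ccts_E2 kc _ _.
  by move=> t; apply: (rP (hom^~ s)); exact: rdiff_hom_t.
rewrite /bI !H2 !H1 ?lexx ?t12 //; ring.
Qed.

Let bIB k k' t1 t2 s1 s2 : kcts k t1 t2 -> kcts k' t1 t2 -> t1 <= t2 ->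
  bI (fun y => k y - k' y) t1 t2 s1 s2 = bI k t1 t2 s1 s2 - bI k' t1 t2 s1 s2.
Proof.
move=> kc kc' t12.
have H1 t : t1 <= t <= t2 -> E1 (fun y => k y - k' y) t s1 s2 = E1 k t s1 s2 - E1 k' t s1 s2.
  move=> tt; rewrite /E1 -cintegralB; [|exact: ccts_E1 kc tt|exact: ccts_E1 kc' tt].
  by apply: eq_cintegral => s _; rewrite mulrBl.
have H2 s : E2 (fun y => k y - k' y) s t1 t2 = E2 k s t1 t2 - E2 k' s t1 t2.
  rewrite /E2 -cintegralB; [|exact: ccts_E2 kc _ _|exact: ccts_E2 kc' _ _].
  by apply: eq_cintegral => t _; rewrite mulrBl.
by rewrite /bI !H2 !H1 ?lexx ?t12 //; ring.
Qed.

(** The constant 8 is 2 (two opposite sides) times 2 (from [nc_cintegral]) times 2, since 2 rho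
    bounds the speed in both directions. *)
Let nc_bI k t1 t2 s1 s2 C : 0 <= t1 -> t2 <= 1 -> t1 <= t2 -> s1 <= s2 -> kcts k t1 t2 ->
  (forall t s, t1 <= t <= t2 -> s1 <= s <= s2 -> nc (k (hom t s)) <= C) ->
  nc (bI k t1 t2 s1 s2) <= 8 * rho * C * ((t2 - t1) + (s2 - s1)).
Proof.
move=> t10 t21 t12 s12 kc kC.
have C0 : 0 <= C.
  by apply: le_trans (nc_ge0 _) (kC t1 s1 _ _); rewrite lexx ?t12 ?s12.
have H1 t : t1 <= t <= t2 -> nc (E1 k t s1 s2) <= 2 * (C * (2 * rho)) * (s2 - s1).
  move=> tt; apply: nc_cintegral => //; first exact: ccts_E1 kc tt.
  move=> s ss; rewrite ncM; apply: ler_pM; rewrite ?nc_ge0 //; first exact: kC.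
  rewrite /gam' !ncM nc_i nc_expi !ncR mul1r mulr1 (gtr0_norm rho0).
  rewrite ler_pM2r //; have /andP[? ?] := tt.
  by rewrite ger0_norm; lra.
have H2 s : s1 <= s <= s2 -> nc (E2 k s t1 t2) <= 2 * (C * (2 * rho)) * (t2 - t1).
  move=> ss; apply: nc_cintegral => //; first exact: ccts_E2 kc _ _.
  by move=> t tt; rewrite ncM; apply: ler_pM; rewrite ?nc_ge0 ?gam_x //; exact: kC.
have tri (p q u v : R[i]) : nc (p + q - u - v) <= nc p + nc q + nc u + nc v.
  apply: le_trans (ncD _ _) _; rewrite ncN lerD2r.
  by apply: le_trans (ncD _ _) _; rewrite ncN lerD2r; exact: ncD.
rewrite /bI; apply: le_trans (tri _ _ _ _) _.
have h1 := H1 t1; have h2 := H1 t2; have h3 := H2 s1; have h4 := H2 s2.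
move: h1 h2 h3 h4; rewrite !lexx t12 s12 => /(_ isT) h1 /(_ isT) h2 /(_ isT) h3 /(_ isT) h4.
nra.
Qed.

(** The point x is exempt from differentiability so that the theorem applies to a divided
    difference, of which only continuity at x is known at first; this is what gives Cauchy's
    formula. *)
Variable k : R[i] -> R[i].
Hypothesis kd : forall y, nc (y - c) <= rho -> y != x -> exists D, cdiff k y D.
Hypothesis kx : ccts (k : R[i]^o -> R[i]) x.

Let kctsP e : 0 < e -> kcts k e 1.
Proof.
move=> e0 t s /andP[et t1]; have t0 := lt_le_trans e0 et.
have t01 : 0 <= t <= 1 by rewrite ltW.
by have [D /cdiff_ccts] := kd (hom_disc s t01) (hom_neq s t0).
Qed.

(* Away from x, k is affine up to an error small against the side l of a
   parameter square, so [bI] is at most eta * l ^+ 2 on small squares. *)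
Let bI_small e eta : 0 < e < 1 -> 0 < eta -> nc (bI k e 1 0 (2 * pi)) <= eta.
Proof.
move=> /andP[e0 e1] eta0.
(* The unit square is mapped onto the parameter rectangle [e, 1] x [0, 2 pi]. *)
pose tt a := e + (1 - e) * a; pose ss b : R := 2 * pi * b.
have pi0 : 0 < pi :> R := pi_gt0 R.
(* Only the direction of t is guarded: for t in [e, 1] the point [hom t s] lies in the disc and off
   x, whatever s is. *)
pose P a b l := 0 <= a -> a + l <= 1 ->
  nc (bI k (tt a) (tt (a + l)) (ss b) (ss (b + l))) <= eta * l ^+ 2.
suff : P 0 0 1.
  rewrite /P /tt /ss !add0r !mulr0 !mulr1 addr0 addrC subrK expr1n mulr1.
  by apply; rewrite // lexx.
pose K := 2 * rho * (1 + 2 * pi).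
have K0 : 0 < K by rewrite !mulr_gt0 // addr_gt0 // mulr_gt0.
have et a : 0 <= a -> e <= tt a by move=> a0; rewrite /tt lerDl mulr_ge0 // subr_ge0 ltW.
have t1 a : a <= 1 -> tt a <= 1.
  by move=> a1; have := ler_wpM2l (ltW (_ : 0 < 1 - e)) a1; rewrite subr_gt0 /tt => /(_ e1); lra.
have ttle a b : a <= b -> tt a <= tt b.
  by move=> ab; rewrite /tt lerD2l ler_wpM2l // subr_ge0 ltW.
have ssle a b : a <= b -> ss a <= ss b.
  by move=> ab; rewrite /ss ler_wpM2l // mulr_ge0 // ltW.
have kcs a b : 0 <= a -> b <= 1 -> kcts k (tt a) (tt b).
  move=> a0 b1 t s /andP[at_ tb]; apply: (kctsP e0).
  by rewrite (le_trans (et _ a0)) //= (le_trans tb) // t1.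
apply: bisection2 => [a b l l0 P1 P2 P3 P4 a0 al|x0 y0 x01 y01].
  have E : l = l / 2 + l / 2 by lra.
  rewrite {1 2}E !addrA.
  rewrite (@bI_split k _ (tt (a + l / 2)) _ _ (ss (b + l / 2))); last 3 first.
  - by apply: kcs => //; move: al; rewrite {1}E addrA.
  - by rewrite !ttle //; lra.
  - by rewrite !ssle //; lra.
  have l20 : 0 < l / 2 by rewrite divr_gt0.
  have a20 : 0 <= a + l / 2 by rewrite addr_ge0 // ltW.
  have al2 : a + l / 2 + l / 2 <= 1 by rewrite -addrA -splitr.
  have al1 : a + l / 2 <= 1 by apply: le_trans al2; rewrite lerDl ltW.
  have h1 := P1 a0 al1; have h2 := P2 a20 al2; have h3 := P3 a0 al1; have h4 := P4 a20 al2.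
  have tri (p q u v : R[i]) : nc (p + q + u + v) <= nc p + nc q + nc u + nc v.
    do 2 (apply: le_trans (ncD _ _) _; rewrite lerD2r); exact: ncD.
  apply: le_trans (tri _ _ _ _) _.
  have -> : eta * l ^+ 2 = eta * (l / 2) ^+ 2 + eta * (l / 2) ^+ 2 +
      eta * (l / 2) ^+ 2 + eta * (l / 2) ^+ 2 by field.
  move: h1 h2 h3 h4; rewrite -!addrA -!splitr !addrA => h1 h2 h3 h4.
  exact: (lerD (lerD (lerD h1 h2) h3) h4).
have /andP[x00 x01'] := x01.
pose t0 := tt x0; pose s0 := ss y0; pose w := hom t0 s0.
have t0e : e <= t0 by exact: et.
have t01 : t0 <= 1 by exact: t1.
have t0pos : 0 < t0 by exact: lt_le_trans t0e.
have t001 : 0 <= t0 <= 1 by rewrite ltW.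
have [D] := kd (hom_disc s0 t001) (hom_neq s0 t0pos).
(* On a square of side l the points differ by at most K l, so k is affine up to e' K l, and [nc_bI]
   gives 8 rho (1 + 2 pi) e' K l ^ 2 = 4 K ^ 2 e' l ^ 2 = eta l ^ 2. *)
pose e' := eta / (4 * K ^+ 2).
have e'0 : 0 < e' by rewrite divr_gt0 // mulr_gt0 // exprn_gt0.
move=> /cdiffP /(_ e' e'0) [d d0 Hd].
exists (d / K); first by rewrite divr_gt0.
move=> a b l /andP[l0]; rewrite ltr_pdivlMr // => ld /andP[ax xal] /andP[by_ ybl] a0 al.
pose lin y := (k w - D * w) + D * y.
have lc : kcts lin (tt a) (tt (a + l)).
  move=> t s _; apply: cctsD; first exact: ccts_cst.
  by apply: cctsM; [exact: ccts_cst|exact: cvg_id].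
have tal : tt a <= tt (a + l) by apply: ttle; rewrite lerDl ltW.
have sbl : ss b <= ss (b + l) by apply: ssle; rewrite lerDl ltW.
have -> : bI k (tt a) (tt (a + l)) (ss b) (ss (b + l)) =
    bI (fun y => k y - lin y) (tt a) (tt (a + l)) (ss b) (ss (b + l)).
  rewrite (bIB _ _ (kcs _ _ a0 al) lc tal).
  have -> : bI lin (tt a) (tt (a + l)) (ss b) (ss (b + l)) = 0 by exact: bI_lin.
  by rewrite subr0.
have H : forall t s, tt a <= t <= tt (a + l) -> ss b <= s <= ss (b + l) ->
    nc (k (hom t s) - lin (hom t s)) <= e' * (K * l).
  move=> t s /andP[ta tb] /andP[sa sb].
  have lt : `|t - t0| <= l.
    move: (ttle _ _ ax) (ttle _ _ xal); rewrite -/t0 => h1 h2.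
    have h3 : tt (a + l) - tt a <= l.
      rewrite /tt [X in X <= _](_ : _ = (1 - e) * l); last by ring.
      by rewrite ler_piMl ?(ltW l0) // gerBl ltW.
    by rewrite ler_norml; apply/andP; split; lra.
  have ls : `|s - s0| <= 2 * pi * l.
    move: (ssle _ _ by_) (ssle _ _ ybl); rewrite -/s0 => h1 h2.
    have h3 : ss (b + l) - ss b = 2 * pi * l by rewrite /ss; ring.
    by rewrite ler_norml; apply/andP; split; lra.
  have hl : nc (hom t s - w) <= K * l.
    apply: le_trans (hom_lip t s s0 _) _; first by rewrite ltW.
    rewrite /K -[2 * rho * (1 + 2 * pi) * l]mulrA ler_wpM2l // ?mulr_ge0 // ?(ltW rho0) //; lra.
  have -> : k (hom t s) - lin (hom t s) = k (hom t s) - k w - D * (hom t s - w).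
    by rewrite /lin; ring.
  apply: le_trans (Hd _ _) _; first by apply: le_lt_trans hl _; rewrite mulrC.
  by rewrite ler_wpM2l // ltW.
have ta0 : 0 <= tt a by apply: le_trans (et _ a0); exact: ltW.
have klc : kcts (fun y => k y - lin y) (tt a) (tt (a + l)).
  by move=> t s tb; apply: cctsB; [exact: (kcs _ _ a0 al)|exact: lc].
apply: le_trans (nc_bI ta0 (t1 _ al) tal sbl klc H) _.
have -> : eta * l ^+ 2 = 4 * K * (e' * (K * l)) * l.
  by rewrite /e'; field; rewrite gt_eqF.
have h1 : tt (a + l) - tt a <= l.
  rewrite /tt [X in X <= _](_ : _ = (1 - e) * l); last by ring.
  by rewrite ler_piMl ?(ltW l0) // gerBl ltW.
have h2 : ss (b + l) - ss b = 2 * pi * l by rewrite /ss; ring.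
have h3 : 0 <= 8 * rho * (e' * (K * l)).
  apply: mulr_ge0; first by rewrite mulr_ge0 // ltW.
  by apply: mulr_ge0; [exact: ltW|apply: mulr_ge0; exact: ltW].
have h4 : tt (a + l) - tt a + (ss (b + l) - ss b) <= l + 2 * pi * l by rewrite h2 lerD2r.
apply: le_trans (ler_wpM2l h3 h4) _.
by rewrite le_eqVlt; apply/orP; left; apply/eqP; rewrite /K; ring.
Qed.

(* The integral over [hom t] does not depend on t in ]0, 1] and vanishes as
   t tends to 0 since k is bounded near x. *)
Lemma circle_integral_eq0 : circle_integral c rho k = 0.
Proof.
have pi0 : 0 < pi :> R := pi_gt0 R.
have E1e e : 0 < e < 1 -> E1 k 1 0 (2 * pi) = E1 k e 0 (2 * pi).
  move=> e01.
  have : bI k e 1 0 (2 * pi) = 0.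
    apply/eqP; rewrite -nc_eq0 eq_le nc_ge0 andbT; apply/ler_addgt0Pl => eta eta0.
    by rewrite addr0; exact: bI_small.
  rewrite /bI.
  (* The circle is closed, so the two radial sides coincide and cancel. *)
  have -> : E2 k (2 * pi) e 1 = E2 k 0 e 1.
    have g : gam (2 * pi) = gam 0.
      by rewrite /gam /expi mulr_natl cos2pi sin2pi cos0 sin0.
    by apply: eq_cintegral => t _; rewrite /hom g.
  by rewrite [X in X - _]addrAC subrr add0r => /eqP; rewrite subr_eq0 => /eqP.
suff : E1 k 1 0 (2 * pi) = 0.
  move=> <-; apply: eq_cintegral => s _.
  by rewrite /hom mul1r [x + _]addrC subrK /gam' mul1r.
have /ccts_complexP /(_ 1 ltr01) [d d0 Hd] := kx.
have C0 : 0 <= nc (k x) + 1 by rewrite addr_ge0 ?nc_ge0.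
apply/eqP; rewrite -nc_eq0 eq_le nc_ge0 andbT; apply/ler_addgt0Pl => eta eta0.
rewrite addr0.
pose K := 2 * ((nc (k x) + 1) * rho) * (2 * pi).
have K0 : 0 <= K by rewrite !mulr_ge0 // ltW.
(* The three bounds ensure e < 1, that [hom e s] is within 2 e rho <= d / 2 of x, and that the
   integral, at most e K, is below eta. *)
pose e := Num.min (2^-1) (Num.min (d / (4 * rho)) (eta / (K + 1))).
have K1 : 0 < K + 1 by rewrite ltr_wpDl.
have e0 : 0 < e by rewrite !lt_min invr_gt0 ltr0n !divr_gt0 // mulr_gt0.
have e1 : e < 1 by rewrite gt_min invf_lt1 // ltr1n.
have ed : e * (4 * rho) <= d.
  by rewrite -ler_pdivlMr ?mulr_gt0 // /e !ge_min lexx orbT.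
have eK : e * (K + 1) <= eta by rewrite -ler_pdivlMr // /e !ge_min lexx !orbT.
rewrite (E1e e) ?e0 //.
apply: le_trans (_ : 2 * ((nc (k x) + 1) * (e * rho)) * (2 * pi - 0) <= _).
  apply: nc_cintegral; first by rewrite mulr_ge0 // ltW.
    by apply: ccts_E1 (kctsP e0) _; rewrite lexx ltW.
  move=> s _; rewrite ncM; apply: ler_pM; rewrite ?nc_ge0 //.
    have /Hd /ltW : nc (hom e s - x) < d.
      rewrite /hom addrC addKr ncM ncR gtr0_norm //.
      have := gam_x s; nra.
    move=> h; rewrite -[k (hom e s)](subrK (k x)) addrC.
    by apply: le_trans (ncD _ _) _; rewrite lerD2l.
  by rewrite /gam' !ncM nc_i nc_expi !ncR mul1r mulr1 !gtr0_norm.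
rewrite subr0; apply: le_trans eK.
have -> : 2 * ((nc (k x) + 1) * (e * rho)) * (2 * pi) = e * K by rewrite /K; ring.
by rewrite ler_pM2l // lerDl.
Qed.
End Goursat.

(* Otherwise [done] unfolds these predicates down to filters. *)
Local Opaque ccts cdiff.

(** * Cauchy's formula and divided differences *)

Section Cauchy.
Variable R : realType.
Implicit Types (r d e C : R) (a c x y : R[i]) (g h phi : R[i] -> R[i]) (U : set R[i]).
Local Notation nc := (@Normc.normc R).

(** Only the trace on the circle counts; the density of a Cauchy transform need not be analytic. *)
Definition circle_good c r h := forall s, ccts (fun s => h (c + r%:C * expi s)) s.

Lemma circle_bound c r h : circle_good c r h ->
  exists C, forall s, 0 <= s <= 2 * pi -> nc (h (c + r%:C * expi s)) <= C.
Proof.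
move=> hc; have pi2 : 0 <= 2 * pi :> R by rewrite mulr_ge0 // pi_ge0.
have nch s : {for s, continuous (fun s => nc (h (c + r%:C * expi s)))}.
  exact: continuous_nc (hc s).
have [|t _ tmax] := EVT_max (f := fun s => nc (h (c + r%:C * expi s))) pi2.
  by apply: continuous_in_subspaceT => s _; exact: nch.
by exists (nc (h (c + r%:C * expi t))) => s s2; apply: tmax; rewrite in_itv.
Qed.

Lemma nc_circle c r s : 0 < r -> nc (c + r%:C * expi s - c) = r.
Proof. by move=> r0; rewrite addrC addKr ncM nc_expi mulr1 ncR gtr0_norm. Qed.

Lemma ccts_circle c r s : ccts (fun s => c + r%:C * expi s) s.
Proof.
by apply: cctsD; [exact: ccts_cst|apply: cctsM; [exact: ccts_cst|exact: ccts_expi]].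
Qed.

Lemma circle_goodM c r g h : circle_good c r g -> circle_good c r h ->
  circle_good c r (fun y => g y * h y).
Proof. by move=> gc hc s; exact: cctsM. Qed.
Lemma circle_goodD c r g h : circle_good c r g -> circle_good c r h ->
  circle_good c r (fun y => g y + h y).
Proof. by move=> gc hc s; exact: cctsD. Qed.
Lemma circle_good_cst c r (b : R[i]) : circle_good c r (fun=> b).
Proof. by move=> s; exact: ccts_cst. Qed.

Lemma circle_good_id c r : circle_good c r id.
Proof. by move=> s; exact: ccts_circle. Qed.

Lemma nc_sub_circle c r x y : nc (y - c) = r -> r - nc (x - c) <= nc (y - x).
Proof. by move=> <-; rewrite lerBlDr; exact: nc_tri. Qed.
Lemma nc_sub_circle_out c r x y : nc (y - c) = r -> nc (x - c) - r <= nc (y - x).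
Proof. by move=> <-; rewrite lerBlDr [nc (y - x)]ncB; exact: nc_tri. Qed.
Lemma nc_circle_dist c r x y : nc (y - c) = r -> `|r - nc (x - c)| <= nc (y - x).
Proof.
move=> yr; rewrite ler_norml lerNl opprB nc_sub_circle ?andbT //.
exact: nc_sub_circle_out.
Qed.

Lemma circle_good_inv c r x : 0 < r -> nc (x - c) != r ->
  circle_good c r (fun y => (y - x)^-1).
Proof.
move=> r0 xr.
have d0 : 0 < `|r - nc (x - c)| by rewrite normr_gt0 subr_eq0 eq_sym.
move=> s; apply: cctsV; last by apply: cctsB; [exact: ccts_circle|exact: ccts_cst].
rewrite -nc_eq0 gt_eqF //; apply: lt_le_trans d0 _.
by apply: nc_circle_dist; exact: nc_circle.
Qed.
Lemma circle_good_div c r x h : 0 < r -> nc (x - c) != r -> circle_good c r h ->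
  circle_good c r (fun y => h y / (y - x)).
Proof. by move=> r0 xr gh; exact: circle_goodM gh (circle_good_inv r0 xr). Qed.

Let on c r h := fun s => h (c + r%:C * expi s) * ('i * r%:C * expi s).
Let on_cts c r h (a b : R) : circle_good c r h -> ccts_on a b (on c r h).
Proof.
move=> hc s _; apply: cctsM; first exact: hc.
by apply: cctsM; [exact: ccts_cst|exact: ccts_expi].
Qed.

Lemma eq_circle c r g h : 0 < r -> (forall y, nc (y - c) = r -> g y = h y) ->
  circle_integral c r g = circle_integral c r h.
Proof. by move=> r0 gh; apply: eq_cintegral => s _; rewrite gh // nc_circle. Qed.
Lemma circleD c r g h : circle_good c r g -> circle_good c r h ->
  circle_integral c r (fun y => g y + h y) = circle_integral c r g + circle_integral c r h.
Proof.
move=> gc hc; rewrite /circle_integral -cintegralD; [|exact: on_cts..].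
by apply: eq_cintegral => s _; rewrite mulrDl.
Qed.
Lemma circleZ c r (b : R[i]) h : circle_good c r h ->
  circle_integral c r (fun y => b * h y) = b * circle_integral c r h.
Proof.
move=> hc; rewrite /circle_integral -cintegralZ; last exact: on_cts.
by apply: eq_cintegral => s _; rewrite mulrA.
Qed.
Lemma circleB c r g h : circle_good c r g -> circle_good c r h ->
  circle_integral c r (fun y => g y - h y) = circle_integral c r g - circle_integral c r h.
Proof.
move=> gc hc; have hc' := circle_goodM (@circle_good_cst c r (-1)) hc.
rewrite -mulN1r -(circleZ _ hc) -(circleD gc hc').
by apply: eq_cintegral => s _; rewrite mulN1r.
Qed.
Lemma nc_circle_integral c r h C : 0 < r -> circle_good c r h ->
  (forall s, 0 <= s <= 2 * pi -> nc (h (c + r%:C * expi s)) <= C) ->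
  nc (circle_integral c r h) <= 4 * pi * r * C.
Proof.
move=> r0 hc hC.
have -> : 4 * pi * r * C = 2 * (C * r) * (2 * pi - 0) by ring.
apply: nc_cintegral; [by rewrite mulr_ge0 // pi_ge0|exact: on_cts|].
move=> s s2; rewrite !ncM nc_i nc_expi ncR mul1r mulr1 gtr0_norm //.
by rewrite ler_wpM2r ?(ltW r0) // hC.
Qed.

Lemma circle_good_cts c r h : 0 < r ->
  (forall y, nc (y - c) = r -> ccts (h : R[i]^o -> R[i]) y) -> circle_good c r h.
Proof.
move=> r0 hc s.
apply: (@ccts_comp _ _ (fun s => c + r%:C * expi s) h s (@ccts_circle c r s)).
by apply: hc; rewrite nc_circle.
Qed.

Lemma cdiff_inv a x : x != a -> cdiff (fun y => (y - a)^-1) x (- (x - a) ^- 2).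
Proof.
move=> xa.
have := cdiffV (g := fun y => y - a) _ (cdiffB (cdiff_id x) (cdiff_cst a x)).
by move=> /(_ ltac:(by rewrite subr_eq0)) /cdiff_eq; apply; rewrite subr0 mulr1.
Qed.

Lemma conj_expi (s : R) : conjc (expi s) = (expi s)^-1.
Proof.
apply: (mulfI (expi_neq0 s)); rewrite mulfV ?expi_neq0 //.
rewrite /expi; simpc.
by rewrite -!expr2 cos2Dsin2 mulrC addNr.
Qed.

(* With e = exp (i s) and w = (x - c) / r, the integrand is i (1 + w / (e - w)),
   and the conjugate of w / (e - w) is e times k e for k y = w^* / (1 - w^* y),
   which is analytic on the closed unit disc. *)
Lemma circle_inv_in c x r : nc (x - c) < r ->
  circle_integral c r (fun y => (y - x)^-1) = 2 * pi%:C * 'i.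
Proof.
move=> xr; have r0 : 0 < r by exact: le_lt_trans (nc_ge0 _) xr.
have rC0 : r%:C != 0 :> R[i] by rewrite -nc_eq0 ncR normr_eq0 gt_eqF.
have [w wE] : exists w, w = (x - c) / r%:C by eexists.
have w1 : nc w < 1 by rewrite wE ncM ncV ncR gtr0_norm // ltr_pdivrMr // mul1r.
have wJ : nc (conjc w) = nc w by case: (w) => u v /=; rewrite sqrrN.
have w'0 y : nc y <= 1 -> 1 - conjc w * y != 0.
  move=> y1; rewrite subr_eq0 eq_sym; apply: contraTneq (w1) => wy.
  rewrite -leNgt -wJ -nc1 -wy ncM ler_piMr ?nc_ge0 //.
have kd y : nc (y - 0) <= 1 -> y != 0 -> exists D, cdiff (fun y => conjc w / (1 - conjc w * y)) y D.
  rewrite subr0 => y1 _; eexists; apply: cdiffM; first exact: cdiff_cst.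
  apply: cdiffV; first exact: w'0.
  by apply: cdiffB; [exact: cdiff_cst|apply: cdiffM; [exact: cdiff_cst|exact: cdiff_id]].
have kx : ccts ((fun y => conjc w / (1 - conjc w * y)) : R[i]^o -> R[i]) 0.
  apply: cctsM; first exact: ccts_cst.
  apply: cctsV; first by apply: w'0; rewrite nc0.
  by apply: cctsB; [exact: ccts_cst|apply: cctsM; [exact: ccts_cst|exact: ccts_id]].
have nc00 : nc (0 - 0) < 1 by rewrite subr0 nc0.
have e1 s : nc (expi s) <= 1 by rewrite nc_expi.
have e0 s : 1 - conjc w * expi s != 0 by exact: w'0.
have I0 := circle_integral_eq0 (@ltr01 R) nc00 kd kx.
pose q (s : R) := conjc w * expi s / (1 - conjc w * expi s).
have qc (a b : R) : ccts_on a b q.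
  move=> s _; apply: cctsM.
    by apply: cctsM; [exact: ccts_cst|exact: ccts_expi].
  apply: (@cctsV _ _ (fun s => 1 - conjc w * expi s)); first exact: e0.
  apply: cctsB; first exact: ccts_cst.
  by apply: cctsM; [exact: ccts_cst|exact: ccts_expi].
have pi2 : 0 <= 2 * pi :> R by rewrite mulr_ge0 // pi_ge0.
have i0 : ('i)%R != 0 :> R[i] by rewrite -nc_eq0 nc_i oner_eq0.
have Iq : cintegral 0 (2 * pi) q = 0.
  apply: (mulfI i0); rewrite mulr0 -cintegralZ // -I0.
  apply: eq_cintegral => s _; rewrite /q add0r rmorph1 !mul1r mulr1.
  ring.
have JB (y1 y2 : R[i]) : conjc (y1 - y2) = conjc y1 - conjc y2 by exact: rmorphB.
have JM (y1 y2 : R[i]) : conjc (y1 * y2) = conjc y1 * conjc y2 by exact: rmorphM.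
have E s : (c + r%:C * expi s - x)^-1 * ('i * r%:C * expi s) = 'i * (1 + conjc (q s)).
  have := w'0 _ (e1 s); rewrite -conjc_eq0 JB JM conjc1 conjcK conj_expi => W.
  have x0 : c + r%:C * expi s - x != 0.
    rewrite subr_eq0; apply: contraTneq xr => <-.
    by rewrite nc_circle // ltxx.
  rewrite /q JM conjc_inv JB !JM conjc1 conjcK conj_expi.
  have es0 := expi_neq0 s.
  have xE : x = c + r%:C * w by rewrite wE mulrCA divff // mulr1 addrC subrK.
  have x0' : expi s - w != 0.
    move: x0; rewrite {1}xE (_ : _ - _ = r%:C * (expi s - w)); last by ring.
    by rewrite mulf_eq0 negb_or => /andP[].
  have key (c' u v z' k : R[i]) : u != 0 -> v != 0 -> v - z' != 0 ->
      (c' + u * v - (c' + u * z'))^-1 * (k * u * v) = k * (1 + z' * v^-1 / (1 - z' * v^-1)).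
    move=> u0 v0 vz.
    have -> : c' + u * v - (c' + u * z') = u * (v - z') by ring.
    by field; rewrite ?u0 v0 vz.
  by rewrite {1}xE; exact: key.
rewrite /circle_integral.
rewrite (@eq_cintegral _ _ _ _ (fun s => 'i * (1 + conjc (q s)))); last by move=> s _; exact: E.
have qJ (a b : R) : ccts_on a b (fun s => conjc (q s)).
  move=> s sab; have /cctsP H := qc _ _ s sab.
  apply/cctsP => e /H; apply: filterS => t.
  by rewrite -rmorphB /=; case: (q t - q s) => u v /=; rewrite sqrrN.
rewrite cintegralZ; last by move=> s sab; apply: cctsD; [exact: ccts_cst|exact: qJ sab].
have c1 : ccts_on 0 (2 * pi) (fun=> 1 : R[i]) by move=> s _; exact: ccts_cst.
rewrite (cintegralD c1 (qJ _ _)) cintegral_cst // cintegral_conj; last exact: qc.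
by rewrite Iq conjc0 addr0 subr0 mulr1 rmorphM rmorph_nat mulrC.
Qed.

Lemma circle_integral_disc c r h : 0 < r ->
  (forall y, nc (y - c) <= r -> exists D, cdiff h y D) -> circle_integral c r h = 0.
Proof.
move=> r0 hd; apply: (@circle_integral_eq0 R c c r r0) => //.
- by rewrite subrr nc0.
- by move=> y yr _; exact: hd.
have [D hD] := hd c ltac:(by rewrite subrr nc0 ltW).
exact: cdiff_ccts hD.
Qed.

(* The divided difference g[a, x], completed by the derivative at x = a. *)
Definition dd g a : R[i] -> R[i] :=
  fun x => if x == a then cderive 1 g a else (g x - g a) / (x - a).

Lemma ddE g a x : g x = g a + (x - a) * dd g a x.
Proof.
rewrite /dd; case: eqVneq => [->|xa]; first by rewrite subrr mul0r addr0.
by rewrite mulrCA divff ?subr_eq0 // mulr1 addrC subrK.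
Qed.

Lemma dd_eq0 g a : dd g a a = cderive 1 g a.
Proof. by rewrite /dd eqxx. Qed.

Lemma dd_ccts g a D : cdiff g a D -> ccts (dd g a : R[i]^o -> R[i]) a.
Proof.
move=> gD; have DE := cdiff_derive1 gD; have /cdiffP H := gD.
apply/ccts_complexP => e e0; have e20 : 0 < e / 2 by rewrite divr_gt0.
have [d d0 Hd] := H _ e20; exists d => // y ya.
apply: le_lt_trans (_ : e / 2 < e); last by rewrite ltr_pdivrMr // ltr_pMr // ltr1n.
rewrite dd_eq0 DE /dd; case: eqVneq => [_|nya]; first by rewrite DE subrr nc0 ltW.
have nya0 : y - a != 0 by rewrite subr_eq0.
have -> : (g y - g a) / (y - a) - D = (g y - g a - D * (y - a)) / (y - a) by field.
by rewrite ncM ncV ler_pdivrMr ?nc_gt0 //; exact: Hd.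
Qed.

Lemma dd_cdiff_off g a x D : x != a -> cdiff g x D -> exists E, cdiff (dd g a) x E.
Proof.
move=> xa gD; have d0 : 0 < nc (x - a) by rewrite nc_gt0 subr_eq0.
exists ((g x - g a) * (- (x - a) ^- 2) + (x - a)^-1 * (D - 0)).
apply: (cdiff_local d0) (cdiffM (cdiffB gD (cdiff_cst (g a) x)) (cdiff_inv xa)).
move=> y yx; rewrite /dd; case: eqVneq => // ya.
by move: yx; rewrite ya ncB ltxx.
Qed.

(** Goursat's theorem for [dd g x], which on the circle is (g y - g x) / (y - x); the part with g x
    is [circle_inv_in]. *)
Lemma cauchy_formula U g c r x : analytic_on U g ->
  (forall y, nc (y - c) <= r -> U y) -> nc (x - c) < r -> circle_good c r g ->
  circle_integral c r (fun y => g y / (y - x)) = 2 * pi%:C * 'i * g x.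
Proof.
move=> ag DU xr gg; have r0 : 0 < r by exact: le_lt_trans (nc_ge0 _) xr.
have I0 : circle_integral c r (dd g x) = 0.
  apply: (circle_integral_eq0 r0 xr) => [y yr yx|].
    exact: dd_cdiff_off yx (analytic_cdiff ag (DU _ yr)).
  exact: dd_ccts (analytic_cdiff ag (DU _ (ltW xr))).
have xr' : nc (x - c) != r by rewrite lt_eqF.
have gi := circle_good_inv r0 xr'.
rewrite -(circle_inv_in xr) mulrC -(circleZ _ gi).
apply/eqP; rewrite -subr_eq0.
rewrite -(circleB (circle_goodM gg gi) (circle_goodM (@circle_good_cst c r (g x)) gi)).
rewrite -I0; apply/eqP/eq_circle => // y yr.
rewrite /dd; case: eqVneq => [yx|_]; last by rewrite mulrBl.
by move: xr'; rewrite -yx yr eqxx.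
Qed.

(** * Cauchy transforms of continuous densities and local properties of analytic functions *)

Definition cauchyT c r phi x := circle_integral c r (fun y => phi y / (y - x)).

(** Partial fractions: 1 / (y - x) - 1 / (y - a) = (x - a) / ((y - x) (y - a)). A divided difference
    of a transform is thus a transform, and nothing is ever differentiated under the integral
    sign. *)
Lemma cauchyT_sub c r phi x a : 0 < r -> nc (x - c) != r -> nc (a - c) != r ->
  circle_good c r phi ->
  cauchyT c r phi x - cauchyT c r phi a =
  (x - a) * cauchyT c r (fun y => phi y / (y - a)) x.
Proof.
move=> r0 xr ar gp; rewrite /cauchyT -circleB; [|exact: circle_good_div..].
rewrite -(circleZ _ (circle_good_div r0 xr (circle_good_div r0 ar gp))).
apply: eq_circle => // y yr.
have yx : y - x != 0 by rewrite subr_eq0; apply: contraNneq xr => <-; exact/eqP.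
have ya : y - a != 0 by rewrite subr_eq0; apply: contraNneq ar => <-; exact/eqP.
by field; rewrite yx ya.
Qed.

Lemma nc_cauchyT c r phi x C e : 0 < r -> 0 < e -> e <= `|r - nc (x - c)| ->
  circle_good c r phi ->
  (forall s, 0 <= s <= 2 * pi -> nc (phi (c + r%:C * expi s)) <= C) ->
  nc (cauchyT c r phi x) <= 4 * pi * r * (C / e).
Proof.
move=> r0 e0 xr gp pC; apply: (nc_circle_integral r0).
  apply: (circle_good_div r0 _ gp); apply: contraTneq xr => ->.
  by rewrite subrr normr0 -ltNge.
move=> s s2; have yr := nc_circle c s r0; move: (pC _ s2).
move: (c + r%:C * expi s) yr => y yr yC; rewrite ncM ncV.
have yx : e <= nc (y - x) by apply: le_trans xr _; exact: nc_circle_dist.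
apply: ler_pM; rewrite ?nc_ge0 ?yC ?invr_ge0 ?nc_ge0 //.
by rewrite lef_pV2 ?posrE //; exact: lt_le_trans yx.
Qed.

Lemma cauchyT_ccts c r phi a : 0 < r -> nc (a - c) != r -> circle_good c r phi ->
  ccts (cauchyT c r phi : R[i]^o -> R[i]) a.
Proof.
move=> r0 ar gp.
have gp' := circle_good_div r0 ar gp; have [C HC] := circle_bound gp'.
(* Half the distance from a to the circle: points within d of a stay at distance at least d from
   it. *)
have [d [d0 dE]] : exists d, 0 < d /\ `|r - nc (a - c)| = 2 * d.
  exists (`|r - nc (a - c)| / 2); split; last by field.
  by rewrite divr_gt0 // normr_gt0 subr_eq0 eq_sym.
pose K := `|4 * pi * r * (C / d)| + 1.
have K0 : 0 < K by rewrite ltr_wpDl.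
apply/ccts_complexP => e e0; exists (Num.min d (e / K)); first by rewrite lt_min d0 divr_gt0.
move=> x; rewrite lt_min [_ < e / K]ltr_pdivlMr // => /andP[xd xe].
have xr : d <= `|r - nc (x - c)|.
  have h1 := nc_tri x a c; have h2 := nc_tri a x c; rewrite [nc (a - x)]ncB in h2.
  have h3 : `|nc (x - c) - nc (a - c)| <= d by rewrite ler_norml; apply/andP; split; lra.
  have h4 := ler_distD (nc (x - c)) r (nc (a - c)); rewrite dE in h4.
  have h5 := le_trans h4 (lerD (lexx _) h3).
  by move: h5; rewrite mulr_natl mulr2n lerD2r.
have xr' : nc (x - c) != r.
  by apply: contraTneq xr => ->; rewrite subrr normr0 -ltNge.
rewrite (cauchyT_sub r0 xr' ar gp).
apply: le_lt_trans xe; rewrite ncM ler_wpM2l ?nc_ge0 //.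
apply: le_trans (nc_cauchyT r0 d0 xr gp' HC) _.
by rewrite /K; apply: le_trans (ler_norm _) _; rewrite lerDl.
Qed.

(** The difference quotient at a is the transform of phi y / (y - a), continuous at a. *)
Lemma cauchyT_cdiff c r phi a : nc (a - c) < r -> circle_good c r phi ->
  cdiff (cauchyT c r phi) a (cauchyT c r (fun y => phi y / (y - a)) a).
Proof.
move=> ar gp; have r0 : 0 < r by exact: le_lt_trans (nc_ge0 _) ar.
have ar' : nc (a - c) != r by rewrite lt_eqF.
have gp' := circle_good_div r0 ar' gp.
have /ccts_complexP H := cauchyT_ccts r0 ar' gp'.
apply/cdiffP => e /H[d d0 Hd].
have d'0 : 0 < r - nc (a - c) by rewrite subr_gt0.
exists (Num.min d (r - nc (a - c))); first by rewrite lt_min d0.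
move=> x; rewrite lt_min => /andP[xd xr].
rewrite cauchyT_sub //; last first.
  rewrite lt_eqF //; have := nc_tri x a c; lra.
by rewrite mulrC -mulrBl ncM ler_wpM2r ?nc_ge0 // ltW // Hd.
Qed.

Lemma cauchyT_dd c r phi a x : nc (a - c) < r -> nc (x - c) < r -> circle_good c r phi ->
  dd (cauchyT c r phi) a x = cauchyT c r (fun y => phi y / (y - a)) x.
Proof.
move=> ar xr gp; have r0 : 0 < r by exact: le_lt_trans (nc_ge0 _) ar.
rewrite /dd; case: eqVneq => [->|xa].
  exact: cdiff_derive1 (cauchyT_cdiff ar gp).
by rewrite cauchyT_sub ?lt_eqF // mulrAC divff ?mul1r // subr_eq0.
Qed.

Lemma open_disc U a : open (U : set R[i]^o) -> U a ->
  exists2 d, 0 < d & forall y, nc (y - a) <= d -> U y.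
Proof.
move=> /open_ncP oU /oU[d d0 H]; exists (d / 2); first by rewrite divr_gt0.
move=> y yd; apply: H; apply: le_lt_trans yd _.
by rewrite ltr_pdivrMr // ltr_pMr // ltr1n.
Qed.

(* Near a, an analytic function is the Cauchy transform of its values on a
   small circle, on which it is bounded by continuity. *)
Lemma analytic_local U g a : analytic_on U g -> U a ->
  exists r C : R, [/\ 0 < r, circle_good a r g, forall y, nc (y - a) = r -> nc (g y) <= C &
    forall x, nc (x - a) < r -> U x /\ g x = (2 * pi%:C * 'i)^-1 * cauchyT a r g x].
Proof.
move=> ag Ua; have oU : open (U : set R[i]^o) by case: ag.
have [d d0 dU] := open_disc oU Ua.
have /ccts_complexP /(_ 1 ltr01) [d' d'0 Hd'] := analytic_ccts ag Ua.
pose r := Num.min d (d' / 2).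
have r0 : 0 < r by rewrite lt_min d0 divr_gt0.
have rd : r <= d by rewrite ge_min lexx.
have rd' : r < d'.
  by rewrite gt_min (_ : d' / 2 < d') ?orbT // ltr_pdivrMr // ltr_pMr // ltr1n.
have rU y : nc (y - a) <= r -> U y by move=> yr; apply: dU; exact: le_trans rd.
have gC y : nc (y - a) = r -> nc (g y) <= nc (g a) + 1.
  move=> yr; rewrite -[g y](subrK (g a)) addrC; apply: le_trans (ncD _ _) _.
  by rewrite lerD2l ltW // Hd' // yr.
have gg : circle_good a r g.
  apply: (circle_good_cts r0).
  by move=> y yr; apply: (analytic_ccts ag); apply: rU; rewrite yr.
exists r, (nc (g a) + 1); split=> // x xr; split; first by apply: rU; exact: ltW.
rewrite /cauchyT (cauchy_formula ag rU xr gg) mulKf //.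
rewrite -nc_eq0 !ncM nc_i mulr1 ncR mulf_neq0 // ?normr_eq0 ?gt_eqF ?pi_gt0 //.
by rewrite nc_gt0 pnatr_eq0.
Qed.

Lemma cdiffZ (b : R[i]) g x D : cdiff g x D -> cdiff (fun y => b * g y) x (b * D).
Proof. by move=> gD; apply: cdiff_eq (cdiffM (cdiff_cst b x) gD) _; rewrite mulr0 addr0. Qed.

(* At a itself: near a, g is a Cauchy transform, and the divided differences of
   a Cauchy transform are Cauchy transforms again. *)
Lemma analytic_dd U g a : analytic_on U g -> U a -> analytic_on U (dd g a).
Proof.
move=> ag Ua; apply/analyticP; split; first by case: ag.
move=> x Ux; have [->{x Ux}|xa] := eqVneq x a; last first.
  exact: dd_cdiff_off xa (analytic_cdiff ag Ux).
have [r [C [r0 gg _ H]]] := analytic_local ag Ua.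
pose b := (2 * pi%:C * 'i)^-1 : R[i].
have aa : nc (a - a) < r by rewrite subrr nc0.
have gg' : circle_good a r (fun y => g y / (y - a)) by apply: (circle_good_div r0 _ gg); rewrite lt_eqF.
exists (b * cauchyT a r (fun y => g y / (y - a) / (y - a)) a).
apply: (cdiff_local r0) (cdiffZ b (cauchyT_cdiff aa gg')) => x xr.
rewrite -(cauchyT_dd aa xr gg) /dd; case: eqVneq => [_|xa].
  rewrite (cdiff_derive1 (cauchyT_cdiff aa gg)); apply/esym/cdiff_derive1.
  apply: (cdiff_local r0) (cdiffZ b (cauchyT_cdiff aa gg)) => y yr.
  by have [_ ->] := H y yr.
have [_ ->] := H x xr; have [_ ->] := H a aa.
by rewrite -mulrBr mulrA.
Qed.

(** Cauchy's estimate on the disc of half the radius, where the distance to the circle is at least r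
    / 2. It makes (x - a) q' x small near a in the proof that derivatives are analytic. *)
Lemma cderive_bounded U g a : analytic_on U g -> U a ->
  exists C d, 0 < d /\ forall x, nc (x - a) < d -> nc (cderive 1 g x) <= C.
Proof.
move=> ag Ua; have [r [C [r0 gg gC H]]] := analytic_local ag Ua.
pose b := (2 * pi%:C * 'i)^-1 : R[i].
exists (nc b * (4 * pi * r * (C / (r / 2) / (r / 2)))), (r / 2); split; first by rewrite divr_gt0.
move=> x xr2.
have xr : nc (x - a) < r by apply: lt_trans xr2 _; rewrite ltr_pdivrMr // ltr_pMr // ltr1n.
have -> : cderive 1 g x = b * cauchyT a r (fun y => g y / (y - x)) x.
  apply: cdiff_derive1; have d0 : 0 < r - nc (x - a) by rewrite subr_gt0.
  apply: (cdiff_local d0) (cdiffZ b (cauchyT_cdiff xr gg)) => y yx.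
  have [] := H y; first by have := nc_tri y x a; lra.
  by move=> _ ->.
have r20 : 0 < r / 2 by rewrite divr_gt0.
rewrite ncM ler_wpM2l ?nc_ge0 //; apply: (nc_cauchyT r0 r20).
- by rewrite ger0_norm; lra.
- by apply: (circle_good_div r0 _ gg); rewrite lt_eqF.
move=> s _; have yr := nc_circle a s r0.
move: (a + r%:C * expi s) yr => y yr; rewrite ncM ncV.
have h := nc_sub_circle x yr.
have yx : r / 2 <= nc (y - x) by lra.
apply: ler_pM; rewrite ?nc_ge0 ?gC ?invr_ge0 ?nc_ge0 //.
by rewrite lef_pV2 ?posrE //; exact: lt_le_trans yx.
Qed.

(* Differentiate g x = g a + (x - a) (g' a + (x - a) q x) with q analytic. *)
Lemma analytic_cderive1 U g : analytic_on U g -> analytic_on U (cderive 1 g).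
Proof.
move=> ag; apply/analyticP; split; first by case: ag.
move=> a Ua; have [q qE] : exists q, q = dd (dd g a) a by eexists.
have aq : analytic_on U q by rewrite qE; exact: analytic_dd (analytic_dd ag Ua) Ua.
have gE x : g x = g a + (x - a) * (cderive 1 g a + (x - a) * q x).
  by rewrite {1}(ddE g a x) (ddE (dd g a) a x) dd_eq0 qE.
have g'E x : U x -> cderive 1 g x = cderive 1 g a + (x - a) * (2 * q x + (x - a) * cderive 1 q x).
  move=> Ux; apply: cdiff_derive1; have qD := analytic_cdiff aq Ux.
  have xD := cdiffB (cdiff_id x) (cdiff_cst a x).
  have := cdiffD (cdiff_cst (g a) x)
    (cdiffM xD (cdiffD (cdiff_cst (cderive 1 g a) x) (cdiffM xD qD))).
  rewrite (_ : (fun y => _) = g); last by apply/funext => y; rewrite -gE.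
  move=> H; apply: (cdiff_eq H).
  by move: (cderive 1 g a) (cderive 1 q x) (q x) => ? ? ?; ring.
have [C [d [d0 HC]]] := cderive_bounded aq Ua.
have oU : open (U : set R[i]^o) by case: ag.
have [d1 d10 dU] := open_disc oU Ua.
exists (2 * q a); apply/cdiffP => e e0.
have e40 : 0 < e / 4 by rewrite divr_gt0.
have /ccts_complexP /(_ _ e40) [d2 d20 H2] := analytic_ccts aq Ua.
pose K := `|C| + 1.
have K0 : 0 < K by rewrite ltr_wpDl.
have CK : C < K by rewrite (le_lt_trans (ler_norm C)) // ltrDl.
(* The tolerance e is spent as 2 (e / 4) on q x - q a and d3 K = e / 2 on the term with q', which K
   bounds near a. *)
pose d3 := e / 2 / K.
have d30 : 0 < d3 by rewrite !divr_gt0.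
exists (Num.min (Num.min d d1) (Num.min d2 d3)); first by rewrite !lt_min d0 d10 d20 d30.
move=> x; rewrite !lt_min => /andP[/andP[xd xd1] /andP[xd2 xd3]].
rewrite g'E; last by apply: dU; exact: ltW.
rewrite (_ : _ - _ - _ = (2 * (q x - q a) + (x - a) * cderive 1 q x) * (x - a)); last first.
  by move: (cderive 1 g a) (cderive 1 q x) (q x) (q a) => ? ? ? ?; ring.
rewrite ncM ler_wpM2r ?nc_ge0 //; apply: le_trans (ncD _ _) _; rewrite !ncM.
have -> : nc 2 = 2 by rewrite -[2]/(2%:R) -(rmorph_nat (@real_complex R)) ncR normr_nat.
have h1 := HC x xd; have h2 := H2 x xd2.
have h3 : nc (x - a) * nc (cderive 1 q x) <= d3 * K.
  by apply: ler_pM; rewrite ?nc_ge0 //; [exact: ltW|exact: le_trans (ltW CK)].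
move: h3; rewrite /d3 mulfVK ?gt_eqF //; lra.
Qed.

Lemma cderive0 g : cderive 0 g = g.
Proof. by []. Qed.

Lemma cderiveS j g : cderive j.+1 g = cderive 1 (cderive j g).
Proof. by []. Qed.

Lemma analytic_cderive U g j : analytic_on U g -> analytic_on U (cderive j g).
Proof. by move=> ag; elim: j => [|j IHj]; [exact: ag|exact: (analytic_cderive1 IHj)]. Qed.
End Cauchy.

Local Opaque cderive analytic_on circle_good.

(** * Newton interpolation of analytic functions *)

Section AnalyticAlgebra.
Variable R : realType.
Implicit Types (a c x y : R[i]) (g h e phi : R[i] -> R[i]) (U V W : set R[i])
  (p : {poly R[i]}) (s : seq R[i]).
Local Notation nc := (@Normc.normc R).

Lemma analytic_open U g : analytic_on U g -> open (U : set R[i]^o).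
Proof. by move=> /analyticP[]. Qed.

Lemma analytic_sub U V g : open (V : set R[i]^o) -> V `<=` U ->
  analytic_on U g -> analytic_on V g.
Proof. by move=> oV VU /analyticP[_ ag]; apply/analyticP; split=> // x /VU /ag. Qed.

Lemma open_eq_disc W x g h : open (W : set R[i]^o) -> W x ->
  (forall y, W y -> g y = h y) ->
  exists2 d : R, 0 < d & forall y, nc (y - x) < d -> g y = h y.
Proof.
by move=> /open_ncP oW /oW[d d0 dW] gh; exists d => // y /dW /gh.
Qed.

Lemma cdiff_on W x g h D : open (W : set R[i]^o) -> W x ->
  (forall y, W y -> g y = h y) -> cdiff g x D -> cdiff h x D.
Proof.
by move=> oW Wx gh; have [d d0 H]  := open_eq_disc oW Wx gh; exact: (cdiff_local d0 H).
Qed.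

Lemma eq_analytic W g h : (forall y, W y -> g y = h y) ->
  analytic_on W g -> analytic_on W h.
Proof.
move=> gh /analyticP[oW ag]; apply/analyticP; split=> // x Wx.
by have [D gD] := ag _ Wx; exists D; exact: (cdiff_on oW Wx gh gD).
Qed.

Lemma eq_cderive W g h j : analytic_on W g -> (forall y, W y -> g y = h y) ->
  forall x, W x -> cderive j g x = cderive j h x.
Proof.
move=> ag gh; have oW := analytic_open ag.
elim: j => [|j IHj] x Wx; first exact: gh.
have := analytic_cdiff (analytic_cderive j ag) Wx.
move=> /(cdiff_on oW Wx IHj) /cdiff_derive1 E.
rewrite (cderiveS j g) (cderiveS j h) E.
reflexivity.
Qed.

Lemma cdiff_cderiveS g j x D : cdiff (cderive j g) x D -> cderive j.+1 g x = D.
Proof. by rewrite (cderiveS j); exact: cdiff_derive1. Qed.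

Lemma analytic_cst W c : open (W : set R[i]^o) -> analytic_on W (fun=> c).
Proof. by move=> oW; apply/analyticP; split=> // x _; exists 0; exact: cdiff_cst. Qed.
Lemma analyticD W g h : analytic_on W g -> analytic_on W h ->
  analytic_on W (fun x => g x + h x).
Proof.
move=> ag ah; apply/analyticP; split=> [|x Wx]; first exact: analytic_open ag.
by eexists; apply: cdiffD; [exact: analytic_cdiff ag Wx|exact: analytic_cdiff ah Wx].
Qed.
Lemma analyticM W g h : analytic_on W g -> analytic_on W h ->
  analytic_on W (fun x => g x * h x).
Proof.
move=> ag ah; apply/analyticP; split=> [|x Wx]; first exact: analytic_open ag.
by eexists; apply: cdiffM; [exact: analytic_cdiff ag Wx|exact: analytic_cdiff ah Wx].
Qed.
Lemma analyticZ W c g : analytic_on W g -> analytic_on W (fun x => c * g x).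
Proof. by move=> ag; exact: (analyticM (analytic_cst c (analytic_open ag)) ag). Qed.
Lemma analyticB W g h : analytic_on W g -> analytic_on W h ->
  analytic_on W (fun x => g x - h x).
Proof.
move=> ag ah; apply/analyticP; split=> [|x Wx]; first exact: analytic_open ag.
by eexists; apply: cdiffB; [exact: analytic_cdiff ag Wx|exact: analytic_cdiff ah Wx].
Qed.
Lemma analyticV W g : (forall x, W x -> g x != 0) -> analytic_on W g ->
  analytic_on W (fun x => (g x)^-1).
Proof.
move=> g0 ag; apply/analyticP; split=> [|x Wx]; first exact: analytic_open ag.
by eexists; apply: cdiffV; [exact: g0|exact: analytic_cdiff ag Wx].
Qed.

Lemma cdiff_horner p x : cdiff (fun y => p.[y]) x p^`().[x].
Proof.
elim/poly_ind: p => [|p c IHp].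
  rewrite deriv0 horner0 (_ : (fun _ => _) = fun=> 0); first exact: cdiff_cst.
  by apply/funext => y; rewrite horner0.
have := cdiffD (cdiffM IHp (cdiff_id x)) (cdiff_cst c x).
rewrite (_ : (fun y => _) = fun y => (p * 'X + c%:P).[y]); last first.
  by apply/funext => y; rewrite !hornerE.
by move=> H; apply: (cdiff_eq H); rewrite derivMXaddC hornerD hornerMX; ring.
Qed.
Lemma analytic_horner W p : open (W : set R[i]^o) -> analytic_on W (fun x => p.[x]).
Proof. by move=> oW; apply/analyticP; split=> // x _; exists p^`().[x]; exact: cdiff_horner. Qed.
Lemma cderive_horner j p x : cderive j (fun y => p.[y]) x = p^`(j).[x].
Proof.
elim: j x => [|j IHj] x; first by rewrite derivn0.
apply: cdiff_cderiveS; rewrite (_ : cderive j _ = fun y => p^`(j).[y]); last exact/funext.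
by rewrite derivnS; exact: cdiff_horner.
Qed.
Lemma cderive_horner_small j p x : (size p <= j)%N -> cderive j (fun y => p.[y]) x = 0.
Proof. by move=> pj; rewrite cderive_horner derivn_poly0 // horner0. Qed.

Lemma cderiveB W g h j x : analytic_on W g -> analytic_on W h -> W x ->
  cderive j (fun y => g y - h y) x = cderive j g x - cderive j h x.
Proof.
move=> ag ah; elim: j x => [|j IHj] x Wx; first by [].
have oW := analytic_open ag.
have H := cdiffB (analytic_cdiff (analytic_cderive j ag) Wx)
  (analytic_cdiff (analytic_cderive j ah) Wx).
apply: cdiff_cderiveS.
apply: (cdiff_on oW Wx _ H) => y Wy; exact/esym/IHj.
Qed.

Lemma open_horner_neq0 p : open ([set x | p.[x] != 0] : set R[i]^o).
Proof.
apply/open_ncP => x /= px.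
have /ccts_complexP H := cdiff_ccts (cdiff_horner p x).
have [d d0 Hd] := H (nc p.[x]) ltac:(by rewrite nc_gt0).
exists d => // y /Hd; apply: contraTneq => ->.
by rewrite sub0r ncN ltxx.
Qed.
Lemma analytic_ratfun (u v : {poly R[i]}) : analytic_on [set x | v.[x] != 0] (ratfun u v).
Proof.
have oV := @open_horner_neq0 v.
apply: analyticM; first exact: analytic_horner.
by apply: analyticV => //; exact: analytic_horner.
Qed.

(** A linear factor leaves two terms of Leibniz's rule. Along a segment from a, where x - a is
    proportional to t, their sum is the combination that [max_principle] bounds. *)
Lemma cderive_leibniz W c a e phi j : analytic_on W e ->
  (forall x, W x -> phi x = c + (x - a) * e x) ->
  forall x, W x -> cderive j.+1 phi x =
    j.+1%:R * cderive j e x + (x - a) * cderive j.+1 e x.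
Proof.
move=> ae pE; have oW := analytic_open ae.
have xa x := cdiffB (cdiff_id x) (cdiff_cst a x).
elim: j => [|j IHj] x Wx.
  have H := cdiffD (cdiff_cst c x) (cdiffM (xa x) (analytic_cdiff ae Wx)).
  apply: cdiff_derive1; apply: (cdiff_on oW Wx (fun y Wy => esym (pE y Wy))).
  apply: (cdiff_eq H); rewrite cderive0.
  by move: (cderive 1 e x) (e x) => ? ?; ring.
have H := cdiffD (cdiffZ j.+1%:R (analytic_cdiff (analytic_cderive j ae) Wx))
  (cdiffM (xa x) (analytic_cdiff (analytic_cderive j.+1 ae) Wx)).
apply: cdiff_cderiveS.
apply: (cdiff_on oW Wx (fun y Wy => esym (IHj y Wy))).
apply: (cdiff_eq H).
rewrite [in RHS]mulrS.
by rewrite -!cderiveS; move: (cderive j.+1 e x) (cderive j.+2 e x) => ? ?; ring.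
Qed.

Lemma cderive_dd U g a j x : analytic_on U g -> U a -> U x ->
  cderive j.+1 g x = j.+1%:R * cderive j (dd g a) x + (x - a) * cderive j.+1 (dd g a) x.
Proof.
move=> ag Ua Ux; have E y : U y -> g y = g a + (y - a) * dd g a y by move=> _; exact: ddE.
exact: (cderive_leibniz j (analytic_dd ag Ua) E Ux).
Qed.

(* Hermite interpolation polynomial at the points of s, in Newton's form, and the
   divided difference x |-> g[s, x]. *)
Fixpoint newton s g : {poly R[i]} :=
  if s is y :: s' then (g y)%:P + ('X - y%:P) * newton s' (dd g y) else 0.
Fixpoint ddl s g : R[i] -> R[i] := if s is y :: s' then ddl s' (dd g y) else g.
Definition nodal s : {poly R[i]} := \prod_(y <- s) ('X - y%:P).

(** [ddE] is an identity for arbitrary functions, the factor x - a vanishing at the node itself; its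
    iteration gives Newton's formula with remainder, repeated points included. *)
Lemma newtonE s g x : g x = (newton s g).[x] + (nodal s).[x] * ddl s g x.
Proof.
rewrite /nodal; elim: s g => [|y s IHs] g /=.
  by rewrite big_nil horner0 hornerC add0r mul1r.
rewrite big_cons !hornerM hornerD hornerM hornerXsubC hornerC (ddE g y x).
  by rewrite (IHs (dd g y)) mulrDr addrA -mulrA.
Qed.

Lemma analytic_ddl U s g : analytic_on U g -> (forall y, y \in s -> U y) ->
  analytic_on U (ddl s g).
Proof.
elim: s g => [|y s IHs] g ag sU; first exact: ag.
apply: (IHs _ (analytic_dd ag (sU _ (mem_head y s)))) => x xs.
by apply: sU; rewrite inE xs orbT.
Qed.

Lemma nodal_cat s1 s2 : nodal (s1 ++ s2) = nodal s1 * nodal s2.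
Proof. by rewrite /nodal big_cat. Qed.
Lemma horner_nodal s x : (nodal s).[x] = \prod_(y <- s) (x - y).
Proof. by rewrite horner_prod; apply: eq_bigr => y _; rewrite !hornerE. Qed.
Lemma root_nodal s x : ((nodal s).[x] == 0) = (x \in s).
Proof.
rewrite horner_nodal; elim: s => [|y s IHs]; first by rewrite big_nil oner_eq0.
by rewrite big_cons mulf_eq0 IHs inE subr_eq0.
Qed.

Definition vanishes g x n := forall j, (j < n)%N -> cderive j g x = 0.

(** By [cderive_dd]: at x = a the second term drops out, so one order is lost; elsewhere x - a is
    invertible and induction on j kills the first term. *)
Lemma vanishes_dd W g a x n : analytic_on W g -> W a -> W x -> g a = 0 ->
  vanishes g x n -> vanishes (dd g a) x (n - (x == a)).
Proof.
move=> ag Wa Wx ga gx; have [xa|xa] := eqVneq x a => j.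
  rewrite ltn_subRL addnC addn1 => /gx /eqP.
  rewrite (cderive_dd j ag Wa Wx) {2}xa subrr mul0r addr0 mulf_eq0 pnatr_eq0 /=.
  by move/eqP.
rewrite subn0; elim: j => [|j IHj] jn.
  have := gx 0%N jn; rewrite !cderive0 /dd (negbTE xa) ga => ->.
  by rewrite subrr mul0r.
have := gx _ jn; rewrite (cderive_dd j ag Wa Wx) IHj ?(ltnW jn) // mulr0 add0r.
by move/eqP; rewrite mulf_eq0 subr_eq0 (negbTE xa) /= => /eqP.
Qed.

(** Passes from f - r to v (f - r). Pulling out one factor y - x at a time needs only
    [cderive_leibniz], not the general product rule. *)
Lemma vanishes_mul W g h x n : analytic_on W g -> analytic_on W h -> W x ->
  vanishes g x n -> vanishes (fun y => h y * g y) x n.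
Proof.
move=> ag ah Wx; elim: n g ag => [|n IHn] g ag gx; first by move=> j; rewrite ltn0.
have g0 : g x = 0 by rewrite -(cderive0 g); exact: (gx 0%N).
have ae := analytic_dd ag Wx.
have ex : vanishes (dd g x) x n.
  by have := vanishes_dd ag Wx Wx g0 gx; rewrite eqxx subn1.
have hex := IHn _ ae ex.
case=> [_|j jn]; first by rewrite !cderive0 g0 mulr0.
have E y : W y -> h y * g y = 0 + (y - x) * (h y * dd g x y).
  by move=> _; rewrite (ddE g x y) g0 !add0r mulrCA.
rewrite (cderive_leibniz j (analyticM ah ae) E Wx).
by rewrite (hex j jn) mulr0 subrr mul0r addr0.
Qed.

(* Dividing by x - y lowers the order of vanishing at y by one and keeps it
   elsewhere. *)
Lemma newton_vanishes W s g : analytic_on W g -> (forall y, y \in s -> W y) ->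
  (forall x, x \in s -> vanishes g x (count_mem x s)) -> newton s g = 0.
Proof.
elim: s g => [|y s IHs] g ag sW gs; first by [].
have Wy : W y by apply: sW; exact: mem_head.
have gy : g y = 0.
  by rewrite -(cderive0 g); apply: (gs y _ 0%N); rewrite ?inE ?eqxx //= eqxx.
have sW' x : x \in s -> W x by move=> xs; apply: sW; rewrite inE xs orbT.
rewrite [newton _ _]/= gy add0r (IHs (dd g y) (analytic_dd ag Wy) sW') ?mulr0 // => x xs.
have xys : x \in y :: s by rewrite inE xs orbT.
have := vanishes_dd ag Wy (sW _ xys) gy (gs _ xys).
by rewrite /= eq_sym addKn.
Qed.
End AnalyticAlgebra.

Local Opaque circle_integral.

(** * Contours *)

Section Contours.
Variable R : realType.
Implicit Types (a c x y : R[i]) (g h q phi : R[i] -> R[i]) (U V W : set R[i])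
  (p : {poly R[i]}) (s : seq R[i]) (G : contour R).
Local Notation nc := (@Normc.normc R).

Definition contour_good G h := forall d, d \in G -> circle_good d.1 d.2 h.
Definition contour_pos G := forall d, d \in G -> 0 < d.2.
Definition inside G x := exists2 d, d \in G & nc (x - d.1) < d.2.
Definition off_contour G x := forall d, d \in G -> nc (x - d.1) != d.2.

Lemma contour_integral_nil h : contour_integral [::] h = 0.
Proof. by rewrite /contour_integral big_nil. Qed.
Lemma contour_integral_cons d G h :
  contour_integral (d :: G) h = circle_integral d.1 d.2 h + contour_integral G h.
Proof. by rewrite /contour_integral big_cons. Qed.

Lemma eq_contour G g h : contour_pos G ->
  (forall d y, d \in G -> nc (y - d.1) = d.2 -> g y = h y) ->
  contour_integral G g = contour_integral G h.
Proof.
move=> G0 gh; apply: eq_big_seq => d dG; apply: eq_circle; first exact: G0.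
by move=> y; exact: gh.
Qed.
Lemma contourD G g h : contour_good G g -> contour_good G h ->
  contour_integral G (fun y => g y + h y) = contour_integral G g + contour_integral G h.
Proof.
move=> gg gh; rewrite /contour_integral -big_split; apply: eq_big_seq => d dG.
exact: circleD (gg d dG) (gh d dG).
Qed.
Lemma contourZ G (b : R[i]) h : contour_good G h ->
  contour_integral G (fun y => b * h y) = b * contour_integral G h.
Proof.
move=> gh; rewrite /contour_integral big_distrr; apply: eq_big_seq => d dG.
exact: circleZ (gh d dG).
Qed.
Lemma contour_good_cst G (b : R[i]) : contour_good G (fun=> b).
Proof. by move=> d _; exact: circle_good_cst. Qed.
Lemma contour_goodD G g h : contour_good G g -> contour_good G h ->
  contour_good G (fun y => g y + h y).
Proof. by move=> gg gh d dG; exact: circle_goodD (gg d dG) (gh d dG). Qed.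
Lemma contour_goodM G g h : contour_good G g -> contour_good G h ->
  contour_good G (fun y => g y * h y).
Proof. by move=> gg gh d dG; exact: circle_goodM (gg d dG) (gh d dG). Qed.
Lemma contour_good_inv G x : contour_pos G -> off_contour G x ->
  contour_good G (fun y => (y - x)^-1).
Proof. by move=> G0 Gx d dG; exact: circle_good_inv (G0 d dG) (Gx d dG). Qed.
Lemma contour_good_sum (I : Type) (r : seq I) (F : I -> R[i] -> R[i]) G :
  (forall i, contour_good G (F i)) -> contour_good G (fun y => \sum_(i <- r) F i y).
Proof.
move=> FG; elim: r => [|i r IHr].
  rewrite (_ : (fun _ => _) = fun=> 0); first exact: contour_good_cst.
  by apply/funext => y; rewrite big_nil.
rewrite (_ : (fun _ => _) = fun y => F i y + \sum_(i <- r) F i y).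
  exact: contour_goodD (FG i) IHr.
by apply/funext => y; rewrite big_cons.
Qed.
Lemma contour_sum (I : Type) (r : seq I) (F : I -> R[i] -> R[i]) G :
  (forall i, contour_good G (F i)) ->
  contour_integral G (fun y => \sum_(i <- r) F i y) =
  \sum_(i <- r) contour_integral G (F i).
Proof.
move=> FG; elim: r => [|i r IHr].
  rewrite big_nil -[RHS](mul0r (contour_integral G (fun=> 0))) -contourZ.
    by congr contour_integral; apply/funext => y; rewrite big_nil mul0r.
  exact: contour_good_cst.
rewrite big_cons -IHr -contourD; [|exact: FG|exact: contour_good_sum].
by congr contour_integral; apply/funext => y; rewrite big_cons.
Qed.
Lemma contour_good_poly p G : contour_good G (fun y => p.[y]).
Proof.
elim/poly_ind: p => [|p c IHp].
  rewrite (_ : (fun _ => _) = fun=> 0); first exact: contour_good_cst.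
  by apply/funext => y; rewrite horner0.
have idG : contour_good G id by move=> d dG; exact: circle_good_id.
rewrite (_ : (fun _ => _) = fun y => p.[y] * y + c).
  by apply: contour_goodD; [exact: contour_goodM IHp idG|exact: contour_good_cst].
by apply/funext => y; rewrite hornerMXaddC.
Qed.

Lemma contour_integral_eq0 U G h : contour_pos G ->
  (forall d, d \in G -> [set x | nc (x - d.1) <= d.2] `<=` U) ->
  analytic_on U h -> contour_integral G h = 0.
Proof.
move=> G0 GU ah; rewrite /contour_integral big_seq big1 // => d dG.
apply: circle_integral_disc; first exact: G0.
by move=> y yd; eexists; apply: analytic_cdiff ah _; exact: GU dG _ yd.
Qed.

Lemma circle_inv_out c (r : R) x : 0 < r -> r < nc (x - c) ->
  circle_integral c r (fun y => (y - x)^-1) = 0.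
Proof.
move=> r0 rx; apply: circle_integral_disc => // y yr; eexists; apply: cdiff_inv.
by apply: contraTneq rx => <-; rewrite -leNgt.
Qed.

Definition disjoint_discs := pairwise (fun d e : R[i] * R => d.2 + e.2 < nc (d.1 - e.1)).

Lemma inside_off G x : contour_pos G -> disjoint_discs G -> inside G x -> off_contour G x.
Proof.
move=> G0 Gd [d dG xd] e eG; have [->|de] := eqVneq e d; first by rewrite lt_eqF.
have : d.2 + e.2 < nc (d.1 - e.1).
  move: dG eG de Gd; elim: (G) => [|f F IHF]; first by rewrite in_nil.
  rewrite !inE /disjoint_discs pairwise_cons => /orP[/eqP->|dF] /orP[/eqP->|eF] de.
  - by rewrite eqxx in de.
  - by move=> /andP[/allP /(_ _ eF)].
  - by move=> /andP[/allP /(_ _ dF) h _]; rewrite ncB addrC.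
  - by move=> /andP[_]; exact: IHF.
move=> h; rewrite gt_eqF //; have := nc_tri d.1 x e.1; rewrite [nc (d.1 - x)]ncB; lra.
Qed.

Lemma contour_inv_inside G x : contour_pos G -> disjoint_discs G -> inside G x ->
  contour_integral G (fun y => (y - x)^-1) = 2 * pi%:C * 'i.
Proof.
elim: G => [|d G IHG] G0 Gd; first by case=> ?; rewrite in_nil.
have G0' : contour_pos G by move=> e eG; apply: G0; rewrite inE eG orbT.
move: Gd; rewrite /disjoint_discs pairwise_cons => /andP[/allP dG Gd] [e].
rewrite contour_integral_cons inE => /orP[/eqP->|eG] xe.
  rewrite circle_inv_in // /contour_integral big_seq big1 ?addr0 // => f fG.
  apply: circle_inv_out; first exact: G0'.
  by have := nc_tri d.1 x f.1; rewrite [nc (d.1 - x)]ncB; have := dG f fG; lra.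
rewrite IHG //; last by exists e.
rewrite circle_inv_out ?add0r //; first by apply: G0; rewrite mem_head.
by have := nc_tri d.1 x e.1; rewrite [nc (d.1 - x)]ncB; have := dG e eG; lra.
Qed.

Definition contourT G phi x := contour_integral G (fun y => phi y / (y - x)).

Lemma contourT_sub G phi x a : contour_pos G -> off_contour G x -> off_contour G a ->
  contour_good G phi ->
  contourT G phi x - contourT G phi a =
  (x - a) * contourT G (fun y => phi y / (y - a)) x.
Proof.
move=> G0 Gx Ga gp; rewrite /contourT /contour_integral -sumrB big_distrr.
apply: eq_big_seq => d dG.
exact: cauchyT_sub (G0 d dG) (Gx d dG) (Ga d dG) (gp d dG).
Qed.

Lemma contourT_ccts G phi a : contour_pos G -> off_contour G a -> contour_good G phi ->
  ccts (contourT G phi : R[i]^o -> R[i]) a.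
Proof.
elim: G => [|d G IHG] G0 Ga gp.
  rewrite (_ : contourT _ _ = fun=> 0); first exact: ccts_cst.
  by apply/funext => x; exact: contour_integral_nil.
have sub e : e \in G -> e \in d :: G by move=> eG; rewrite inE eG orbT.
rewrite (_ : contourT _ _ = fun x => cauchyT d.1 d.2 phi x + contourT G phi x).
  have dG := mem_head d G.
  have h1 := cauchyT_ccts (G0 d dG) (Ga d dG) (gp d dG).
  have h2 := IHG (fun e eG => G0 e (sub e eG)) (fun e eG => Ga e (sub e eG))
    (fun e eG => gp e (sub e eG)).
  exact: (@cctsD _ (R[i]^o) _ _ a h1 h2).
by apply/funext => x; exact: contour_integral_cons.
Qed.

(* The divided differences of a constant vanish; at x = a use continuity. *)
Lemma contourT_div G phi K : contour_pos G -> disjoint_discs G -> contour_good G phi ->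
  (forall x, inside G x -> contourT G phi x = K) ->
  forall a x, inside G a -> inside G x -> contourT G (fun y => phi y / (y - a)) x = 0.
Proof.
move=> G0 Gd gp phiK a x ia ix.
have off := inside_off G0 Gd.
have key z : inside G z -> z != a -> contourT G (fun y => phi y / (y - a)) z = 0.
  move=> iz za; have := contourT_sub G0 (off _ iz) (off _ ia) gp.
  rewrite !phiK // subrr => /esym/eqP; rewrite mulf_eq0 subr_eq0 (negbTE za) /=.
  by move/eqP.
have [->|xa] := eqVneq x a; last exact: key.
have gp' : contour_good G (fun y => phi y / (y - a)).
  by exact: contour_goodM gp (contour_good_inv G0 (off _ ia)).
have /ccts_complexP H := contourT_ccts G0 (off _ ia) gp'.
apply/eqP; rewrite -nc_eq0 eq_le nc_ge0 andbT; apply/ler_addgt0Pl => e e0.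
rewrite addr0; have [d d0 Hd] := H e e0.
have [f fG af] := ia.
(* The shift a + m is a point other than a, within d of it and in the same disc, where [key]
   applies. *)
pose m : R := Num.min d (f.2 - nc (a - f.1)) / 2.
have m0 : 0 < m by rewrite divr_gt0 // lt_min d0 subr_gt0.
have [md mf] : m < d /\ m < f.2 - nc (a - f.1).
  have h : m < Num.min d (f.2 - nc (a - f.1)).
    by rewrite ltr_pdivrMr // ltr_pMr ?ltr1n // lt_min d0 subr_gt0.
  by move: h; rewrite lt_min => /andP[].
have ncm : nc (a + m%:C - a) = m by rewrite addrC addKr ncR gtr0_norm.
have am : a + m%:C != a by rewrite -subr_eq0 -nc_eq0 ncm gt_eqF.
have := Hd (a + m%:C); rewrite ncm key ?sub0r ?ncN; first by move=> /(_ md) /ltW.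
  exists f => //; have := nc_tri (a + m%:C) a f.1; rewrite ncm; lra.
exact: am.
Qed.

Lemma contour_good_nodal G s : contour_pos G -> (forall y, y \in s -> off_contour G y) ->
  contour_good G (fun y => (nodal s).[y]^-1).
Proof.
move=> G0; elim: s => [|a s IHs] sG.
  rewrite (_ : (fun _ => _) = fun=> 1); first exact: contour_good_cst.
  by apply/funext => y; rewrite /nodal big_nil hornerC invr1.
rewrite (_ : (fun _ => _) = fun y => (nodal s).[y]^-1 * (y - a)^-1).
  apply: contour_goodM; last by apply: contour_good_inv => //; apply: sG; exact: mem_head.
  by apply: IHs => y ys; apply: sG; rewrite inE ys orbT.
by apply/funext => y; rewrite /nodal big_cons hornerM hornerXsubC invfM mulrC.
Qed.

(** All poles are inside and there are at least two with multiplicity, so the residues sum to 0. As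
    poles may coincide, factors are added one at a time: each passes from a transform constant
    inside (2 pi i, then 0) to its divided difference. *)
Lemma contour_inv_nodal G s x : contour_pos G -> disjoint_discs G -> s != [::] ->
  (forall y, y \in s -> inside G y) -> inside G x ->
  contour_integral G (fun y => ((nodal s).[y] * (y - x))^-1) = 0.
Proof.
move=> G0 Gd; have off := inside_off G0 Gd.
have gd t (tG : forall y, y \in t -> inside G y) :=
  contour_good_nodal G0 (fun y yt => off y (tG y yt)).
have E t : contourT G (fun y => (nodal t).[y]^-1) = fun x =>
    contour_integral G (fun y => ((nodal t).[y] * (y - x))^-1).
  by apply/funext => z; congr contour_integral; apply/funext => y; rewrite invfM.
move=> s0 sG ix; rewrite -[LHS]/((fun x => _) x) -E.
elim: s s0 sG x ix => // a s IHs _ sG x ix.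
have ia : inside G a by apply: sG; exact: mem_head.
have sG' y : y \in s -> inside G y by move=> ys; apply: sG; rewrite inE ys orbT.
rewrite (_ : (fun y => _) = fun y => (nodal s).[y]^-1 / (y - a)); last first.
  by apply/funext => y; rewrite /nodal big_cons hornerM hornerXsubC invfM mulrC.
have [s0|s0] := eqVneq s [::].
  apply: (contourT_div (K := 2 * pi%:C * 'i) G0 Gd (gd _ sG') _ ia ix) => z iz.
  rewrite -(contour_inv_inside G0 Gd iz) /contourT s0.
  by congr contour_integral; apply/funext => y; rewrite /nodal big_nil hornerC invr1 mul1r.
by apply: (contourT_div (K := 0) G0 Gd (gd _ sG') _ ia ix) => z iz; exact: IHs.
Qed.
End Contours.

Local Opaque contour_integral.

(** * The holomorphic functional calculus *)

Section Resolvent.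
Variables (R : realType) (n : nat).
Implicit Types (x y : R[i]) (g h q : R[i] -> R[i]) (U : set R[i])
  (p : {poly R[i]}) (s t : seq R[i]) (G : contour R) (B : 'M[R[i]]_n.+1).
Local Notation nc := (@Normc.normc R).

(** The list s repeats eigenvalues by algebraic multiplicity, which makes Cayley-Hamilton available
    for [nodal s]. *)
Lemma spectrum_split B : exists2 s, char_poly B = nodal s & spectrum B = [set` s].
Proof.
have [s sE] := closed_field_poly_normal (char_poly B).
have ps : char_poly B = nodal s.
  by rewrite sE (monicP (char_poly_monic B)) scale1r.
exists s => //; apply/seteqP; split=> x; rewrite /spectrum /= eigenvalue_root_char ps.
  by rewrite /root root_nodal.
by rewrite /root root_nodal.
Qed.

(* The Newton interpolant at the eigenvalues s of B of y |-> (x - y)^-1, evaluated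
   at B, which is the resolvent (x - B)^-1. *)
Fixpoint newton_resolvent B s x : 'M[R[i]]_n.+1 :=
  if s is y :: s' then (x - y)^-1 *: (1%:M + newton_resolvent B s' x *m (B - y%:M)) else 0.

Lemma horner_mx_nodal_cons B y s :
  horner_mx B (nodal (y :: s)) = horner_mx B (nodal s) *m (B - y%:M).
Proof.
by rewrite /nodal big_cons mulrC rmorphM rmorphB /= horner_mx_X horner_mx_C.
Qed.

Lemma newton_resolventE B s x : x \notin s ->
  (x%:M - B) *m newton_resolvent B s x = 1%:M - (nodal s).[x]^-1 *: horner_mx B (nodal s).
Proof.
elim: s => [|y s IHs] xs.
  by rewrite /nodal big_nil hornerC invr1 scale1r mulmx0 !rmorph1 subrr.
move: xs; rewrite inE negb_or => /andP[xy xs].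
have xy0 : x - y != 0 by rewrite subr_eq0.
rewrite [newton_resolvent _ _ _]/= -scalemxAr mulmxDr mulmx1 mulmxA (IHs xs).
rewrite mulmxBl mul1mx -scalemxAl -horner_mx_nodal_cons.
rewrite addrA addrA subrK -(raddfB (@scalar_mx _ n.+1)) scalerBr scalerA.
rewrite scale_scalar_mx (mulVf xy0); congr (_ - _ *: _).
by rewrite /nodal big_cons hornerM hornerXsubC invfM.
Qed.

(** Cayley-Hamilton kills the remainder in [newton_resolventE]. *)
Lemma newton_resolvent_inv B s x : char_poly B = nodal s -> x \notin s ->
  invmx (x%:M - B) = newton_resolvent B s x.
Proof.
move=> Bs xs; have := newton_resolventE B xs.
rewrite -[in horner_mx _ _]Bs Cayley_Hamilton scaler0 subr0 => E.
have [u _] := mulmx1_unit E.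
by rewrite -[RHS]mul1mx -(mulVmx u) -mulmxA E mulmx1.
Qed.

Lemma newton_resolvent_good B s G i j : contour_pos G ->
  (forall y, y \in s -> off_contour G y) ->
  contour_good G (fun x => newton_resolvent B s x i j).
Proof.
move=> G0; elim: s i j => [|y s IHs] i j sG.
  rewrite (_ : (fun _ => _) = fun=> 0); first exact: contour_good_cst.
  by apply/funext => x; rewrite mxE.
have sG' z : z \in s -> off_contour G z by move=> zs; apply: sG; rewrite inE zs orbT.
rewrite (_ : (fun _ => _) = fun x => (x - y)^-1 *
   ((i == j)%:R + \sum_k newton_resolvent B s x i k * (B - y%:M) k j)).
  apply: contour_goodM.
    by apply: contour_good_inv => //; apply: sG; exact: mem_head.
  apply: contour_goodD; first exact: contour_good_cst.
  apply: contour_good_sum => k; apply: contour_goodM; last exact: contour_good_cst.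
  exact: IHs.
by apply/funext => x; rewrite /= !mxE.
Qed.

(** The nodal polynomial cancels every pole of the resolvent; hence in [matfunE] the part of g
    divisible by [char_poly B] contributes an analytic integrand. *)
Lemma newton_resolvent_poly B s i j : exists Q : {poly R[i]}, forall x, x \notin s ->
  (nodal s).[x] * newton_resolvent B s x i j = Q.[x].
Proof.
elim: s i j => [|y s IHs] i j.
  by exists 0 => x _; rewrite /= mxE mulr0 horner0.
have [Q HQ] := choice (IHs i).
exists (nodal s * ((i == j)%:R)%:P + \sum_k Q k * ((B - y%:M) k j)%:P) => x.
rewrite inE negb_or => /andP[xy xs].
have xy0 : x - y != 0 by rewrite subr_eq0.
have nE : (nodal (y :: s)).[x] = (x - y) * (nodal s).[x].
  by rewrite /nodal big_cons hornerM hornerXsubC.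
have cancel T : (x - y) * (nodal s).[x] * ((x - y)^-1 * T) = (nodal s).[x] * T.
  by rewrite mulrACA (mulfV xy0) mul1r.
rewrite [newton_resolvent _ _ _]/= mxE nE cancel hornerD hornerM hornerC horner_sum.
rewrite !mxE mulrDr mulr_sumr; congr (_ + _); apply: eq_bigr => k _.
by rewrite hornerM hornerC -(HQ k x xs) mulrA.
Qed.

(** The list t is there for the induction: removing y from s moves the factor 1 / (x - y) to t. With
    t non-empty the integrand decays at least like x ^ -2 and integrates to 0, so only the identity
    term with t empty survives. *)
Lemma contour_resolvent B G s t i j : contour_pos G -> disjoint_discs G ->
  (forall y, y \in s -> inside G y) -> (forall y, y \in t -> inside G y) ->
  contour_integral G (fun x => (nodal t).[x]^-1 * newton_resolvent B s x i j) =
  if (t == [::]) && (s != [::]) then 2 * pi%:C * 'i * (i == j)%:R else 0.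
Proof.
move=> G0 Gd; have off := inside_off G0 Gd.
have gd u (uG : forall y, y \in u -> inside G y) :=
  contour_good_nodal G0 (fun y yu => off y (uG y yu)).
elim: s t i j => [|y s IHs] t i j sG tG.
  rewrite andbF -[RHS](mul0r (contour_integral G (fun=> 0))) -contourZ.
    by congr contour_integral; apply/funext => x; rewrite /= mxE mulr0 mul0r.
  exact: contour_good_cst.
have iy : inside G y by apply: sG; exact: mem_head.
have sG' z : z \in s -> inside G z by move=> zs; apply: sG; rewrite inE zs orbT.
have ytG z : z \in y :: t -> inside G z by rewrite inE => /orP[/eqP->|/tG].
have so z : z \in s -> off_contour G z by move=> /sG'; exact: off.
have g1 k : contour_good G (fun x => (nodal (y :: t)).[x]^-1 * newton_resolvent B s x i k).
  by apply: contour_goodM; [exact: gd|exact: newton_resolvent_good].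
rewrite (_ : (fun x => _) = fun x => (i == j)%:R * (nodal (y :: t)).[x]^-1 +
   \sum_k (B - y%:M) k j * ((nodal (y :: t)).[x]^-1 * newton_resolvent B s x i k)); last first.
  apply/funext => x; rewrite /= !mxE /nodal big_cons hornerM hornerXsubC invfM mulrDr mulrDr.
  congr (_ + _); first by rewrite [RHS]mulrC [in RHS]mulrC; ring.
  by rewrite !mulr_sumr; apply: eq_bigr => k _; ring.
rewrite contourD; first last.
- by apply: contour_good_sum => k; apply: contour_goodM; [exact: contour_good_cst|exact: g1].
- by apply: contour_goodM; [exact: contour_good_cst|exact: gd].
rewrite contour_sum; last by move=> k; apply: contour_goodM; [exact: contour_good_cst|exact: g1].
rewrite big1 ?addr0 => [|k _]; last by rewrite contourZ // IHs // mulr0.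
rewrite contourZ; last exact: gd.
have E : (fun x => (nodal (y :: t)).[x]^-1) = fun x => ((nodal t).[x] * (x - y))^-1.
  by apply/funext => x; rewrite /nodal big_cons hornerM hornerXsubC mulrC.
rewrite E; have [t0|t0] := eqVneq t [::].
  rewrite t0 /= mulrC -(contour_inv_inside G0 Gd iy); congr (_ * _); congr contour_integral.
  by apply/funext => x; rewrite /nodal big_nil hornerC mul1r.
by rewrite (contour_inv_nodal G0 Gd t0 tG iy) mulr0.
Qed.

(** Induction on p with x R(x) = 1 + B R(x) for the resolvent R: the term p(x) is entire and
    integrates to 0, and the last coefficient needs the integral of R alone. *)
Lemma contour_poly_resolvent B G s p i j : char_poly B = nodal s -> contour_pos G ->
  disjoint_discs G -> (forall y, y \in s -> inside G y) ->
  contour_integral G (fun x => p.[x] * newton_resolvent B s x i j) =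
  2 * pi%:C * 'i * horner_mx B p i j.
Proof.
move=> Bs G0 Gd sG; have off := inside_off G0 Gd.
have so z : z \in s -> off_contour G z by move=> /sG; exact: off.
have gr k l := @newton_resolvent_good B s G k l G0 so.
have gp p' k l : contour_good G (fun x => p'.[x] * newton_resolvent B s x k l).
  by apply: contour_goodM; [exact: contour_good_poly|exact: gr].
have s0 : s != [::].
  by apply/eqP => s0; have := size_char_poly B; rewrite Bs s0 /nodal big_nil size_poly1.
elim/poly_ind: p i j => [|p c IHp] i j.
  rewrite rmorph0 mxE mulr0 -[RHS](mul0r (contour_integral G (fun=> 0))) -contourZ.
    by congr contour_integral; apply/funext => x; rewrite horner0 !mul0r.
  exact: contour_good_cst.
rewrite (@eq_contour _ G _ (fun x => ((i == j)%:R * p.[x] +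
    \sum_k B i k * (p.[x] * newton_resolvent B s x k j)) +
    c * newton_resolvent B s x i j)); first last.
- move=> d x dG xd; rewrite hornerMXaddC mulrDl; congr (_ + _).
  have xs : x \notin s by apply/negP => /so /(_ d dG); rewrite xd eqxx.
  have := newton_resolventE B xs; rewrite -[in horner_mx _ _]Bs Cayley_Hamilton scaler0 subr0.
  rewrite mulmxBl mul_scalar_mx => /(congr1 (fun X => (X + B *m newton_resolvent B s x) i j)).
  rewrite subrK => E.
  rewrite -mulrA (_ : x * _ = (x *: newton_resolvent B s x) i j); last by rewrite mxE.
  rewrite E 2!mxE mulrDr mulrC [X in _ + _ * X]mxE mulr_sumr; congr (_ + _).
  by apply: eq_bigr => k _; rewrite mulrCA.
- exact: G0.
have g2 : contour_good G (fun x => \sum_k B i k * (p.[x] * newton_resolvent B s x k j)).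
  by apply: contour_good_sum => k; apply: contour_goodM (gp p k j); exact: contour_good_cst.
have g1 : contour_good G (fun x => (i == j)%:R * p.[x]).
  by apply: contour_goodM; [exact: contour_good_cst|exact: contour_good_poly].
rewrite contourD; first last.
- by apply: contour_goodM; [exact: contour_good_cst|exact: gr].
- exact: contour_goodD g1 g2.
rewrite (contourD g1 g2) contourZ; last exact: contour_good_poly.
rewrite (contour_integral_eq0 (U := setT) G0); first last.
- by apply: analytic_horner; exact: openT.
- by move=> d dG x.
rewrite mulr0 add0r contour_sum; last first.
  by move=> k; apply: contour_goodM (gp p k j); exact: contour_good_cst.
rewrite contourZ; last exact: gr.
have -> : contour_integral G (fun x => newton_resolvent B s x i j) =
    2 * pi%:C * 'i * (i == j)%:R.
  have := @contour_resolvent B G s [::] i j G0 Gd sG.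
  rewrite eqxx s0 /= => <- //; congr contour_integral.
  by apply/funext => x; rewrite /nodal big_nil hornerC invr1 mul1r.
have -> : horner_mx B (p * 'X + c%:P) = B *m horner_mx B p + c%:M.
  rewrite rmorphD /= rmorphM /= horner_mx_X horner_mx_C; congr (_ + _).
  exact/esym/comm_mx_horner.
rewrite mxE mulrDr; congr (_ + _).
  rewrite mxE mulr_sumr; apply: eq_bigr => k _.
  by rewrite (contourZ _ (gp p k j)) IHp mulrCA.
by rewrite mxE -[c *+ _]mulr_natr mulrCA.
Qed.

Lemma exists_radius (T : eqType) (r : seq T) (P : T -> R -> Prop) :
  (forall (u : T) (d e : R), 0 < d -> d <= e -> P u e -> P u d) ->
  (forall u : T, u \in r -> exists2 d, 0 < d & P u d) ->
  exists2 d, 0 < d & forall u : T, u \in r -> P u d.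
Proof.
move=> Pd; elim: r => [|t r IHr] Pr; first by exists 1.
have [|d d0 Hd] := IHr; first by move=> u ur; apply: Pr; rewrite inE ur orbT.
have [e e0 He] := Pr t (mem_head _ _).
have m0 : 0 < Num.min d e by rewrite lt_min d0.
exists (Num.min d e) => // u; rewrite inE => /orP[/eqP->|ur].
  by apply: Pd He => //; rewrite ge_min lexx orbT.
by apply: Pd (Hd _ ur) => //; rewrite ge_min lexx.
Qed.

Lemma exists_contour U s : open (U : set R[i]^o) -> (forall y, y \in s -> U y) ->
  exists G, encloses U [set` s] G.
Proof.
move=> oU sU.
have [d d0 Hd] : exists2 d : R, 0 < d & forall y, y \in s -> forall x, nc (x - y) <= d -> U x.
  apply: (@exists_radius _ s (fun y (d : R) => forall x, nc (x - y) <= d -> U x)).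
    by move=> y d e _ de H x xd; apply: H; exact: le_trans de.
  by move=> y ys; exact: open_disc oU (sU _ ys).
have [e e0 He] : exists2 e : R, 0 < e & forall yz, yz \in [seq (y, z) | y <- s, z <- s] ->
    yz.1 != yz.2 -> e + e < nc (yz.1 - yz.2).
  apply: (@exists_radius _ _ (fun yz (e : R) => yz.1 != yz.2 -> e + e < nc (yz.1 - yz.2))).
    move=> yz e e' e0 ee' H yz0; apply: le_lt_trans (H yz0); exact: lerD.
  move=> yz _; have [->|yz0] := eqVneq yz.1 yz.2; first by exists 1 => //; rewrite eqxx.
  have n0 : 0 < nc (yz.1 - yz.2) by rewrite nc_gt0 subr_eq0.
  (* A third of the distance, so that two radii stay strictly below it. *)
  by exists (nc (yz.1 - yz.2) / 3); [rewrite divr_gt0|move=> _; lra].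
pose m := Num.min d e; have m0 : 0 < m by rewrite lt_min d0.
exists [seq (y, m) | y <- undup s]; split.
- by move=> _ /mapP[y _ ->].
- rewrite pairwise_map; have := undup_uniq s; rewrite uniq_pairwise.
  apply: (@sub_in_pairwise _ (mem s)); last by apply/allP => y; rewrite mem_undup.
  move=> y z ys zs /= yz; apply: le_lt_trans (He (y, z) _ yz).
    by apply: lerD; rewrite ge_min lexx orbT.
  by apply/allpairsP; exists (y, z).
- move=> _ /mapP[y ys ->] x /= xy; apply: (Hd y); first by rewrite mem_undup in ys.
  by apply: le_trans xy _; rewrite ge_min lexx.
- move=> x /= xs; exists (x, m); first by apply/mapP; exists x; rewrite ?mem_undup.
  by rewrite /= subrr nc0.
Qed.

(* Multiplied by the resolvent, the term with char_poly B is analytic inside the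
   contour. *)
Lemma matfunE U g q p B : analytic_on U g -> analytic_on U q -> spectrum B `<=` U ->
  (forall x, U x -> g x = p.[x] + (char_poly B).[x] * q x) -> matfun U g B = horner_mx B p.
Proof.
move=> ag aq BU gE; have [s Bs sB] := spectrum_split B.
have : exists G, encloses U (spectrum B) G.
  rewrite sB; apply: exists_contour (analytic_open ag) _ => y ys; apply: BU.
  by rewrite sB.
(* Existence of an enclosing contour excludes the default; only the enclosing property of the chosen
   one is used, so the result is independent of the choice. *)
rewrite /matfun => /(xgetPex [::]); set G := xget _ _ => -[G0 Gd GU Gs].
have sG y : y \in s -> inside G y by move=> ys; apply: Gs; rewrite sB.
have off := inside_off G0 Gd.
have so z : z \in s -> off_contour G z by move=> /sG; exact: off.
apply/matrixP => i j; rewrite mxE.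
have [Q HQ] := newton_resolvent_poly B s i j.
have gq : analytic_on U (fun x => q x * Q.[x]).
  exact: (analyticM aq (@analytic_horner _ U Q (analytic_open aq))).
have -> : contour_integral G (fun x => g x * invmx (x%:M - B) i j) =
    contour_integral G (fun x => p.[x] * newton_resolvent B s x i j + q x * Q.[x]).
  apply: (eq_contour G0) => d x dG xd.
  have xs : x \notin s by apply/negP => /so /(_ d dG); rewrite xd eqxx.
  rewrite (newton_resolvent_inv Bs xs) gE; last by apply: (GU d dG); rewrite /= xd.
  by rewrite mulrDl -(HQ _ xs) Bs; ring.
rewrite contourD; first last.
- move=> d dG; apply: circle_good_cts; first exact: (G0 d dG).
    by move=> y yd; apply: cdiff_ccts; apply: analytic_cdiff gq _; apply: (GU d dG); rewrite /= yd.
- apply: contour_goodM; first exact: contour_good_poly.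
  exact: (@newton_resolvent_good B s G i j G0 so).
rewrite (contour_integral_eq0 G0 GU gq) addr0 (contour_poly_resolvent p i j Bs G0 Gd sG) mulKf //.
rewrite -nc_eq0 !ncM nc_i mulr1 ncR mulf_neq0 // ?normr_eq0 ?gt_eqF ?pi_gt0 //.
by rewrite nc_gt0 pnatr_eq0.
Qed.
End Resolvent.

(** * Convex hulls of finite sets *)

Section ConvexHull.
Variable R : realType.
Implicit Types (x y z w : R[i]) (t : R) (M C : set R[i]) (s : seq R[i]).
Local Notation nc := (@Normc.normc R).

Definition cconvex C := forall x y t, C x -> C y -> 0 <= t <= 1 ->
  C ((1 - t)%:C * x + t%:C * y).

(** [conv] puts its weight on the first point: hence 1 - t in one direction and exchanged points in
    the other. *)
Lemma convex_setP C : @convex_set R[i] R[i]^o C <-> cconvex C.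
Proof.
split=> [cC x y t Cx Cy /andP[t0 t1]|cC x y l].
  have l0 : 0 <= (1 - t)%:C by rewrite ler0c subr_ge0.
  have l1 : (1 - t)%:C <= 1 :> R[i] by rewrite -(rmorph1 (real_complex R)) lecR gerBl.
  have := cC x y (Itv01 l0 l1); rewrite !inE => /(_ Cx Cy).
  congr (C _); rewrite /conv /=; congr (_ + _).
  by rewrite /unstable.onem -{1}(rmorph1 (real_complex R)) -rmorphB opprB addrC subrK.
rewrite !inE => Cx Cy.
have l0 : 0 <= l%:num by []. have l1 : l%:num <= 1 by [].
have /complex_realP[t lE] : l%:num \is Num.real by rewrite ger0_real.
have t0 : 0 <= t by rewrite -ler0c -lE.
have t1 : t <= 1 by rewrite -lecR -lE; exact: l1.
have := cC y x t Cy Cx; rewrite t0 t1 => /(_ isT).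
congr (C _); rewrite /conv /= addrC lE; congr (_ + _).
have e : (1 - t)%:C = 1 - t%:C :> R[i] by rewrite rmorphB rmorph1.
by rewrite e.
Qed.

Lemma co_cconvex M : cconvex (co M).
Proof.
move=> x y t cx cy t01 C [cC MC]; move/convex_setP: (cC); apply=> //.
  by apply: cx; split.
by apply: cy; split.
Qed.
Lemma sub_co M : M `<=` co M.
Proof. exact: sub_gen_smallest. Qed.
Lemma co_min M C : cconvex C -> M `<=` C -> co M `<=` C.
Proof. by move=> /convex_setP cC MC; exact: smallest_sub. Qed.

(* Iterated joins, so that compactness follows by induction. *)
Fixpoint hull z s : set R[i] :=
  if s is y :: s' then
    [set p | exists t w, [/\ 0 <= t <= 1, hull y s' w & p = (1 - t)%:C * z + t%:C * w]]
  else [set z].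

Lemma hull_sub z s C : cconvex C -> (forall y, y \in z :: s -> C y) -> hull z s `<=` C.
Proof.
move=> cC; elim: s z => [|y s IHs] z sC /=.
  by move=> _ ->; apply: sC; exact: mem_head.
move=> _ [t [w [t01 hw ->]]]; apply: cC => //; first by apply: sC; exact: mem_head.
by apply: (IHs y) => // x xs; apply: sC; rewrite inE xs orbT.
Qed.

Lemma sub_hull z s y : y \in z :: s -> hull z s y.
Proof.
elim: s z y => [|x s IHs] z y; first by rewrite inE => /eqP.
rewrite inE => /orP[/eqP->|ys].
  exists 0, x; split; [by rewrite lexx ler01|apply: IHs; exact: mem_head|].
  by rewrite subr0 mul0r mul1r addr0.
exists 1, y; split; [by rewrite lexx ler01|exact: IHs|].
by rewrite subrr mul0r mul1r add0r.
Qed.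

Lemma hull_cconvex z s : cconvex (hull z s).
Proof.
elim: s z => [|y s IHs] z x1 x2 a /=.
  by move=> -> -> _; rewrite -mulrDl -rmorphD subrK rmorph1 mul1r.
move=> [t1 [w1 [/andP[t10 t11] h1 ->]]] [t2 [w2 [/andP[t20 t21] h2 ->]]] /andP[a0 a1].
(* The total weight of w1 and w2, which are merged into one point of [hull y s] with relative weight
   a t2 / T; if T = 0 both weights vanish and the combination is z. *)
pose T := (1 - a) * t1 + a * t2.
have a1' : 0 <= 1 - a by rewrite subr_ge0.
have T0 : 0 <= T by rewrite addr_ge0 // mulr_ge0.
have T1 : T <= 1.
  have e1 := ler_wpM2l a1' t11; have e2 := ler_wpM2l a0 t21; rewrite /T; lra.
have [Tz|Tz] := eqVneq T 0.
  have e1 : (1 - a) * t1 = 0.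
    apply/eqP; rewrite eq_le mulr_ge0 // andbT -Tz lerDl mulr_ge0 //.
  have e2 : a * t2 = 0 by move: Tz; rewrite /T e1 add0r.
  exists 0, w1; split=> //; first by rewrite lexx ler01.
  rewrite subr0 mul0r mul1r addr0.
  have E1 : (1 - a)%:C * t1%:C = 0 by rewrite -rmorphM e1.
  have E2 : a%:C * t2%:C = 0 by rewrite -rmorphM e2.
  rewrite (_ : _ + _ = z + (1 - a)%:C * t1%:C * (w1 - z) + a%:C * t2%:C * (w2 - z)).
    by rewrite E1 E2 !mul0r !addr0.
  by rewrite !rcB rc1; ring.
exists T, ((1 - a * t2 / T)%:C * w1 + (a * t2 / T)%:C * w2); split.
- by rewrite T0.
- apply: IHs => //; have Tp : 0 < T by rewrite lt_def Tz.
  rewrite divr_ge0 ?mulr_ge0 //= ler_pdivrMr // mul1r /T lerDr mulr_ge0 //.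
- have TC : T%:C != 0 by rewrite -nc_eq0 ncR normr_eq0.
  have TE : T%:C = (1 - a%:C) * t1%:C + a%:C * t2%:C.
    by rewrite /T rcD !rcM rcB rc1.
  rewrite !rcB !rcM rcV rc1.
  move: TE TC; move: (T%:C) => TT TE TC.
  rewrite [RHS](_ : _ = z - TT * z + (TT - a%:C * t2%:C) * w1 + a%:C * t2%:C * w2).
    by rewrite TE; ring.
  by field.
Qed.

Lemma hull_co z s : co [set` z :: s] = hull z s.
Proof.
apply/seteqP; split.
  by apply: co_min; [exact: hull_cconvex|move=> y; exact: sub_hull].
apply: hull_sub; first exact: co_cconvex.
by move=> y ys; exact: (@sub_co [set` z :: s]).
Qed.

Lemma compact_hull z s : compact (hull z s : set R[i]^o).
Proof.
elim: s z => [|y s IHs] z; first exact: compact_set1.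
pose F (tw : R * R[i]^o) : R[i]^o := (1 - tw.1)%:C * z + tw.2 * tw.1%:C.
have -> : hull z (y :: s) = F @` (`[0, 1] `*` hull y s).
  apply/seteqP; split=> [_ [t [w [t01 hw ->]]]|_ [[t w] [/= t01 hw] <-]].
    exists (t, w); last by rewrite /F /= [t%:C * _]mulrC.
    by split=> //=; rewrite in_itv.
  exists t, w; split; [by move: t01; rewrite in_itv|exact: hw|].
  by rewrite /F /= [w * _]mulrC.
apply: (@continuous_compact _ (R[i]^o) F); last first.
  by apply: compact_setX; [exact: segment_compact|exact: IHs].
apply: continuous_subspaceT => tw.
have c1 : {for tw, continuous (fun u : R * R[i]^o => u.1)} by exact: cvg_fst.
have c2 : ccts (fun u : R * R[i]^o => u.2) tw by exact: cvg_snd.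
apply: (@cctsD R _ (fun u : R * R[i]^o => (1 - u.1)%:C * z) (fun u => u.2 * u.1%:C)).
  apply: (@cctsM R _ (fun u : R * R[i]^o => (1 - u.1)%:C) (fun=> z)); last exact: ccts_cst.
  apply: (@ccts_real R _ (fun u : R * R[i]^o => 1 - u.1)).
  by apply: (@continuousB _ R _ (fun=> 1) (fun u : R * R[i]^o => u.1)) => //; exact: cvg_cst.
apply: (@cctsM R _ (fun u : R * R[i]^o => u.2) (fun u => u.1%:C) tw c2).
exact: (@ccts_real R _ (fun u : R * R[i]^o => u.1)).
Qed.
End ConvexHull.

(** * A maximum principle *)

Section MaxPrinciple.
Variables (R : realType) (V : lmodType R[i]) (nrm : V -> R).
(** Only a seminorm is available in the application, X |-> [nrm (C *m X)] with C possibly singular;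
    derivatives are likewise expressed through [nrm] alone. *)
Hypothesis nrmD : forall u v, nrm (u + v) <= nrm u + nrm v.
Hypothesis nrmZ : forall (a : R[i]) v, nrm (a *: v) = Normc.normc a * nrm v.

Lemma seminorm0 : nrm 0 = 0.
Proof. by rewrite -(scale0r (0 : V)) nrmZ nc0 mul0r. Qed.
Lemma seminormN v : nrm (- v) = nrm v.
Proof. by rewrite -scaleN1r nrmZ ncN nc1 mul1r. Qed.
Lemma seminormB u v : nrm (u - v) = nrm (v - u).
Proof. by rewrite -seminormN opprB. Qed.
Lemma seminorm_ge0 v : 0 <= nrm v.
Proof.
have := nrmD v (- v); rewrite subrr seminorm0 seminormN -mulr2n.
by rewrite pmulrn_lge0.
Qed.
Lemma seminorm_sub u v : nrm u - nrm v <= nrm (u - v).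
Proof. by rewrite lerBlDr -{1}(subrK v u). Qed.

(* If nrm (e t) > m at a maximum t > 0, then the bound on (j + 1) e + t d makes
   nrm (e (t - h)) larger for small h > 0; at t = 0 the bound gives the claim. *)
Lemma max_principle (e d : R -> V) (j : nat) (m : R) :
  (forall t, 0 <= t <= 1 -> forall eps, 0 < eps -> exists2 del, 0 < del &
     forall s, 0 <= s <= 1 -> `|s - t| < del ->
     nrm (e s - e t - (s - t)%:C *: d t) <= eps * `|s - t|) ->
  (forall t, 0 <= t <= 1 -> nrm (j.+1%:R *: e t + t%:C *: d t) <= j.+1%:R * m) ->
  nrm (e 1) <= m.
Proof.
move=> ed em.
have cnt : {within `[0, 1], continuous (fun t => nrm (e t))}.
  apply/subspace_continuousP => t; rewrite /= in_itv /= => t01.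
  apply/cvgrPdist_lt => eps eps0.
  have [del del0 Hd] := ed t t01 1 ltr01.
  pose K := nrm (d t) + 1.
  have K0 : 0 < K by rewrite ltr_wpDl ?seminorm_ge0.
  have m0 : 0 < Num.min del (eps / K) by rewrite lt_min del0 divr_gt0.
  have /cvgrPdist_lt /(_ _ m0) N : (id : R -> R) @ t --> t by exact: cvg_id.
  rewrite near_withinE; apply: filterS N => s sdK s01; move: sdK; rewrite distrC.
  rewrite lt_min [_ < eps / K]ltr_pdivlMr // => /andP[sd sK].
  have sb : nrm (e s - e t) <= `|s - t| * K.
    rewrite -(subrK ((s - t)%:C *: d t) (e s - e t)).
    apply: le_trans (nrmD _ _) _; rewrite nrmZ ncR /K mulrDr mulr1 addrC.
    rewrite lerD2l; apply: le_trans (Hd s _ sd) _; last by rewrite mul1r.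
    by move: s01; rewrite /= in_itv.
  apply: le_lt_trans sK; apply: le_trans sb.
  rewrite ler_norml; apply/andP; split; last by rewrite seminormB; exact: seminorm_sub.
  by rewrite lerNl opprB; exact: seminorm_sub.
have [T T01 Tmax] := EVT_max (@ler01 R) cnt.
move: T01; rewrite in_itv /= => /andP[T0 T1].
apply: le_trans (Tmax 1 _) _; first by rewrite in_itv /= ler01 lexx.
have j0 : 0 < j.+1%:R :> R by rewrite ltr0n.
have jn : Normc.normc (j.+1%:R : R[i]) = j.+1%:R.
  by rewrite -(rmorph_nat (real_complex R)) ncR normr_nat.
rewrite leNgt; apply/negP => mT.
have [TE|Tn] := eqVneq T 0.
  have := em 0; rewrite lexx ler01 => /(_ isT).
  by rewrite scale0r addr0 nrmZ jn ler_pM2l // leNgt -TE mT.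
have Tp : 0 < T by rewrite lt_def Tn.
have T01 : 0 <= T <= 1 by rewrite T0.
pose D := nrm (e T) - m; have D0 : 0 < D by rewrite subr_gt0.
(* Chosen so that the error eps h is half of the gain q D, where q = (j + 1) h / T. *)
pose eps := j.+1%:R * D / (2 * T).
have eps0 : 0 < eps by rewrite divr_gt0 ?mulr_gt0.
have [del del0 Hd] := ed T T01 eps eps0.
pose h := Num.min (del / 2) T.
have h0 : 0 < h by rewrite lt_min Tp divr_gt0.
have hT : h <= T by rewrite ge_min lexx orbT.
have hd : h < del by rewrite gt_min ltr_pdivrMr // ltr_pMr // ltr1n.
have s01 : 0 <= T - h <= 1 by rewrite subr_ge0 hT /= (le_trans _ T1) // gerBl ltW.
have sT : T - h - T = - h by rewrite addrAC subrr add0r.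
have := Hd (T - h) s01; rewrite sT normrN gtr0_norm // => /(_ hd) H1.
have H2 := Tmax (T - h); rewrite in_itv /= in H2; have {}H2 := H2 s01.
have H3 := em T T01.
have TC : T%:C != 0 :> R[i] by rewrite -nc_eq0 ncR normr_eq0.
pose X := j.+1%:R *: e T + T%:C *: d T.
(* The term h d T cancels between the first-order expansion at T - h and (h / T) X. Norms then give
   (1 + q) nrm (e T) <= eps h + nrm (e T) + q m, that is q D <= q D / 2. *)
have E : (1 + j.+1%:R * h / T)%:C *: e T =
    - (e (T - h) - e T - (- h)%:C *: d T) + e (T - h) + (h / T)%:C *: X.
  have k1 : (h / T)%:C * T%:C = h%:C :> R[i] by rewrite -rcM divfK.
  have k2 : (1 + j.+1%:R * h / T)%:C = 1 + (h / T)%:C * j.+1%:R :> R[i].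
    by rewrite rcD rc1 -rc_nat -rcM; congr (_ + _%:C); ring.
  rewrite /X k2 scalerDr !scalerA k1 rcN scaleNr opprK scalerDl scale1r.
  have grp (A B w q : V) : A + q = - (B - A + w) + B + (q + w).
    by rewrite opprD opprB [A - B - w]addrAC subrK [q + w]addrC addrA subrK.
  exact: grp.
have : nrm ((1 + j.+1%:R * h / T)%:C *: e T) <= eps * h + nrm (e T) + h / T * (j.+1%:R * m).
  rewrite E; apply: le_trans (nrmD _ _) _; apply: lerD.
    apply: le_trans (nrmD _ _) _; apply: lerD => //.
    by rewrite seminormN.
  by rewrite nrmZ ncR ger0_norm ?divr_ge0 ?(ltW h0) // ler_wpM2l // divr_ge0 // ltW.
rewrite nrmZ ncR ger0_norm ?addr_ge0 ?divr_ge0 ?mulr_ge0 ?(ltW h0) //.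
have -> : eps * h = j.+1%:R * h / T * D / 2 by rewrite /eps; field.
have -> : h / T * (j.+1%:R * m) = j.+1%:R * h / T * m by ring.
have q0 : 0 < j.+1%:R * h / T by rewrite divr_gt0 // mulr_gt0.
move: q0; move: (j.+1%:R * h / T) => q q0; rewrite mulrDl mul1r => H.
have : q * D <= q * D / 2 by rewrite /D mulrBr; move: H; rewrite /D; lra.
have : 0 < q * D by rewrite mulr_gt0.
lra.
Qed.
End MaxPrinciple.

(** * Uniform bounds *)

Section MatrixNorm.
Variables (R : realType) (n : nat).
Implicit Types (X Y : 'M[R[i]]_n) (a : R[i]).
Local Notation nc := (@Normc.normc R).

(** An auxiliary submultiplicative norm for all estimates; [is_norm_le_mx1] transfers them to the
    given norm, which need not be submultiplicative. *)
Definition mx1 X : R := \sum_i \sum_j nc (X i j).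

Lemma mx1_ge0 X : 0 <= mx1 X.
Proof. by apply: sumr_ge0 => i _; apply: sumr_ge0 => j _; exact: nc_ge0. Qed.
Lemma mx1D X Y : mx1 (X + Y) <= mx1 X + mx1 Y.
Proof.
rewrite /mx1 -big_split; apply: ler_sum => i _; rewrite -big_split; apply: ler_sum => j _.
by rewrite mxE; exact: ncD.
Qed.
Lemma mx1Z a X : mx1 (a *: X) = nc a * mx1 X.
Proof.
rewrite /mx1 mulr_sumr; apply: eq_bigr => i _; rewrite mulr_sumr; apply: eq_bigr => j _.
by rewrite mxE ncM.
Qed.
Lemma nc_le_mx1 X i j : nc (X i j) <= mx1 X.
Proof.
rewrite /mx1 (bigD1 i) //= (bigD1 j) //= -addrA lerDl addr_ge0 //.
  by apply: sumr_ge0 => k _; exact: nc_ge0.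
by apply: sumr_ge0 => k _; apply: sumr_ge0 => l _; exact: nc_ge0.
Qed.
Lemma mx1M X Y : mx1 (X *m Y) <= mx1 X * mx1 Y.
Proof.
rewrite /mx1 mulr_suml; apply: ler_sum => i _.
apply: le_trans (_ : \sum_j \sum_k nc (X i k) * nc (Y k j) <= _).
  apply: ler_sum => j _; rewrite mxE; apply: le_trans (nc_sum _ _ _) _.
  by apply: ler_sum => k _; rewrite ncM.
rewrite exchange_big mulr_suml; apply: ler_sum => k _ /=.
rewrite -mulr_sumr ler_wpM2l ?nc_ge0 // [leRHS](bigD1 k) //= lerDl.
by apply: sumr_ge0 => l _; apply: sumr_ge0 => j _; exact: nc_ge0.
Qed.
Lemma mx10 : mx1 0 = 0.
Proof. exact: (seminorm0 mx1Z). Qed.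
Lemma mx1N X : mx1 (- X) = mx1 X.
Proof. exact: (seminormN mx1Z X). Qed.
Lemma is_norm_le_mx1 (nrm : 'M[R[i]]_n -> R) : is_norm nrm ->
  exists2 K, 0 <= K & forall X, nrm X <= K * mx1 X.
Proof.
case=> _ nZ nD.
have n0 X : 0 <= nrm X by exact: (seminorm_ge0 nD nZ X).
pose K := \sum_i \sum_j nrm (delta_mx i j); exists K.
  by apply: sumr_ge0 => i _; apply: sumr_ge0.
move=> X; rewrite {1}(matrix_sum_delta X).
have nsum (I : finType) (F : I -> 'M[R[i]]_n) : nrm (\sum_i F i) <= \sum_i nrm (F i).
  elim/big_ind2: _ => // [|x a y b xa yb]; first by rewrite (seminorm0 nZ).
  by apply: le_trans (nD _ _) _; exact: lerD.
apply: le_trans (nsum _ _) _; rewrite /K mulr_suml; apply: ler_sum => i _.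
apply: le_trans (nsum _ _) _; rewrite mulr_suml; apply: ler_sum => j _.
by rewrite nZ mulrC ler_wpM2l // nc_le_mx1.
Qed.
End MatrixNorm.

(** * Divided differences bounded uniformly in their nodes *)

Section ScalarBounds.
Variable R : realType.
Implicit Types (x y : R[i]) (U H : set R[i]) (g : R[i] -> R[i]).
Local Notation nc := (@Normc.normc R).

Lemma analytic_bounded U H g : analytic_on U g -> H `<=` U -> compact (H : set R[i]^o) ->
  exists2 M, 0 <= M & forall x, H x -> nc (g x) <= M.
Proof.
move=> ag HU cH; have [H0|H0] := pselect (H !=set0); last first.
  by exists 0 => // x Hx; exfalso; apply: H0; exists x.
have cn : {within (H : set R[i]^o), continuous (fun x : R[i]^o => nc (g x))}.
  apply: continuous_in_subspaceT => x; rewrite inE => Hx.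
  exact: (@continuous_nc R (R[i]^o) g x (analytic_ccts ag (HU _ Hx))).
have [c _ cmax] := @compact_EVT_max (R[i]^o) R _ _ H0 cH cn.
exists (nc (g c)); first exact: nc_ge0.
by move=> x Hx; apply: cmax; rewrite inE.
Qed.

(** The scalar case of the main estimate: [max_principle] on the segment from y to x, inside the
    convex H. The bound M / (j + 1) obtained is weakened to M. *)
Lemma nc_cderive_dd U H g j (M : R) : analytic_on U g -> cconvex H -> H `<=` U ->
  0 <= M -> (forall x, H x -> nc (cderive j.+1 g x) <= M) ->
  forall y x, H y -> H x -> nc (cderive j (dd g y) x) <= M.
Proof.
move=> ag cH HU M0 gM y x Hy Hx.
pose w (t : R) := (1 - t)%:C * y + t%:C * x.
have Hw t : 0 <= t <= 1 -> H (w t) by exact: cH.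
have wB s t : w s - w t = (s - t)%:C * (x - y) by rewrite /w !rcB rc1; ring.
have wy t : w t - y = t%:C * (x - y) by rewrite /w rcB rc1; ring.
have w1 : w 1 = x by rewrite /w subrr mul0r add0r rc1 mul1r.
have ae := analytic_dd ag (HU _ Hy).
have jn : nc (j.+1%:R : R[i]) = j.+1%:R by rewrite -rc_nat ncR normr_nat.
have j0 : 0 < j.+1%:R :> R by rewrite ltr0n.
rewrite -w1; apply: le_trans (_ : M / j.+1%:R <= _); last first.
  by rewrite ler_pdivrMr // ler_peMr // ler1n.
apply: (@max_principle R (R[i]^o) nc (@ncD R) (@ncM R) (fun t => cderive j (dd g y) (w t))
  (fun t => (x - y) * cderive j.+1 (dd g y) (w t)) j) => [t t01 e e0|t t01].
  have /cdiffP H1 := analytic_cdiff (analytic_cderive j ae) (HU _ (Hw t t01)).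
  pose K := nc (x - y) + 1; have K0 : 0 < K by rewrite ltr_wpDl ?nc_ge0.
  have eK : 0 < e / K by rewrite divr_gt0.
  have [d d0 Hd] := H1 _ eK; exists (d / K); first by rewrite divr_gt0.
  move=> s s01; rewrite ltr_pdivlMr // => sd.
  have wK : nc (w s - w t) <= `|s - t| * K.
    by rewrite wB ncM ncR ler_wpM2l // /K lerDl.
  have := Hd (w s) (le_lt_trans wK sd); rewrite wB -cderiveS => H2.
  have com (a b c : R[i]) : a *: (b * c : R[i]^o) = c * (a * b).
    by rewrite /GRing.scale /= mulrA mulrC.
  rewrite com.
  apply: le_trans H2 _; rewrite -wB.
  apply: le_trans (_ : e / K * (`|s - t| * K) <= _); first by rewrite ler_wpM2l // ltW.
  by rewrite mulrCA divfK ?gt_eqF // mulrC.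
rewrite [leRHS]mulrC divfK ?gt_eqF //; apply: le_trans (gM _ (Hw t t01)).
rewrite (cderive_dd j ag (HU _ Hy) (HU _ (Hw t t01))) wy.
by rewrite /GRing.scale /= mulrA.
Qed.

(** K is fixed before g, s and B because the nodes will be the eigenvalues of a varying matrix. Each
    node passed costs one derivative, whence the shifted sequence in the induction. *)
Lemma newton_bounded n U H (k : nat) (M : nat -> R) (K0 : R) : cconvex H -> H `<=` U ->
  0 <= K0 -> (forall j, 0 <= M j) ->
  exists2 K, 0 <= K & forall g s (B : 'M[R[i]]_n.+1), size s = k -> analytic_on U g ->
    (forall y, y \in s -> H y) -> (forall j x, H x -> nc (cderive j g x) <= M j) ->
    (forall y, y \in s -> mx1 (B - y%:M) <= K0) -> mx1 (horner_mx B (newton s g)) <= K.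
Proof.
move=> cH HU K00; elim: k M => [|k IHk] M M0.
  by exists 0 => // g s B /size0nil -> _ _ _ _; rewrite rmorph0 mx10.
have [K K0' HK] := IHk (fun j => M j.+1) (fun j => M0 j.+1).
exists (M 0%N * mx1 (1%:M : 'M[R[i]]_n.+1) + K0 * K).
  by rewrite addr_ge0 // mulr_ge0 // mx1_ge0.
move=> g [|y s] B // [sk] ag sH gM BK.
have Hy : H y by apply: sH; exact: mem_head.
have sH' z : z \in s -> H z by move=> zs; apply: sH; rewrite inE zs orbT.
have -> : horner_mx B (newton (y :: s) g) =
    g y *: 1%:M + (B - y%:M) *m horner_mx B (newton s (dd g y)).
  rewrite [newton _ _]/= rmorphD /= rmorphM /= rmorphB /= horner_mx_X !horner_mx_C.
  by rewrite scalemx1.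
apply: le_trans (mx1D _ _) _; apply: lerD.
  rewrite mx1Z ler_wpM2r ?mx1_ge0 //; have := gM 0%N y Hy.
  by rewrite cderive0.
apply: le_trans (mx1M _ _) _; apply: ler_pM; rewrite ?mx1_ge0 //.
  by apply: BK; exact: mem_head.
apply: HK sk (analytic_dd ag (HU _ Hy)) sH' _ _.
  by move=> j x Hx; exact: nc_cderive_dd ag cH HU (M0 j.+1) (gM j.+1) _ _ Hy Hx.
by move=> z zs; apply: BK; rewrite inE zs orbT.
Qed.
End ScalarBounds.

(** * Regularity of B |-> g(B) *)

Section Matfun.
Variables (R : realType) (n : nat).
Implicit Types (x y : R[i]) (U H : set R[i]) (g h q : R[i] -> R[i]) (p : {poly R[i]})
  (B D X Y : 'M[R[i]]_n.+1).
Local Notation nc := (@Normc.normc R).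

Lemma matfun_rep U g B : analytic_on U g -> spectrum B `<=` U -> exists p q,
  [/\ analytic_on U q, forall x, g x = p.[x] + (char_poly B).[x] * q x &
      matfun U g B = horner_mx B p].
Proof.
move=> ag BU; have [s Bs sB] := spectrum_split B.
have aq : analytic_on U (ddl s g).
  by apply: (analytic_ddl ag) => y ys; apply: BU; rewrite sB.
have gE x : g x = (newton s g).[x] + (char_poly B).[x] * ddl s g x by rewrite Bs -newtonE.
exists (newton s g), (ddl s g); split; [exact: aq|exact: gE|].
by apply: (matfunE ag aq BU) => x _; exact: gE.
Qed.

Lemma matfunD U g h B : analytic_on U g -> analytic_on U h -> spectrum B `<=` U ->
  matfun U (fun x => g x + h x) B = matfun U g B + matfun U h B.
Proof.
move=> ag ah BU; have [p1 [q1 [a1 E1 ->]]] := matfun_rep ag BU.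
have [p2 [q2 [a2 E2 ->]]] := matfun_rep ah BU.
rewrite (matfunE (p := p1 + p2) (analyticD ag ah) (analyticD a1 a2) BU) ?rmorphD //.
by move=> x _; rewrite E1 E2 hornerD; ring.
Qed.

Lemma matfun_horner U p B : open (U : set R[i]^o) -> spectrum B `<=` U ->
  matfun U (fun x => p.[x]) B = horner_mx B p.
Proof.
move=> oU BU; apply: (matfunE (analytic_horner p oU) (analytic_cst 0 oU) BU) => x _.
by rewrite mulr0 addr0.
Qed.

Lemma matfunM U g h B : analytic_on U g -> analytic_on U h -> spectrum B `<=` U ->
  matfun U (fun x => g x * h x) B = matfun U g B *m matfun U h B.
Proof.
move=> ag ah BU; have [p1 [q1 [a1 E1 ->]]] := matfun_rep ag BU.
have [p2 [q2 [a2 E2 ->]]] := matfun_rep ah BU.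
have oU := analytic_open ag.
have ap r := analytic_horner r oU.
have aq := analyticD (analyticD (analyticM (ap p1) a2) (analyticM (ap p2) a1))
  (analyticM (ap (char_poly B)) (analyticM a1 a2)).
rewrite (matfunE (p := p1 * p2) (analyticM ag ah) aq BU) ?rmorphM //.
by move=> x _; rewrite E1 E2 hornerM; ring.
Qed.

Lemma eq_matfun U g h B : analytic_on U g -> spectrum B `<=` U ->
  (forall x, U x -> g x = h x) -> matfun U g B = matfun U h B.
Proof.
move=> ag BU gh; have [p [q [aq E ->]]] := matfun_rep ag BU.
have ah := eq_analytic gh ag.
by rewrite (matfunE ah aq BU (p := p)) // => x Ux; rewrite -gh.
Qed.

Lemma horner_mx_comm p B D : comm_mx B D -> comm_mx (horner_mx B p) D.
Proof. by move=> BD; apply/comm_mx_sym/comm_mx_horner/comm_mx_sym. Qed.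

Lemma horner_mxMXaddC p (c : R[i]) B :
  horner_mx B (p * 'X + c%:P) = horner_mx B p *m B + c%:M.
Proof. by rewrite rmorphD /= rmorphM /= horner_mx_X horner_mx_C. Qed.

Lemma horner_mx_lipschitz p B0 (Kb : R) : 0 <= Kb -> exists2 K, 0 <= K & forall B,
  mx1 B <= Kb -> mx1 (horner_mx B p - horner_mx B0 p) <= K * mx1 (B - B0).
Proof.
move=> Kb0; elim/poly_ind: p => [|p c [K K0 HK]].
  by exists 0 => // B _; rewrite !rmorph0 subr0 mx10 mul0r.
exists (K * Kb + mx1 (horner_mx B0 p)); first by rewrite addr_ge0 ?mulr_ge0 ?mx1_ge0.
move=> B BKb; rewrite !horner_mxMXaddC.
have -> : horner_mx B p *m B + c%:M - (horner_mx B0 p *m B0 + c%:M) =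
    (horner_mx B p - horner_mx B0 p) *m B + horner_mx B0 p *m (B - B0).
  by rewrite mulmxBl mulmxBr opprD addrACA subrr addr0 addrA subrK.
apply: le_trans (mx1D _ _) _; rewrite mulrDl; apply: lerD; last exact: mx1M.
apply: le_trans (mx1M _ _) _; rewrite mulrAC.
by apply: ler_pM; rewrite ?mx1_ge0 ?HK.
Qed.

(** Since D commutes with B0 it can be moved to the front as in the scalar product rule; each step
    of the induction leaves the remainder s ^ 2 D p'(B0) D. *)
Lemma horner_mx_derivative p B0 D : comm_mx B0 D ->
  exists2 K, 0 <= K & forall s : R, `|s| <= 1 ->
    mx1 (horner_mx (B0 + s%:C *: D) p - horner_mx B0 p - s%:C *: (D *m horner_mx B0 p^`()))
    <= K * s ^+ 2.
Proof.
move=> BD; elim/poly_ind: p => [|p c [K K0 HK]].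
  by exists 0 => // s _; rewrite deriv0 !rmorph0 mulmx0 scaler0 !subr0 mx10 mul0r.
pose P := horner_mx B0 p; pose P' := horner_mx B0 p^`().
exists (K * (mx1 B0 + mx1 D) + mx1 (D *m P' *m D)).
  by rewrite addr_ge0 ?mulr_ge0 ?addr_ge0 ?mx1_ge0.
move=> s s1; rewrite !horner_mxMXaddC derivMXaddC rmorphD rmorphM /= horner_mx_X.
rewrite -/P -/P'; set B := B0 + _; set Q := horner_mx B p.
have PD : P *m D = D *m P by exact: horner_mx_comm.
have -> : Q *m B + c%:M - (P *m B0 + c%:M) - s%:C *: (D *m (P + P' * B0)) =
   (Q - P - s%:C *: (D *m P')) *m B + s%:C *: (s%:C *: (D *m P' *m D)).
  have E1 : P *m B = P *m B0 + s%:C *: (D *m P) by rewrite /B mulmxDr -scalemxAr PD.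
  have E2 : (s%:C *: (D *m P')) *m B = s%:C *: (D *m P' *m B0) + s%:C *: (s%:C *: (D *m P' *m D)).
    by rewrite /B mulmxDr -!scalemxAl -scalemxAr.
  have E3 : s%:C *: (D *m (P + P' * B0)) = s%:C *: (D *m P) + s%:C *: (D *m P' *m B0).
    by rewrite mulmxDr scalerDr mulmxA.
  rewrite !mulmxBl opprD addrACA subrr addr0 E1 E2 E3.
  have grp (a b e k l : 'M[R[i]]_n.+1) : a - b - (e + k) = a - (b + e) - (k + l) + l.
    by rewrite !opprD !addrA subrK.
  exact: grp.
apply: le_trans (mx1D _ _) _; rewrite mulrDl; apply: lerD.
  apply: le_trans (mx1M _ _) _; rewrite mulrAC; apply: ler_pM; rewrite ?mx1_ge0 ?HK //.
  apply: le_trans (mx1D _ _) _; rewrite lerD2l mx1Z ncR.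
  by rewrite ler_piMl ?mx1_ge0.
by rewrite scalerA -rcM mx1Z ncR -expr2 ger0_norm ?sqr_ge0 // mulrC.
Qed.

Variables (U H : set R[i]) (Kb : R).
Hypotheses (cH : cconvex H) (kH : compact (H : set R[i]^o)) (HU : H `<=` U).
Hypothesis (Kb0 : 0 <= Kb).

(** The matrices over which constants are uniform: a perturbation moves and may split eigenvalues,
    but they stay in the compact H, where every derivative of g is bounded. *)
Definition in_family B := spectrum B `<=` H /\ mx1 B <= Kb.

Lemma in_family_sub B : in_family B -> spectrum B `<=` U.
Proof. by move=> [BH _] x /BH /HU. Qed.

(** g(B) is the Newton interpolant of g at the n + 1 eigenvalues of B, evaluated at B; its
    coefficients are controlled by the derivatives of g on H. *)
Lemma matfun_bounded g : analytic_on U g ->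
  exists2 K, 0 <= K & forall B, in_family B -> mx1 (matfun U g B) <= K.
Proof.
move=> ag; have oU := analytic_open ag.
have [Ky Ky0 HKy] := analytic_bounded (analytic_horner 'X oU) HU kH.
have bd j : exists M : R, 0 <= M /\ forall x, H x -> nc (cderive j g x) <= M.
  by have [M M0 HM] := analytic_bounded (analytic_cderive j ag) HU kH; exists M.
have [M HM] := choice bd.
pose K0 := Kb + Ky * mx1 (1%:M : 'M[R[i]]_n.+1).
have K00 : 0 <= K0 by rewrite addr_ge0 // mulr_ge0 // mx1_ge0.
have [K K1 HK] := newton_bounded n n.+1 cH HU K00 (fun j => proj1 (HM j)).
exists K => // B fB; have [BH BK] := fB; have BU := in_family_sub fB.
have [s Bs sB] := spectrum_split B.
have aq : analytic_on U (ddl s g).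
  by apply: (analytic_ddl ag) => y ys; apply: BU; rewrite sB.
rewrite (matfunE (p := newton s g) ag aq BU); last by move=> x _; rewrite Bs -newtonE.
have sH y : y \in s -> H y by move=> ys; apply: BH; rewrite sB.
apply: HK => //.
- have := size_char_poly B; rewrite Bs /nodal size_prod_XsubC.
  by case.
- by move=> j; have [] := HM j.
move=> y /sH Hy; apply: le_trans (mx1D _ _) _; rewrite mx1N; apply: lerD => //.
have -> : y%:M = y *: (1%:M : 'M[R[i]]_n.+1) by rewrite scalemx1.
rewrite mx1Z ler_wpM2r ?mx1_ge0 //.
by have := HKy y Hy; rewrite hornerX.
Qed.

(** With g = p + chi q for chi the characteristic polynomial of the fixed B0, g(B) = p(B) + chi(B)
    q(B): both polynomials are Lipschitz, chi(B0) = 0 and q(B) is bounded. No commutation of B with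
    B0 enters. *)
Lemma matfun_lipschitz g B0 : analytic_on U g -> spectrum B0 `<=` U ->
  exists2 K, 0 <= K & forall B, in_family B ->
    mx1 (matfun U g B - matfun U g B0) <= K * mx1 (B - B0).
Proof.
move=> ag B0U; have oU := analytic_open ag.
have [p [q [aq gE ->]]] := matfun_rep ag B0U.
have [Kq Kq0 HKq] := matfun_bounded aq.
have [Kp Kp0 HKp] := horner_mx_lipschitz p B0 Kb0.
have [Kc Kc0 HKc] := horner_mx_lipschitz (char_poly B0) B0 Kb0.
exists (Kp + Kc * Kq); first by rewrite addr_ge0 ?mulr_ge0.
move=> B fB; have BU := in_family_sub fB; have [_ BK] := fB.
have ap r := analytic_horner r oU.
have -> : matfun U g B = horner_mx B p + horner_mx B (char_poly B0) *m matfun U q B.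
  rewrite (eq_matfun ag BU (h := fun x => p.[x] + (char_poly B0).[x] * q x)); last first.
    by move=> x _; exact: gE.
  by rewrite (matfunD (ap _) (analyticM (ap _) aq) BU) (matfunM (ap _) aq BU) !matfun_horner.
rewrite addrAC mulrDl; apply: le_trans (mx1D _ _) _; apply: lerD; first exact: HKp.
apply: le_trans (mx1M _ _) _; rewrite mulrAC; apply: ler_pM; rewrite ?mx1_ge0 ?HKq //.
by have := HKc B BK; rewrite Cayley_Hamilton subr0.
Qed.

(* Write g = p + chi ^ 2 q with chi = char_poly B0: the second term is O(s ^ 2)
   since chi(B0) = 0 and q is uniformly bounded on the family. *)
Lemma matfun_derivative g B0 D : analytic_on U g -> spectrum B0 `<=` U -> comm_mx B0 D ->
  exists2 K, 0 <= K & forall s : R, `|s| <= 1 -> in_family (B0 + s%:C *: D) ->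
    mx1 (matfun U g (B0 + s%:C *: D) - matfun U g B0 -
         s%:C *: (D *m matfun U (cderive 1 g) B0)) <= K * s ^+ 2.
Proof.
move=> ag B0U BD; have oU := analytic_open ag; have ap r := analytic_horner r oU.
have [ys Bs sB] := spectrum_split B0.
pose chi := char_poly B0.
have ysU y : y \in ys ++ ys -> U y.
  by move=> yy; apply: B0U; rewrite sB /=; move: yy; rewrite mem_cat orbb.
(* Listing each eigenvalue twice makes the nodal polynomial chi ^ 2. *)
pose p := newton (ys ++ ys) g; have [q qE] : exists q, q = ddl (ys ++ ys) g by eexists.
have aq : analytic_on U q by rewrite qE; exact: analytic_ddl.
have gE x : g x = p.[x] + chi.[x] * (chi.[x] * q x).
  by rewrite (newtonE (ys ++ ys)) -qE nodal_cat -Bs hornerM mulrA.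
have ac := analyticM (ap chi) aq.
have gE' B : spectrum B `<=` U -> matfun U g B =
    horner_mx B p + horner_mx B chi *m (horner_mx B chi *m matfun U q B).
  move=> BU; rewrite (eq_matfun ag BU (fun x _ => gE x)).
  rewrite (matfunD (ap _) (analyticM (ap _) ac) BU) (matfunM (ap _) ac BU).
  by rewrite (matfunM (ap _) aq BU) !matfun_horner.
(* The derivative of chi ^ 2 q is chi (2 chi' q + chi q'), so g' and p' agree modulo chi. *)
have g1 : matfun U (cderive 1 g) B0 = horner_mx B0 p^`().
  have aq' := analytic_cderive1 aq.
  have aQ := analyticD (analyticZ 2 (analyticM (ap chi^`()) aq)) (analyticM (ap chi) aq').
  apply: (matfunE (analytic_cderive1 ag) aQ B0U) => x Ux.
  have cc := cdiff_horner chi x.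
  have H1 := cdiffD (cdiff_horner p x)
    (cdiffM cc (cdiffM cc (analytic_cdiff aq Ux))).
  have -> : cderive 1 g x = cderive 1 (fun y => p.[y] + chi.[y] * (chi.[y] * q y)) x.
    by congr (cderive 1 _ x); apply/funext.
  rewrite (cdiff_derive1 H1) -/chi.
  by move: (cderive 1 q x) (q x) => ? ?; ring.
have [Kq Kq0 HKq] := matfun_bounded aq.
have [Kp Kp0 HKp] := horner_mx_derivative p BD.
have [Kc Kc0 HKc] := horner_mx_derivative chi BD.
have chi0 : horner_mx B0 chi = 0 by exact: Cayley_Hamilton.
pose Kd := Kc + mx1 (D *m horner_mx B0 chi^`()).
have Kd0 : 0 <= Kd by rewrite addr_ge0 ?mx1_ge0.
exists (Kp + Kd * (Kd * Kq)); first by rewrite addr_ge0 ?mulr_ge0.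
move=> s s1 fB; have BU := in_family_sub fB.
rewrite (gE' _ BU) (gE' _ B0U) chi0 mul0mx addr0 g1.
have c1 : mx1 (horner_mx (B0 + s%:C *: D) chi) <= Kd * `|s|.
  have := HKc s s1; rewrite chi0 subr0 => h.
  rewrite -(subrK (s%:C *: (D *m horner_mx B0 chi^`())) (horner_mx _ chi)).
  apply: le_trans (mx1D _ _) _; rewrite mx1Z ncR mulrDl [`|s| * _]mulrC lerD2r.
  apply: le_trans h _; rewrite ler_wpM2l // -real_normK ?num_real // expr2.
  by rewrite ler_piMl.
have grp (a b c d : 'M[R[i]]_n.+1) : a + b - c - d = a - c - d + b.
  by rewrite (addrAC a b) (addrAC (a - c) b).
rewrite grp; apply: le_trans (mx1D _ _) _.
rewrite mulrDl; apply: lerD; first exact: HKp.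
have -> : Kd * (Kd * Kq) * s ^+ 2 = Kd * `|s| * (Kd * `|s| * Kq).
  by rewrite -real_normK ?num_real //; ring.
apply: le_trans (mx1M _ _) _; apply: ler_pM; rewrite ?mx1_ge0 //.
by apply: le_trans (mx1M _ _) _; apply: ler_pM; rewrite ?mx1_ge0 ?HKq.
Qed.
End Matfun.

Local Opaque matfun.

Lemma matfun_leibniz (R : realType) n (U : set R[i]) (B : 'M[R[i]]_n.+1) (c y : R[i])
    (e0 e1 e2 : R[i] -> R[i]) : spectrum B `<=` U ->
  analytic_on U e0 -> analytic_on U e1 -> analytic_on U e2 ->
  (forall x, U x -> e2 x = c * e0 x + (x - y) * e1 x) ->
  matfun U e2 B = c *: matfun U e0 B + (B - y%:M) *m matfun U e1 B.
Proof.
move=> BU a0 a1 a2 e2E; have oU := analytic_open a0; have ap r := analytic_horner r oU.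
pose h x := (c%:P : {poly R[i]}).[x] * e0 x + ('X - y%:P).[x] * e1 x.
have e2h x : U x -> e2 x = h x by move=> Ux; rewrite e2E // /h hornerC hornerXsubC.
rewrite (eq_matfun a2 BU e2h) (matfunD (analyticM (ap _) a0) (analyticM (ap _) a1) BU).
rewrite (matfunM (ap _) a0 BU) (matfunM (ap _) a1 BU) !(matfun_horner _ oU BU).
by rewrite horner_mx_C rmorphB /= horner_mx_X horner_mx_C mul_scalar_mx.
Qed.

(** * The error bound *)

Section HermiteGenocchi.
Variables (R : realType) (n : nat) (U H : set R[i]) (Kb : R).
Implicit Types (y : R[i]) (g : R[i] -> R[i]) (s : seq R[i]) (B X : 'M[R[i]]_n.+1).
Hypotheses (cH : cconvex H) (kH : compact (H : set R[i]^o)) (HU : H `<=` U).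
Hypothesis Kb0 : 0 <= Kb.
Variable F : set 'M[R[i]]_n.+1.
Hypothesis F_family : forall B, F B -> in_family H Kb B.
Variables (nr : 'M[R[i]]_n.+1 -> R) (Kn : R).
Hypothesis nrD : forall X Y, nr (X + Y) <= nr X + nr Y.
Hypothesis nrZ : forall (a : R[i]) X, nr (a *: X) = Normc.normc a * nr X.
Hypotheses (Kn0 : 0 <= Kn) (nr_mx1 : forall X, nr X <= Kn * mx1 X).

(** To bound a divided difference at B, the derivative of g must be bounded on the whole segment
    from y to B; F is a set closed under these contractions. *)
Definition star_at y := forall B t, F B -> 0 <= t <= 1 -> F (y%:M + t%:C *: (B - y%:M)).

(* [max_principle] on the segment from y to B; this replaces the formula
   (dd g y)^(j) (x) = integral over t in [0, 1] of t^j g^(j+1) (y + t (x - y)). *)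
Lemma matfun_dd_le g y j (m : R) : analytic_on U g -> H y -> star_at y ->
  (forall B, F B -> nr (matfun U (cderive j.+1 g) B) <= j.+1%:R * m) ->
  forall B, F B -> nr (matfun U (cderive j (dd g y)) B) <= m.
Proof.
move=> ag Hy sy gm B FB; have Uy := HU Hy; have oU := analytic_open ag.
have ae := analytic_cderive j (analytic_dd ag Uy).
have ae' := analytic_cderive j.+1 (analytic_dd ag Uy).
pose D := B - y%:M; pose Bt (t : R) := y%:M + t%:C *: D.
have FBt t : 0 <= t <= 1 -> F (Bt t) by exact: sy.
have BtU t : 0 <= t <= 1 -> spectrum (Bt t) `<=` U.
  by move=> t01; exact (in_family_sub HU (F_family (FBt t t01))).
have B1 : Bt 1 = B by rewrite /Bt rc1 scale1r addrC subrK.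
have BtD t : comm_mx (Bt t) D.
  by rewrite /comm_mx /Bt (mulmxDl y%:M) (mulmxDr D) scalar_mxC -scalemxAl -scalemxAr.
have BtB (s t : R) : Bt s = Bt t + (s - t)%:C *: D.
  by rewrite /Bt -addrA -scalerDl -rcD addrCA subrr addr0.
rewrite -B1.
apply: (@max_principle R _ nr nrD nrZ (fun t => matfun U (cderive j (dd g y)) (Bt t))
  (fun t => D *m matfun U (cderive j.+1 (dd g y)) (Bt t)) j) => [t t01 e e0|t t01].
  have [K K0 HK] := matfun_derivative cH kH HU Kb0 ae (BtU t t01) (BtD t).
  pose Q := Kn * K + 1; have Q0 : 0 < Q by rewrite ltr_wpDl // mulr_ge0.
  exists (Num.min 1 (e / Q)); first by rewrite lt_min ltr01 divr_gt0.
  move=> s s01; rewrite lt_min [_ < e / Q]ltr_pdivlMr // => /andP[st1 stQ].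
  apply: le_trans (nr_mx1 _) _.
  have fs : in_family H Kb (Bt t + (s - t)%:C *: D) by rewrite -BtB; exact: F_family (FBt s s01).
  have := HK (s - t) (ltW st1) fs; rewrite -BtB -cderiveS => h.
  apply: le_trans (ler_wpM2l Kn0 h) _.
  rewrite -real_normK ?num_real // expr2 !mulrA; apply: ler_wpM2r => //.
  apply: le_trans (ltW stQ); rewrite mulrC ler_wpM2l // /Q lerDl //.
have tD : t%:C *: D = Bt t - y%:M by rewrite /Bt addrC addKr.
have gh x : U x ->
    cderive j.+1 g x = j.+1%:R * cderive j (dd g y) x + (x - y) * cderive j.+1 (dd g y) x.
  by move=> Ux; exact: cderive_dd ag Uy Ux.
have L := matfun_leibniz (BtU t t01) ae ae' (analytic_cderive j.+1 ag) gh.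
rewrite -tD -scalemxAl in L.
exact (eq_ind _ (fun X => nr X <= j.+1%:R * m) (gm _ (FBt t t01)) _ L).
Qed.

(** Each node trades one derivative for one factor of the factorial: [matfun_dd_le] is applied at
    order size s + j, with (size s + j)! m as its m. *)
Lemma matfun_ddl_le s g j (m : R) : analytic_on U g ->
  (forall y, y \in s -> H y) -> (forall y, y \in s -> star_at y) ->
  (forall B, F B -> nr (matfun U (cderive (size s + j) g) B) <= ((size s + j)`!)%:R * m) ->
  forall B, F B -> nr (matfun U (cderive j (ddl s g)) B) <= (j`!)%:R * m.
Proof.
elim: s g => [|y s IHs] g ag sH st gm; first exact: gm.
have Hy : H y by apply: sH; exact: mem_head.
apply: (IHs _ (analytic_dd ag (HU Hy))) => [x xs|x xs|].
- by apply: sH; rewrite inE xs orbT.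
- by apply: st; rewrite inE xs orbT.
apply: (matfun_dd_le ag Hy) => [|B FB]; first by apply: st; exact: mem_head.
have := gm B FB; rewrite [size _]/= addSn factS natrM mulrA.
exact.
Qed.
End HermiteGenocchi.

(** * The matrices (1 - t) mu + t A *)

Section Segments.
Variables (R : realType) (n : nat) (A : 'M[R[i]]_n.+1).
Implicit Types (t : R) (mu : R[i]).

Definition segment_mx t mu : 'M[R[i]]_n.+1 := ((1 - t)%:C * mu)%:M + t%:C *: A.

(** For t != 0 an eigenvector of the segment matrix is one of A, with eigenvalue l such that y = (1
    - t) mu + t l; for t = 0 the only eigenvalue is mu. *)
Lemma spectrum_segment (H : set R[i]) t mu : cconvex H -> H mu -> spectrum A `<=` H ->
  0 <= t <= 1 -> spectrum (segment_mx t mu) `<=` H.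
Proof.
move=> cH Hmu AH t01 y /eigenvalueP[w wB w0].
move: wB; rewrite /segment_mx mulmxDr mul_mx_scalar -scalemxAr => E.
have [t0|t0] := eqVneq t 0.
  move: E; rewrite t0 scale0r addr0 subr0 rc1 mul1r => /eqP.
  by rewrite -subr_eq0 -scalerBl scaler_eq0 (negbTE w0) orbF subr_eq0 => /eqP <-.
have tC : t%:C != 0 :> R[i] by rewrite -nc_eq0 ncR normr_eq0.
pose l := (y - (1 - t)%:C * mu) / t%:C.
have -> : y = (1 - t)%:C * mu + t%:C * l by rewrite /l mulrCA divff // mulr1 addrC subrK.
apply: cH => //; apply: AH; apply/eigenvalueP; exists w => //.
apply: (scalerI tC); rewrite scalerA /l mulrCA divff // mulr1 scalerBl -E.
by rewrite addrC addKr.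
Qed.

(** Contraction towards y leaves A the coefficient s t and gives the scalar part total weight 1 - s
    t; normalised, it is a point mu' between y and mu. If s t = 1 then s = t = 1 and mu' = mu. So
    averaging over several nodes creates no new matrices. *)
Lemma segment_star (M : set R[i]) y t s mu : cconvex M -> M y -> M mu ->
  0 <= t <= 1 -> 0 <= s <= 1 ->
  exists2 mu', M mu' & y%:M + s%:C *: (segment_mx t mu - y%:M) = segment_mx (s * t) mu'.
Proof.
move=> cM My Mmu /andP[t0 t1] /andP[s0 s1].
have E : y%:M + s%:C *: (segment_mx t mu - y%:M) =
    ((1 - s)%:C * y + s%:C * ((1 - t)%:C * mu))%:M + (s * t)%:C *: A.
  apply/matrixP => i k; rewrite /segment_mx !mxE.
  by case: (i == k); rewrite ?mulr1n ?mulr0n ?rcB !rcM ?rc1; ring.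
have st1 : s * t <= 1 by rewrite mulr_ile1.
have [st|st] := eqVneq (s * t) 1.
  have s1' : s = 1 by apply/eqP; rewrite eq_le s1 -st ler_piMr.
  have t1' : t = 1 by move: st; rewrite s1' mul1r.
  by exists mu => //; rewrite E /segment_mx s1' t1' mulr1 !subrr !mul0r mulr0 add0r.
pose d := 1 - s * t; have d0 : 0 < d by rewrite subr_gt0 lt_neqAle st.
pose th := s * (1 - t) / d.
have th01 : 0 <= th <= 1.
  rewrite divr_ge0 ?mulr_ge0 ?subr_ge0 ?(ltW d0) //= ler_pdivrMr // mul1r /d mulrBr mulr1.
  by rewrite lerD2r.
have dth : d * th = s * (1 - t) by rewrite /th mulrC divfK ?gt_eqF.
exists ((1 - th)%:C * y + th%:C * mu); first exact: cM.
rewrite E /segment_mx; congr (_%:M + _).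
rewrite mulrDr !mulrA -!rcM -/d dth; congr (_%:C * _ + _).
by rewrite mulrBr mulr1 dth /d; ring.
Qed.
End Segments.

(** The matrix depends continuously on (t, mu), so a Lipschitz bound in the matrix at each point
    suffices. *)
Lemma continuous_segment_mx (R : realType) (n : nat) (A : 'M[R[i]]_n.+1) (rhs : R -> R[i] -> R)
    (T : set (R * R[i]^o)) :
  (forall u0, T u0 -> exists2 K : R, 0 <= K & forall u, T u ->
     `|rhs u.1 u.2 - rhs u0.1 u0.2| <= K * mx1 (segment_mx A u.1 u.2 - segment_mx A u0.1 u0.2)) ->
  {within T, continuous (fun u => rhs u.1 u.2)}.
Proof.
move=> lip; apply/subspace_continuousP => u0 Tu0.
have [K K0 HK] := lip u0 Tu0; apply/cvgrPdist_lt => e e0.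
pose a := mx1 (1%:M : 'M[R[i]]_n.+1); pose b := mx1 A.
have a0 : 0 <= a by exact: mx1_ge0.
have b0 : 0 <= b by exact: mx1_ge0.
pose Q := K * (a + b) + 1; have Q0 : 0 < Q by rewrite ltr_wpDl // mulr_ge0 // addr_ge0.
have d0 : 0 < e / Q by rewrite divr_gt0.
have c1 : {for u0, continuous (fun u : R * R[i]^o => u.1)} by exact: cvg_fst.
have c2 : ccts (fun u : R * R[i]^o => u.2) u0 by exact: cvg_snd.
have c3 : ccts (fun u : R * R[i]^o => u.1%:C) u0.
  exact: (@ccts_real R _ (fun u : R * R[i]^o => u.1)).
have c4 : ccts (fun u : R * R[i]^o => (1 - u.1%:C) * u.2) u0.
  have c5 := @cctsB R _ (fun=> 1) (fun u : R * R[i]^o => u.1%:C) u0 (@ccts_cst R _ 1 u0) c3.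
  exact: (@cctsM R _ (fun u : R * R[i]^o => 1 - u.1%:C) (fun u => u.2) u0 c5 c2).
move/cctsP: c3 => /(_ _ d0) c3; move/cctsP: c4 => /(_ _ d0) c4.
rewrite near_withinE; apply: filterS2 c3 c4 => u h3 h4 Tu.
rewrite distrC; apply: le_lt_trans (HK u Tu) _.
have h : mx1 (segment_mx A u.1 u.2 - segment_mx A u0.1 u0.2) <= e / Q * (a + b).
  have -> : segment_mx A u.1 u.2 - segment_mx A u0.1 u0.2 =
    ((1 - u.1%:C) * u.2 - (1 - u0.1%:C) * u0.2) *: 1%:M + (u.1%:C - u0.1%:C) *: A.
    apply/matrixP => i k; rewrite /segment_mx !mxE.
    by case: (i == k); rewrite ?mulr1n ?mulr0n ?rcB ?rc1; ring.
  apply: le_trans (mx1D _ _) _; rewrite !mx1Z mulrDr.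
  by apply: lerD; rewrite ler_wpM2r // ltW.
apply: le_lt_trans (ler_wpM2l K0 h) _.
have -> : K * (e / Q * (a + b)) = e * ((Q - 1) / Q) by rewrite /Q addrK; ring.
by rewrite gtr_pMr // ltr_pdivrMr // mul1r ltrBlDr ltrDl.
Qed.

(** The maximum is stated as an attained upper bound, so its existence is part of the claim. r(A) is
    taken over the set where v does not vanish, since v may have zeros in U away from the nodes and
    the spectrum. *)
Theorem corollary14 (R : realType) (n N L M : nat) (A : 'M[R[i]]_n.+1)
    (z : N.-tuple R[i]) (U : set R[i]) (f : R[i] -> R[i])
    (u v : {poly R[i]}) (nrm : 'M[R[i]]_n.+1 -> R)
    (N_gt0 : (0 < N)%N)
    (f_analytic : analytic_on U f)
    (hullU : co (spectrum A `|` [set` z]) `<=` U)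
    (deg_u : (size u <= L.+1)%N)
    (deg_v : (size v <= M.+1)%N)
    (L_le : (L <= N.-1)%N)
    (r_interp : interpolates z f (ratfun u v))
    (v_z : forall x : R[i], x \in z -> v.[x] != 0)
    (v_A : forall x : R[i], spectrum A x -> v.[x] != 0)
    (nrm_norm : is_norm nrm) :
  let Omega : {poly R[i]} := \prod_(x <- z) ('X - x%:P) in
  let rhs (t : R) (mu : R[i]) : R :=
    nrm (horner_mx A Omega *m invmx (horner_mx A v) *m
         ((N`!%:R)^-1 *:
          matfun U (cderive N (fun x => v.[x] * f x))
            (((1 - t)%:C * mu)%:M + t%:C *: A))) in
  let values : set R := [set rhs t mu | t in `[0, 1] & mu in co [set` z]] in
  exists m : R,
    [/\ values m, ubound values m &
        nrm (matfun U f A - matfun [set x | v.[x] != 0] (ratfun u v) A) <= m].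
Proof.
move=> Omega rhs values.
have oU := analytic_open f_analytic.
have [sA As sAE] := spectrum_split A.
pose zs : seq R[i] := z.
have zsE : [set` z] = [set` zs] by [].
have zs_size : size zs = N by exact: size_tuple.
(* [hull] needs a first point, which N > 0 supplies. *)
have [z0 [zs' zE]] : exists z0 zs', zs = z0 :: zs'.
  by move: zs_size N_gt0; case: (zs) => [<-|z0 zs' _ _] //; exists z0, zs'.
pose K := co [set` z]; pose H := co (spectrum A `|` [set` z]).
have cK : cconvex K by exact: co_cconvex.
have cH : cconvex H by exact: co_cconvex.
have zK x : x \in zs -> K x by move=> xz; exact: (@sub_co R [set` z]).
have zH x : x \in zs -> H x by move=> xz; apply: (@sub_co R); right.
have AH : spectrum A `<=` H by move=> x xA; apply: (@sub_co R); left.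
have KH : K `<=` H by apply: co_min => // x xz; exact: zH.
have kK : compact (K : set R[i]^o).
  by rewrite /K zsE zE hull_co; exact: compact_hull.
have kH : compact (H : set R[i]^o).
  rewrite /H (_ : _ `|` _ = [set` z0 :: (zs' ++ sA)]) ?hull_co; first exact: compact_hull.
  rewrite sAE zsE zE; apply/seteqP; split=> x /=; rewrite !inE mem_cat.
    by move=> [->|/orP[->|->]]; rewrite ?orbT.
  by move=> /orP[->|/orP[->|->]]; rewrite ?orbT; [right|right|left].
have HU : H `<=` U := hullU.
have AU : spectrum A `<=` U by move=> x /AH /HU.
have ap r := analytic_horner r oU.
have [Ky Ky0 HKy] := analytic_bounded (ap 'X) HU kH.
pose Kb := Ky * mx1 (1%:M : 'M[R[i]]_n.+1) + mx1 A.
have Kb0 : 0 <= Kb by rewrite addr_ge0 ?mulr_ge0 ?mx1_ge0.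
(* Contains A (t = 1) and is star-shaped about every node, so the bound over t and mu is exactly the
   hypothesis of the induction over the nodes. *)
pose F := [set B | exists t mu, [/\ 0 <= t <= 1, K mu & B = segment_mx A t mu]].
have F_family B : F B -> in_family H Kb B.
  move=> [t [mu [t01 Kmu ->]]]; split.
    exact: spectrum_segment cH (KH _ Kmu) AH t01.
  have /andP[t0 t1] := t01.
  apply: le_trans (mx1D _ _) _; apply: lerD.
    rewrite -scalemx1 mx1Z ler_wpM2r ?mx1_ge0 // ncM ncR ger0_norm ?subr_ge0 //.
    have := HKy mu (KH _ Kmu); rewrite hornerX; apply: le_trans.
    by rewrite ler_piMl ?nc_ge0 // gerBl.
  by rewrite mx1Z ncR ger0_norm // ler_piMl ?mx1_ge0.
have F_star y : y \in zs -> star_at F y.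
  move=> yz B t [t' [mu [t'01 Kmu ->]]] t01.
  have [mu' Kmu' ->] := segment_star A cK (zK _ yz) Kmu t'01 t01.
  exists (t * t'), mu'; split=> //.
  by move: t01 t'01 => /andP[? ?] /andP[? ?]; rewrite mulr_ge0 ?mulr_ile1.
have FA : F A.
  exists 1, z0; split; [by rewrite ler01 lexx|by apply: zK; rewrite zE mem_head|].
  by rewrite /segment_mx subrr mul0r rc1 scale1r raddf0 add0r.
have avf := analyticM (ap v) f_analytic.
(* Analytic on all of U, unlike f - r, which may have poles where v vanishes. *)
pose g1 x := v.[x] * f x - u.[x].
have ag1 : analytic_on U g1 by exact: analyticB avf (ap u).
pose V := [set x : R[i] | v.[x] != 0].
have oV : open (V : set R[i]^o) by exact: open_horner_neq0.
have oW : open ((U `&` V) : set R[i]^o) by exact: openI.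
have afW : analytic_on (U `&` V) f by apply: analytic_sub f_analytic => // x [].
have arV := analytic_ratfun u v.
have arW : analytic_on (U `&` V) (ratfun u v) by apply: analytic_sub arV => // x [].
have zW x : x \in zs -> (U `&` V) x by move=> xz; split; [exact: HU _ (zH _ xz)|exact: v_z].
have g1W x : (U `&` V) x -> v.[x] * (f x - ratfun u v x) = g1 x.
  by move=> [_ vx]; rewrite /g1 /ratfun mulrBr [_ * (_ / _)]mulrC divfK.
(* f - r vanishes to the required order by interpolation, v (f - r) does too, and it equals g1 on U
   [&] V, an open set containing the nodes. *)
have g1z x : x \in zs -> vanishes g1 x (count_mem x zs).
  move=> xz; have Wx := zW _ xz.
  have w0 : vanishes (fun x => f x - ratfun u v x) x (count_mem x zs).
    move=> j jc; rewrite (cderiveB j afW arW Wx) (r_interp _ j xz jc).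
    by rewrite subrr.
  have vw0 := vanishes_mul (analyticB afW arW) (analytic_horner v oW) Wx w0.
  move=> j jc; rewrite -(vw0 j jc); apply/esym.
  have avw := analyticM (analytic_horner v oW) (analyticB afW arW).
  exact: eq_cderive avw g1W x Wx.
have ag1W : analytic_on (U `&` V) g1 by apply: analytic_sub ag1 => // x [].
have nw0 := newton_vanishes ag1W zW g1z.
have [h hE] : exists h, h = ddl zs g1 by eexists.
have zU x : x \in zs -> U x by move=> xz; exact: HU _ (zH _ xz).
have ah : analytic_on U h by rewrite hE; exact: analytic_ddl ag1 zU.
have g1h x : g1 x = Omega.[x] * h x.
  by rewrite (newtonE zs) nw0 horner0 add0r -hE.
have AV : spectrum A `<=` V by exact: v_A.
have apV r := analytic_horner r oV.
have vr : horner_mx A v *m matfun V (ratfun u v) A = horner_mx A u.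
  rewrite -!(matfun_horner _ oV AV) -(matfunM (apV v) arV AV).
  apply: (eq_matfun (analyticM (apV v) arV) AV) => x vx.
  by rewrite /ratfun mulrC divfK.
(* The inverse is (1 / v)(A), by multiplicativity of the functional calculus on V. *)
have vunit : horner_mx A v \in unitmx.
  have a1V := analytic_ratfun 1 v.
  have : horner_mx A v *m matfun V (ratfun 1 v) A = 1%:M.
    rewrite -(matfun_horner _ oV AV) -(matfunM (apV v) a1V AV).
    rewrite (eq_matfun (analyticM (apV v) a1V) AV (h := fun x => (1 : {poly R[i]}).[x])).
      by rewrite (matfun_horner _ oV AV) rmorph1.
    by move=> x vx; rewrite /ratfun mulrC divfK.
  by case/mulmx1_unit.
pose C := horner_mx A Omega *m invmx (horner_mx A v).
(* f(A) is formed over U and r(A) over V. Multiplied by v(A) the latter becomes u(A), a polynomial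
   in A and hence the same over either set. *)
have main : matfun U f A - matfun V (ratfun u v) A = C *m matfun U h A.
  have e1 : horner_mx A v *m matfun U f A - horner_mx A u = horner_mx A Omega *m matfun U h A.
    rewrite -(matfun_horner Omega oU AU) -(matfunM (ap _) ah AU).
    rewrite -(eq_matfun ag1 AU (fun x _ => g1h x)).
    rewrite -(matfun_horner v oU AU) -(matfunM (ap _) f_analytic AU).
    rewrite -(matfun_horner u oU AU).
    have -> : matfun U g1 A = matfun U (fun x => v.[x] * f x + (- u).[x]) A.
      by apply: (eq_matfun ag1 AU) => x _; rewrite hornerN.
    rewrite (matfunD avf (ap _) AU) !(matfun_horner _ oU AU).
    by rewrite rmorphN.
  apply: (can_inj (mulKmx vunit)); rewrite mulmxBr vr e1 /C !mulmxA.
  have -> : horner_mx A v *m horner_mx A Omega = horner_mx A Omega *m horner_mx A v.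
    exact: comm_horner_mx2.
  by rewrite mulmxK.
case: (nrm_norm) => _ nZ nD.
have [Kn Kn0 nKn] := is_norm_le_mx1 nrm_norm.
(* The fixed factor Omega(A) v(A)^-1 is absorbed into a seminorm, so that only the divided
   difference has to be averaged. *)
pose nr X := nrm (C *m X).
have nrD X Y : nr (X + Y) <= nr X + nr Y by rewrite /nr mulmxDr.
have nrZ (a : R[i]) X : nr (a *: X) = Normc.normc a * nr X by rewrite /nr -scalemxAr nZ.
have nr_mx1 X : nr X <= (Kn * mx1 C) * mx1 X.
  by apply: le_trans (nKn _) _; rewrite -mulrA ler_wpM2l // mx1M.
have KC0 : 0 <= Kn * mx1 C by rewrite mulr_ge0 ?mx1_ge0.
have N0 : 0 < N`!%:R :> R by rewrite ltr0n fact_gt0.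
have aG := analytic_cderive N avf.
have rhsE t mu : rhs t mu =
    (N`!%:R)^-1 * nr (matfun U (cderive N (fun x => v.[x] * f x)) (segment_mx A t mu)).
  rewrite /rhs -scalemxAr nZ ncV -rc_nat ncR normr_nat.
  by [].
pose T : set (R * R[i]^o) := `[0, 1] `*` K.
have kT : compact T by apply: compact_setX => //; exact: segment_compact.
have T0 : T !=set0.
  by exists (1, z0); split; [rewrite /= in_itv /= ler01 lexx|apply: zK; rewrite zE mem_head].
have TF p : T p -> F (segment_mx A p.1 p.2).
  by move=> [/=]; rewrite in_itv /= => t01 Kp; exists p.1, p.2.
have cT : {within T, continuous (fun p => rhs p.1 p.2)}.
  apply: (@continuous_segment_mx R n A) => p0 Tp0.
  have B0U := in_family_sub HU (F_family _ (TF _ Tp0)).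
  have [Kl Kl0 HKl] := matfun_lipschitz cH kH HU Kb0 aG B0U.
  exists ((N`!%:R)^-1 * (Kn * mx1 C * Kl)); first by apply: mulr_ge0; [rewrite invr_ge0 ltW|exact: mulr_ge0].
  move=> p Tp; rewrite !rhsE -mulrBr normrM ger0_norm ?invr_ge0 ?(ltW N0) //.
  rewrite -[leRHS]mulrA; apply: ler_wpM2l; first by rewrite invr_ge0 ltW.
  move: (HKl _ (F_family _ (TF _ Tp))).
  move: (matfun _ _ (segment_mx A p.1 p.2)) (matfun _ _ (segment_mx A p0.1 p0.2)) => G G0 GG0.
  have GG : `|nr G - nr G0| <= nr (G - G0).
    rewrite ler_norml; apply/andP; split; last exact: seminorm_sub nrD _ _.
    by rewrite lerNl opprB (seminormB nrZ); exact: seminorm_sub nrD _ _.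
  apply: le_trans GG _; apply: le_trans (nr_mx1 _) _.
  by rewrite -[leRHS]mulrA; apply: ler_wpM2l.
have [[t0 mu0] Tc cmax] := compact_EVT_max T0 kT cT.
exists (rhs t0 mu0); split.
- by move: Tc; rewrite inE => -[/= ? ?]; exists t0 => //; exists mu0.
- move=> _ [t t01 [mu Kmu <-]]; apply: (cmax (t, mu)).
  by rewrite inE; split.
rewrite main -/(nr _) hE -(cderive0 (ddl zs g1)).
(* With j = 0 and the maximum as m: a bound N! m on the N-th derivative over F becomes m for the
   divided difference at A. *)
have := @matfun_ddl_le R n U H Kb cH kH HU Kb0 F F_family nr (Kn * mx1 C) nrD nrZ KC0 nr_mx1
  zs g1 0 (rhs t0 mu0) ag1 zH F_star.
rewrite addn0 zs_size => /(_ _ A FA); rewrite fact0 mul1r; apply.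
move=> B [t [mu [t01 Kmu ->]]].
have BU := in_family_sub HU (F_family (segment_mx A t mu) ltac:(by exists t, mu)).
(* The degree of u is at most L <= N - 1, so its N-th derivative is 0. *)
have gN x : U x -> cderive N g1 x = cderive N (fun x => v.[x] * f x) x.
  move=> Ux; rewrite /g1 (cderiveB N avf (ap u) Ux) (cderive_horner_small x) ?subr0 //.
  by apply: leq_trans deg_u _; rewrite -(prednK N_gt0) ltnS.
have -> : matfun U (cderive N g1) (segment_mx A t mu) =
   matfun U (cderive N (fun x => v.[x] * f x)) (segment_mx A t mu).
  exact: eq_matfun (analytic_cderive N ag1) BU gN.
have Tt : T (t, mu) by split=> //=; rewrite in_itv.
have := cmax (t, mu); rewrite inE => /(_ Tt) /=.
by rewrite (rhsE t mu) ler_pdivrMl.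
Qed.
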